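(* There is a hereditary class $\mathcal{C}$ of graphs such that FO model checking on $\mathcal{C}$ is FPT, $\mathcal{C}$ has unbounded twin-width and unbounded merge-width, and such that for every connected graph $H$ containing at least two cycles, every graph in $\mathcal{C}$ is an $H$-graph.
   Context: For a graph $H$, an $H$-graph is the intersection graph of a family of connected subsets of the topological realisation of $H$ (vertices as points, edges as arcs joining their endpoints); two subsets are adjacent iff they intersect. A class is hereditary if closed under induced subgraphs. Twin-width: in a graph $G$, vertex sets $X,Y$ are non-homogeneous if there are both an edge and a non-edge between them. For a partition $\mathcal{P}$ of $V(G)$, the error graph has the parts as vertices, two distinct parts adjacent iff non-homogeneous; the error degree is its maximum degree. A contraction sequence is a sequence of partitions from singletons to $\{V(G)\}$, each obtained by merging two parts of the previous; its width is the maximum error degree; $\mathsf{tww}(G)$ is the minimum width. Merge-width: a construction sequence for $G=(V,E)$ is a sequence $(\mathcal{P}_1,E_1,N_1),\dots,(\mathcal{P}_m,E_m,N_m)$ of partitions $\mathcal{P}_t$ of $V$ and disjoint sets $E_t,N_t$ of vertex pairs, with $\mathcal{P}_1$ the singletons and $E_1=N_1=\emptyset$; each step either merges two parts, or for two parts $X,Y\in\mathcal{P}_t$ (possibly $X=Y$) adds all pairs $\{x,y\}$ ($x\in X,y\in Y$) not yet in $E_t\cup N_t$ to $E_{t+1}$ (positive resolution) or to $N_{t+1}$ (negative resolution); it ends with $\mathcal{P}_m=\{V\}$, all pairs resolved and $E_m=E$. With $R_t=E_t\cup N_t$, its radius-$r$ width is the maximum over $t$ and $v\in V$ of the number of parts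 of $\mathcal{P}_t$ containing a vertex at distance at most $r$ from $v$ in the graph $(V,R_t)$. $\mathsf{mw}_r(G)$ is the minimum radius-$r$ width of a construction sequence for $G$. A class has bounded merge-width if there is $f$ with $\mathsf{mw}_r(G)\le f(r)$ for all $r\in\mathbb{N}$ and all $G$ in the class. FO model checking on $\mathcal{C}$: given $G\in\mathcal{C}$ and a first-order sentence $\phi$ over graphs, decide $G\models\phi$; FPT means time $f(|\phi|)\cdot|G|^{O(1)}$ for computable $f$. *)

(* Defs.v *)
From mathcomp Require Import all_boot.

Set Implicit Arguments.
Unset Strict Implicit.
Unset Printing Implicit Defensive.

Record sgraph := SGraph {
  vertex :> finType;
  adj : rel vertex;
  adj_sym : symmetric adj;
  adj_irr : irreflexive adj }.

(* Up to isomorphism: [G] is isomorphic to an induced subgraph of [G']. *)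
Definition induced_subgraph (G G' : sgraph) : Prop :=
  exists h : G -> G', injective h /\ forall x y, adj (h x) (h y) = adj x y.

Definition hereditary (C : sgraph -> Prop) : Prop :=
  forall G G', C G' -> induced_subgraph G G' -> C G.

Definition connected_graph (G : sgraph) : Prop :=
  0 < #|G| /\ forall x y : G, connect (@adj G) x y.

Definition is_cycle (G : sgraph) (c : seq G) : Prop :=
  2 < size c /\ ucycle (@adj G) c.

Definition cycle_edges (G : sgraph) (c : seq G) : {set {set G}} :=
  [set [set x; next c x] | x in c].

(* A cycle is a subgraph, so cyclic sequences differing by a rotation or a
   reversal are the same cycle; the edge set identifies it. *)
Definition at_least_two_cycles (G : sgraph) : Prop :=
  exists c1 c2 : seq G,
    [/\ is_cycle c1, is_cycle c2 & cycle_edges c1 != cycle_edges c2].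

Section Partitions.
Variable V : finType.
Implicit Types P Q : {set {set V}}.

Definition singletons : {set {set V}} := [set [set x] | x : V].

(* The one-block partition [{V}]; it is the empty partition when [V] is empty,
   so that the empty graph also has contraction and construction sequences. *)
Definition one_block : {set {set V}} := [set setT] :\ set0.

Definition merge_step P Q : bool :=
  [exists X in P, exists Y in P,
    (X != Y) && (Q == (X :|: Y) |: (P :\ X :\ Y))].

End Partitions.

Section TwinWidth.
Variable G : sgraph.
Implicit Types (X Y : {set G}) (P : {set {set G}}) (s : seq {set {set G}}).

Definition non_homogeneous X Y : bool :=
  [exists x in X, exists y in Y, adj x y]
  && [exists x in X, exists y in Y, ~~ adj x y].

Definition error_degree P : nat :=
  \max_(X in P) #|[set Y in P | (Y != X) && non_homogeneous X Y]|.

(* [s] lists the partitions that follow the initial one. *)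
Definition contraction_seq s : bool :=
  path (@merge_step G) (singletons G) s && (last (singletons G) s == one_block G).

Definition contraction_width s : nat :=
  \max_(P <- singletons G :: s) error_degree P.

End TwinWidth.

Section MergeWidth.
Variable G : sgraph.

Definition edges : {set {set G}} := [set [set e.1; e.2] | e : G * G & adj e.1 e.2].

Definition pairs_between (X Y : {set G}) : {set {set G}} :=
  [set [set e.1; e.2] | e : G * G & [&& e.1 \in X, e.2 \in Y & e.1 != e.2]].

Record mw_state := MwState {
  mw_part : {set {set G}};
  mw_E : {set {set G}};
  mw_N : {set {set G}} }.
Implicit Types (s t : mw_state).

Definition mw_R s : {set {set G}} := mw_E s :|: mw_N s.

Definition mw_init : mw_state := MwState (singletons G) set0 set0.

Definition mw_final s : bool :=
  [&& mw_part s == one_block G, mw_R s == pairs_between setT setT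
    & mw_E s == edges].

Definition mw_merge s t : bool :=
  [&& merge_step (mw_part s) (mw_part t), mw_E t == mw_E s & mw_N t == mw_N s].

Definition mw_positive s t : bool :=
  [exists X in mw_part s, exists Y in mw_part s,
    [&& mw_part t == mw_part s,
        mw_E t == mw_E s :|: (pairs_between X Y :\: mw_R s)
      & mw_N t == mw_N s]].

Definition mw_negative s t : bool :=
  [exists X in mw_part s, exists Y in mw_part s,
    [&& mw_part t == mw_part s, mw_E t == mw_E s
      & mw_N t == mw_N s :|: (pairs_between X Y :\: mw_R s)]].

Definition mw_step s t : bool :=
  [|| mw_merge s t, mw_positive s t | mw_negative s t].

(* [l] lists the triples that follow the initial one. *)
Definition construction_seq (l : seq mw_state) : bool :=
  path mw_step mw_init l && mw_final (last mw_init l).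

Fixpoint dist_le (e : rel G) (r : nat) (x y : G) : bool :=
  if r is r'.+1 then (x == y) || [exists z, e x z && dist_le e r' z y]
  else x == y.

Definition reachable_parts (r : nat) s (v : G) : {set {set G}} :=
  [set X in mw_part s |
    [exists x in X, dist_le (fun y z => [set y; z] \in mw_R s) r v x]].

Definition construction_width (r : nat) (l : seq mw_state) : nat :=
  \max_(s <- mw_init :: l) \max_(v : G) #|reachable_parts r s v|.

End MergeWidth.

Lemma partition_singletons (V : finType) : partition (singletons V) setT.
Proof.
apply/and3P; split.
- apply/eqP/setP=> x; rewrite inE; apply/bigcupP; exists [set x]; last exact: set11.
  exact: imset_f.
- apply/trivIsetP=> _ _ /imsetP[x _ ->] /imsetP[y _ ->] neq.
  rewrite disjoints1 inE; apply: contraNN neq => /eqP ->; exact: eqxx.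
- apply/imsetP=> -[x _ /setP/(_ x)]; by rewrite !inE eqxx.
Qed.

Lemma partition_merge (V : finType) (P : {set {set V}}) (X Y : {set V}) :
  partition P setT -> X \in P -> Y \in P -> X != Y ->
  partition ((X :|: Y) |: (P :\ X :\ Y)) setT.
Proof.
move=> /and3P[/eqP covP trP n0P] XP YP neqXY.
have disj Z : Z \in P :\ X :\ Y -> [disjoint X :|: Y & Z].
  rewrite !inE => /and3P[ZY ZX ZP].
  rewrite -setI_eq0 setIUl setU_eq0 !setI_eq0.
  by rewrite !(trivIsetP trP) // eq_sym.
apply/and3P; split.
- apply/eqP/setP=> x; rewrite inE.
  have: x \in cover P by rewrite covP inE.
  case/bigcupP=> Z ZP xZ; apply/bigcupP.
  have [ZX|ZX] := eqVneq Z X; first by exists (X :|: Y); rewrite !inE ?eqxx // -ZX xZ.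
  have [ZY|ZY] := eqVneq Z Y; first by exists (X :|: Y); rewrite !inE ?eqxx // -ZY xZ orbT.
  by exists Z; rewrite // !inE ZX ZY ZP orbT.
- apply/trivIsetP=> A B /setU1P[->|AP] /setU1P[->|BP].
  + by rewrite eqxx.
  + by move=> _; apply: disj.
  + by move=> _; rewrite disjoint_sym; apply: disj.
  + move: AP BP; rewrite !inE => /and3P[_ _ AP] /and3P[_ _ BP].
    exact: (trivIsetP trP).
- rewrite !inE (negbTE n0P) !andbF orbF eq_sym setU_eq0 negb_and.
  by apply/orP; left; apply: contraNN n0P => /eqP <-.
Qed.

Lemma merge_to_one_block (V : finType) (P : {set {set V}}) :
  partition P setT ->
  exists s, path (@merge_step V) P s && (last P s == one_block V).
Proof.
have [n] := ubnP #|P|; elim: n P => // n IH P; rewrite ltnS => leP partP.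
have [le1|] := leqP #|P| 1.
  exists [::] => /=.
  have /and3P[/eqP covP _ n0P] := partP.
  apply/eqP; case: (posnP #|P|) => [/eqP|P_gt0].
    rewrite cards_eq0 => /eqP P0; move: covP; rewrite P0 /cover big_set0 => VT.
    by rewrite /one_block -VT setDv.
  have /cards1P[X PX] : #|P| == 1 by rewrite eqn_leq le1 P_gt0.
  move: covP n0P; rewrite PX /cover big_set1 inE => -> n0; rewrite /one_block.
  apply/setP=> A; rewrite !inE.
  by have [->|//] := eqVneq A setT; rewrite ?andbF // andbT eq_sym.
case/card_gt1P=> X [Y [XP YP neqXY]].
set Q := (X :|: Y) |: (P :\ X :\ Y).
have ltQ : #|Q| < n.
  apply: leq_trans leP; rewrite /Q (cardsD1 X P) (cardsD1 Y (P :\ X)) XP !inE.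
  rewrite eq_sym neqXY YP /= !add1n ltnS.
  by rewrite cardsU1; case: (_ \notin _).
have [s /andP[ps ls]] := IH Q ltQ (partition_merge partP XP YP neqXY).
exists (Q :: s); rewrite /= ps ls !andbT.
apply/existsP; exists X; rewrite XP; apply/existsP; exists Y.
by rewrite YP neqXY eqxx.
Qed.

Lemma contraction_seq_exists (G : sgraph) : exists s, contraction_seq (G := G) s.
Proof. exact: merge_to_one_block (partition_singletons G). Qed.

Lemma mem_edges (G : sgraph) (x y : G) : ([set x; y] \in edges G) = adj x y.
Proof.
apply/imsetP/idP=> [[[a b]]|xy]; last by exists (x, y); rewrite ?inE.
rewrite inE /= => ab E.
have: a \in [set x; y] by rewrite E set21.
have: b \in [set x; y] by rewrite E set22.
rewrite !inE.
have neq : a != b by apply: contraTneq ab => ->; rewrite adj_irr.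
case/orP=> /eqP eb; case/orP=> /eqP ea.
- by move: neq; rewrite ea eb eqxx.
- by rewrite -ea -eb adj_sym.
- by rewrite -ea -eb.
- by move: neq; rewrite ea eb eqxx.
Qed.

Lemma pairs_between1 (G : sgraph) (x y : G) :
  x != y -> pairs_between [set x] [set y] = [set [set x; y]].
Proof.
move=> neq; apply/setP=> A; rewrite inE; apply/imsetP/eqP.
  by case=> -[a b]; rewrite !inE /= => /and3P[/eqP -> /eqP -> _].
by move=> ->; exists (x, y); rewrite // !inE /= !eqxx.
Qed.

Lemma resolve_pairs (G : sgraph) (l : seq (G * G)) (s : mw_state G) :
  mw_part s = singletons G -> mw_E s \subset edges G ->
  [disjoint mw_N s & edges G] -> mw_R s \subset pairs_between setT setT ->
  exists k, path (@mw_step G) s k /\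
    let t := last s k in
    [/\ mw_part t = singletons G, mw_E t \subset edges G,
        [disjoint mw_N t & edges G], mw_R t \subset pairs_between setT setT
      & mw_R s \subset mw_R t /\
        forall e, e \in l -> e.1 != e.2 -> [set e.1; e.2] \in mw_R t].
Proof.
elim: l s => [|[x y] l IH] s ps Es Ns Rs; first by exists [::]; split=> //; split.
have [exy|neq] := eqVneq x y.
  have [k [pk [? ? ? ? [? H]]]] := IH s ps Es Ns Rs.
  exists k; split=> //; split=> //; split=> // e; rewrite inE => /orP[/eqP ->|] /=; last exact: H.
  by rewrite exy eqxx.
have xyP : [set x; y] \in pairs_between [set: G] [set: G].
  by apply/imsetP; exists (x, y); rewrite // !inE.
have mems z : [set z] \in mw_part s by rewrite ps imset_f.
pose D := [set [set x; y]] :\: mw_R s.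
have DP : D \subset pairs_between setT setT.
  by apply: subset_trans (subsetDl _ _) _; rewrite sub1set.
pose u := if adj x y then MwState (singletons G) (mw_E s :|: D) (mw_N s)
          else MwState (singletons G) (mw_E s) (mw_N s :|: D).
have su : mw_step s u.
  rewrite /u; case: ifP => _; apply/or3P; [apply: Or32|apply: Or33];
    apply/existsP; exists [set x]; rewrite mems; apply/existsP; exists [set y];
    by rewrite mems pairs_between1 // ps !eqxx.
have Ru : mw_R u = mw_R s :|: [set [set x; y]].
  have RD : mw_R s :|: D = mw_R s :|: [set [set x; y]].
    by apply/setP=> A; rewrite !inE; case: (A \in mw_E s); case: (A \in mw_N s).
  by rewrite -RD /u /mw_R; case: ifP => _ /=; rewrite ?setUA // setUAC.
have Eu : mw_E u \subset edges G.
  rewrite /u; case: ifP => xy //=; rewrite subUset Es.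
  by apply: subset_trans (subsetDl _ _) _; rewrite sub1set mem_edges.
have Nu : [disjoint mw_N u & edges G].
  rewrite /u; case: ifP => xy //=; rewrite -setI_eq0 setIUl setU_eq0 !setI_eq0 Ns /=.
  by apply: disjointWl (subsetDl _ _) _; rewrite disjoints1 mem_edges xy.
have pu : mw_part u = singletons G by rewrite /u; case: ifP.
have Rsu : mw_R u \subset pairs_between setT setT.
  by rewrite Ru subUset Rs sub1set.
have [k [pk [pt Et Nt Rt [Rut H]]]] := IH u pu Eu Nu Rsu.
exists (u :: k); rewrite /= su; split=> //; split=> //; split.
  by apply: subset_trans Rut; rewrite Ru subsetUl.
move=> e; rewrite inE => /orP[/eqP ->|] /=; last exact: H.
by move=> _; apply: (subsetP Rut); rewrite Ru !inE eqxx orbT.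
Qed.

Lemma construction_seq_exists (G : sgraph) : exists l, construction_seq (G := G) l.
Proof.
have [] := @resolve_pairs G (enum {: G * G}) (mw_init G) erefl (sub0set _).
- by rewrite -setI_eq0 set0I.
- by rewrite /mw_R /= setU0 sub0set.
move=> k [pk]; set t := last _ _ => -[pt Et Nt Rt [_ H]].
have [m /andP[pm lm]] := merge_to_one_block (partition_singletons G).
pose lift P := MwState P (mw_E t) (mw_N t).
have liftt : lift (singletons G) = t by rewrite /lift -pt; case: (t).
exists (k ++ map lift m); rewrite /construction_seq cat_path last_cat -/t pk /=.
have -> : last t (map lift m) = lift (one_block G).
  by rewrite -{1}liftt last_map (eqP lm).
have -> /= : path (@mw_step G) t (map lift m).
  rewrite -{1}liftt path_map; apply: sub_path pm => P Q PQ.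
  by rewrite /= /mw_step /mw_merge /= PQ !eqxx.
have Rall : mw_R t = pairs_between setT setT.
  apply/eqP; rewrite eqEsubset Rt; apply/subsetP=> B /imsetP[e]; rewrite inE => /and3P[_ _ ne] ->.
  by apply: H; rewrite // mem_enum.
have -> : mw_final (lift (one_block G)) = (mw_E t == edges G).
  by rewrite /mw_final /mw_R /= -/(mw_R t) Rall !eqxx.
rewrite eqEsubset Et; apply/subsetP=> A Aed.
have : A \in mw_R t.
  move: Aed; rewrite Rall => /imsetP[e]; rewrite inE => ab ->.
  apply/imsetP; exists e; rewrite // !inE; apply: contraTneq ab => ->.
  by rewrite adj_irr.
rewrite inE => /orP[//|AN]; by have := disjointFr Nt AN; rewrite Aed.
Qed.

(* Imported only here because [set0], [setT] and the like denote finite sets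
   above. *)
From mathcomp Require Import all_order all_algebra.
From mathcomp Require Import all_classical all_reals all_analysis.
Import Order.TTheory GRing.Theory Num.Theory.
Import numFieldNormedType.Exports.

Lemma tww_exists (G : sgraph) :
  exists d, `[< exists2 s, contraction_seq (G := G) s & contraction_width s = d >].
Proof.
have [s Hs] := contraction_seq_exists G.
by exists (contraction_width s); apply/asboolP; exists s.
Qed.

Lemma mw_exists (r : nat) (G : sgraph) :
  exists d, `[< exists2 l, construction_seq (G := G) l & construction_width r l = d >].
Proof.
have [l Hl] := construction_seq_exists G.
by exists (construction_width r l); apply/asboolP; exists l.
Qed.

Definition tww (G : sgraph) : nat := ex_minn (tww_exists G).

Definition mw (r : nat) (G : sgraph) : nat := ex_minn (mw_exists r G).

Definition bounded_twin_width (C : sgraph -> Prop) : Prop :=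
  exists d, forall G, C G -> tww G <= d.

Definition bounded_merge_width (C : sgraph -> Prop) : Prop :=
  exists f : nat -> nat, forall r G, C G -> mw r G <= f r.

Section HGraph.
Local Open Scope ring_scope.
Local Open Scope classical_set_scope.
Variable R : realType.

(* The realisation lives in Euclidean space with one axis per vertex: vertices
   are the standard basis vectors, edges the segments between them; such
   segments only meet in common endpoints.  [connected] is intrinsic to the
   subset, so the ambient topology induces the right notion. *)
Definition vertex_point (H : sgraph) (v : H) : 'rV[R]_#|H| :=
  delta_mx ord0 (enum_rank v).

Definition realisation (H : sgraph) : set 'rV[R]_#|H| :=
  [set x | (exists v : H, x = vertex_point v) \/
           (exists (u v : H) (t : R), [/\ adj u v, 0 <= t <= 1 &
              x = (1 - t) *: vertex_point u + t *: vertex_point v])].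

Arguments realisation : clear implicits.

Definition Hgraph (H G : sgraph) : Prop :=
  exists S : G -> set 'rV[R]_#|H|,
    (forall x : G, [/\ S x `<=` realisation H, S x !=set0 & connected (S x)])
    /\ forall x y : G, x != y -> (adj x y <-> S x `&` S y !=set0).

End HGraph.

(* [fo k] is the type of formulas with free variables among [k] variables, as
   de Bruijn indices: the variable bound by [FEx] is [ord0] in its body. *)
Inductive fo : nat -> Type :=
| FEq k : 'I_k -> 'I_k -> fo k
| FAdj k : 'I_k -> 'I_k -> fo k
| FNot k : fo k -> fo k
| FAnd k : fo k -> fo k -> fo k
| FEx k : fo k.+1 -> fo k.

Definition sentence : Type := fo 0.

Definition env_cons (T : Type) k (x : T) (rho : 'I_k -> T) : 'I_k.+1 -> T :=
  fun i => if unlift ord0 i is Some j then rho j else x.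

Fixpoint sat (G : sgraph) k (phi : fo k) : ('I_k -> G) -> bool :=
  match phi in fo k return ('I_k -> G) -> bool with
  | FEq _ i j => fun rho => rho i == rho j
  | FAdj _ i j => fun rho => adj (rho i) (rho j)
  | FNot _ psi => fun rho => ~~ sat psi rho
  | FAnd _ psi chi => fun rho => sat psi rho && sat chi rho
  | FEx _ psi => fun rho => [exists x : G, sat psi (env_cons x rho)]
  end.

Definition models (G : sgraph) (phi : sentence) : bool :=
  sat (G := G) phi (fun i : 'I_0 => False_rect G (notF (ltn_ord i))).

(* Random access machines: programs are lists of instructions acting on
   registers holding natural numbers, under the uniform cost measure; with this
   arithmetic (addition, truncated subtraction, halving) it agrees with Turing
   machine time up to a polynomial.  The input word is read-only with random
   access, letters beyond its end being read as 0. *)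
Inductive instr : Type :=
| IConst of nat & nat
| IAdd of nat & nat & nat
| ISub of nat & nat & nat
| IHalf of nat & nat
| ILoad of nat & nat
| IStore of nat & nat
| IInput of nat & nat
| IInputLen of nat
| IJumpZero of nat & nat.

Definition program : Type := seq instr.

Record ram_state := RamState { pc : nat; reg : nat -> nat }.

Definition assign (s : ram_state) (a x : nat) : ram_state :=
  RamState (pc s).+1 [eta reg s with a |-> x].

Definition exec (w : seq nat) (i : instr) (s : ram_state) : ram_state :=
  let m := reg s in
  match i with
  | IConst a c => assign s a c
  | IAdd a b c => assign s a (m b + m c)
  | ISub a b c => assign s a (m b - m c)
  | IHalf a b => assign s a (m b)./2
  | ILoad a b => assign s a (m (m b))
  | IStore a b => assign s (m a) (m b)
  | IInput a b => assign s a (nth 0 w (m b))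
  | IInputLen a => assign s a (size w)
  | IJumpZero a l => RamState (if m a == 0 then l else (pc s).+1) m
  end.

Definition ram_step (p : program) (w : seq nat) (s : ram_state) : ram_state :=
  if onth p (pc s) is Some i then exec w i s else s.

(* The machine halts when the program counter leaves the program; the output is
   then in register 0. *)
Definition halts_within (p : program) (w : seq nat) (T y : nat) : Prop :=
  exists2 t, t <= T &
    let s := iter t (ram_step p w) (RamState 0 (fun=> 0)) in
    size p <= pc s /\ reg s 0 = y.

Definition computable (f : nat -> nat) : Prop :=
  exists p : program, forall n, exists T, halts_within p [:: n] T (f n).

(* The number of vertices followed by the adjacency matrix, for the vertex
   ordering [s]. *)
Definition encode_graph (G : sgraph) (s : seq G) : seq nat :=
  size s :: [seq nat_of_bool (adj x y) | x <- s, y <- s].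

Fixpoint encode_fo k (phi : fo k) : seq nat :=
  match phi with
  | FEq _ i j => [:: 0; nat_of_ord i; nat_of_ord j]
  | FAdj _ i j => [:: 1; nat_of_ord i; nat_of_ord j]
  | FNot _ psi => 2 :: encode_fo psi
  | FAnd _ psi chi => 3 :: encode_fo psi ++ encode_fo chi
  | FEx _ psi => 4 :: encode_fo psi
  end.

(* One program for all graphs and sentences; |phi| and |G| are the lengths of
   the encodings.  Sentences of a given length are finitely many, since their
   de Bruijn indices are bounded by the number of quantifiers. *)
Definition fpt_model_checking (C : sgraph -> Prop) : Prop :=
  exists (p : program) (f : nat -> nat) (c : nat), computable f /\
    forall (G : sgraph) (s : seq G) (phi : sentence),
      C G -> perm_eq s (enum G) ->
      halts_within p (encode_graph s ++ encode_fo phi)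
        (f (size (encode_fo phi)) * size (encode_graph s) ^ c)
        (models G phi).

(* Main.v *)
Require Import Defs.
From mathcomp Require Import all_boot zify.
From mathcomp Require boolp.

Set Implicit Arguments.
Unset Strict Implicit.
Unset Printing Implicit Defensive.

(* For each n take an n-regular bipartite graph of girth greater than n and let B be
   its vertices and A its edges: B is made independent, A a clique, and b in B
   adjacent to exactly the elements of A that are not incident with b.  The class
   consists of the induced subgraphs of these graphs.

   Twin-width and merge-width are unbounded because, at the first moment when a part
   contains two elements of B, the n elements of A incident with one of them are
   spread over too many parts.

   A first-order sentence of rank q sees only balls of radius exponential in q in the
   incidence relation.  If n is large these balls are trees, and a capped colour
   refinement from the current parameters captures the types of the vertices; if n is
   small the graph has bounded size.  Hence each quantifier may be restricted to one
   vertex per colour class and boundedly many further vertices, which is carried out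
   by a loop program compiled to the machine model.

   A connected graph H with two cycles has two edges whose joint removal leaves it
   connected.  The two sides of the bipartition are placed as points in the interiors
   of these two edges, and an edge bb' is represented by all of H without the points
   of b and b'. *)


(** An edge of the regular graph has one end on each side, so an element of [A] has to avoid just
    two points of [H], one on each of two fixed edges. Complementing incidence turns avoiding into
    non-adjacency, and the sets of [A], which contain every vertex of [H], force the clique. A model
    checker has to undo this flip, yet it is given neither the sides nor the girth. It finds the
    sides by counting non-neighbours, and falls back on twin classes when at most three vertices of
    [B] are left. It cannot tell either whether the girth suffices for the sentence, so a quantifier
    always ranges over an initial segment of the vertices, which is everything if the girth is
    small, together with the colour representatives. The delicate move of the game is a new vertex
    far from all parameters, because colours do not count what happens far away. Both tuples live in
    the same graph, however, and a pigeonhole argument then provides a far answer. The machine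
    semantics is low level, so the algorithm is kept to sums, bounded loops and table filling, whose
    cost can be read off from the loop bounds. *)

(** * A loop language over variables and arrays of natural numbers *)

Inductive expr : Type :=
| EC of nat
| EV of nat
| EAdd of expr & expr
| ESub of expr & expr
| EArr of nat & expr
| EIn of expr
| ELen
| EIf of expr & expr & expr
| ESum of nat & nat & expr.

Inductive cmd : Type :=
| CAssign of nat & expr
| CStore of nat & expr & expr
| CSeq of cmd & cmd
| CFor of nat & nat & cmd.

Record store := Store { vr : nat -> nat; ar : nat -> nat -> nat }.

Definition setv (s : store) (x v : nat) : store :=
  Store [eta vr s with x |-> v] (ar s).

Definition seta (s : store) (k i v : nat) : store :=
  Store (vr s) (fun k' i' => if (k' == k) && (i' == i) then v else ar s k' i').

Section Semantics.
Variable w : seq nat.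

Fixpoint eval (e : expr) (s : store) : nat :=
  match e with
  | EC c => c
  | EV x => vr s x
  | EAdd a b => eval a s + eval b s
  | ESub a b => eval a s - eval b s
  | EArr k a => ar s k (eval a s)
  | EIn a => nth 0 w (eval a s)
  | ELen => size w
  | EIf a b c => if eval a s == 0 then eval c s else eval b s
  | ESum x y a => \sum_(i < vr s y) eval a (setv s x i)
  end.

Fixpoint run (c : cmd) (s : store) : store :=
  match c with
  | CAssign x e => setv s x (eval e s)
  | CStore k e1 e2 => seta s k (eval e1 s) (eval e2 s)
  | CSeq c1 c2 => run c2 (run c1 s)
  | CFor x y c => iteri (vr s y) (fun i s' => run c (setv s' x i)) s
  end.

(** [Z] dominates all loop bounds that are met, in both branches of an [EIf]; the running time is
    then bounded by a function of [Z] and the syntax alone. *)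
Fixpoint safeE (Z : nat) (e : expr) (s : store) : Prop :=
  match e with
  | EC _ | EV _ | ELen => True
  | EAdd a b | ESub a b => safeE Z a s /\ safeE Z b s
  | EArr _ a | EIn a => safeE Z a s
  | EIf a b c => [/\ safeE Z a s, safeE Z b s & safeE Z c s]
  | ESum x y a => vr s y <= Z /\ forall i, i < vr s y -> safeE Z a (setv s x i)
  end.

Fixpoint safe (Z : nat) (c : cmd) (s : store) : Prop :=
  match c with
  | CAssign _ e => safeE Z e s
  | CStore _ e1 e2 => safeE Z e1 s /\ safeE Z e2 s
  | CSeq c1 c2 => safe Z c1 s /\ safe Z c2 (run c1 s)
  | CFor x y c => vr s y <= Z /\ forall i, i < vr s y ->
      safe Z c (setv (iteri i (fun i s' => run c (setv s' x i)) s) x i)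
  end.

End Semantics.

(** * Compilation to random access machines *)

(* Registers below [nv] hold the variables, register [nv] is always 0, those in
   ]nv, base[ are temporaries, and cell [i] of array [k] < 8 lives in
   [base + 8 * i + k]. *)
Definition nv := 48.
Definition base := 256.

Lemma nv_base : nv < base.
Proof. by []. Qed.

Opaque nv base.

Fixpoint lenE (e : expr) : nat :=
  match e with
  | EC _ | EV _ | ELen => 1
  | EAdd a b | ESub a b => lenE a + lenE b + 1
  | EArr _ a => lenE a + 6
  | EIn a => lenE a + 1
  | EIf a b c => lenE a + 1 + lenE b + 1 + lenE c
  | ESum _ _ a => lenE a + 12
  end.

(** [o] is the address of the first instruction and [t] the first free temporary, where the value is
    left. Jumps are absolute, hence the separate length [lenE], which does not depend on [o]. As
    register [nv] holds 0, [IAdd t x nv] is a move and [IJumpZero nv] an unconditional jump. *)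
Fixpoint compE (o t : nat) (e : expr) : seq instr :=
  match e with
  | EC c => [:: IConst t c]
  | EV x => [:: IAdd t x nv]
  | EAdd a b => compE o t a ++ compE (o + lenE a) t.+1 b ++ [:: IAdd t t t.+1]
  | ESub a b => compE o t a ++ compE (o + lenE a) t.+1 b ++ [:: ISub t t t.+1]
  | EArr k a => compE o t a ++
     [:: IAdd t t t; IAdd t t t; IAdd t t t; IConst t.+1 (base + k);
         IAdd t t t.+1; ILoad t t]
  | EIn a => compE o t a ++ [:: IInput t t]
  | ELen => [:: IInputLen t]
  | EIf a b c => compE o t a ++ IJumpZero t (o + lenE a + 1 + lenE b + 1) ::
      compE (o + lenE a + 1) t b ++
      IJumpZero nv (o + lenE (EIf a b c)) ::
      compE (o + lenE a + 1 + lenE b + 1) t c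
  | ESum x y a =>
      [:: IConst t 0; IConst t.+1 0; IAdd t.+2 x nv; IAdd t.+3 y nv;
          IJumpZero t.+3 (o + lenE a + 11); IAdd x t.+1 nv] ++
      compE (o + 6) t.+4 a ++
      [:: IAdd t t t.+4; IConst t.+4 1; IAdd t.+1 t.+1 t.+4;
          ISub t.+3 t.+3 t.+4; IJumpZero nv (o + 4); IAdd x t.+2 nv]
  end.

Fixpoint lenC (c : cmd) : nat :=
  match c with
  | CAssign _ e => lenE e + 1
  | CStore _ e1 e2 => lenE e1 + lenE e2 + 6
  | CSeq c1 c2 => lenC c1 + lenC c2
  | CFor _ _ c => lenC c + 8
  end.

Fixpoint compC (o t : nat) (c : cmd) : seq instr :=
  match c with
  | CAssign x e => compE o t e ++ [:: IAdd x t nv]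
  | CStore k e1 e2 => compE o t e1 ++ compE (o + lenE e1) t.+1 e2 ++
     [:: IAdd t t t; IAdd t t t; IAdd t t t; IConst t.+2 (base + k);
         IAdd t t t.+2; IStore t t.+1]
  | CSeq c1 c2 => compC o t c1 ++ compC (o + lenC c1) t c2
  | CFor x y c =>
      [:: IConst t 0; IAdd t.+1 y nv;
          IJumpZero t.+1 (o + lenC c + 8); IAdd x t nv] ++
      compC (o + 4) t.+3 c ++
      [:: IConst t.+2 1; IAdd t t t.+2; ISub t.+1 t.+1 t.+2; IJumpZero nv (o + 2)]
  end.

Lemma size_compE o t e : size (compE o t e) = lenE e.
Proof.
by elim: e o t => //= [a IHa b IHb|a IHa b IHb|k a IHa|a IHa|a IHa b IHb c IHc|x y a IHa] o t;
  rewrite ?size_cat /= ?size_cat /= ?IHa ?IHb ?IHc; lia.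
Qed.

Lemma size_compC o t c : size (compC o t c) = lenC c.
Proof.
by elim: c o t => //= [x e|k a b|a IHa b IHb|x y c IHc] o t;
  rewrite ?size_cat /= ?size_cat /= ?size_compE ?IHa ?IHb ?IHc; lia.
Qed.

Fixpoint wfE (t : nat) (e : expr) : bool :=
  match e with
  | EC _ | ELen => t < base
  | EV x => (x < nv) && (t < base)
  | EAdd a b | ESub a b => wfE t a && wfE t.+1 b
  | EArr k a => [&& k < 8, wfE t a & t.+1 < base]
  | EIn a => wfE t a
  | EIf a b c => [&& wfE t a, wfE t b & wfE t c]
  | ESum x y a => [&& x < nv, y < nv, t.+4 < base & wfE t.+4 a]
  end.

Fixpoint wfC (t : nat) (c : cmd) : bool :=
  match c with
  | CAssign x e => (x < nv) && wfE t e
  | CStore k a b => [&& k < 8, wfE t a, wfE t.+1 b & t.+2 < base]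
  | CSeq a b => wfC t a && wfC t b
  | CFor x y c => [&& x < nv, y < nv, t.+2 < base & wfC t.+3 c]
  end.

Fixpoint timeE (Z : nat) (e : expr) : nat :=
  match e with
  | EC _ | EV _ | ELen => 1
  | EAdd a b | ESub a b => timeE Z a + timeE Z b + 1
  | EArr _ a => timeE Z a + 6
  | EIn a => timeE Z a + 1
  | EIf a b c => timeE Z a + timeE Z b + timeE Z c + 2
  | ESum _ _ a => 6 + Z * (timeE Z a + 7)
  end.

Fixpoint timeC (Z : nat) (c : cmd) : nat :=
  match c with
  | CAssign _ e => timeE Z e + 1
  | CStore _ a b => timeE Z a + timeE Z b + 6
  | CSeq a b => timeC Z a + timeC Z b
  | CFor _ _ c => 3 + Z * (timeC Z c + 6)
  end.

Section Simulation.
Variables (p : program) (w : seq nat).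

Definition code_at (o : nat) (cs : seq instr) : Prop :=
  forall i, i < size cs -> onth p (o + i) = onth cs i.

Lemma onth_cat (T : Type) (s1 s2 : seq T) i :
  onth (s1 ++ s2) i = if i < size s1 then onth s1 i else onth s2 (i - size s1).
Proof. by elim: s1 i => [|x s1 IH] [|i] //=; rewrite ?subn0 ?IH. Qed.

Lemma code_at_cat o c1 c2 :
  code_at o (c1 ++ c2) -> code_at o c1 /\ code_at (o + size c1) c2.
Proof.
move=> H; split=> i Hi.
  by rewrite H ?onth_cat ?Hi // size_cat ltn_addr.
rewrite -addnA H ?size_cat ?ltn_add2l // onth_cat ltnNge leq_addr /=.
by rewrite addKn.
Qed.

Lemma code_at_cons o i c :
  code_at o (i :: c) -> onth p o = Some i /\ code_at o.+1 c.
Proof.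
move=> H; split; first by have := H 0 isT; rewrite addn0.
by move=> j Hj; rewrite addSnnS H.
Qed.

Definition reaches (n : nat) (s s' : ram_state) : Prop :=
  exists2 k, k <= n & iter k (ram_step p w) s = s'.

Lemma reaches_refl n s : reaches n s s.
Proof. by exists 0. Qed.

Lemma reaches_trans n1 n2 s1 s2 s3 :
  reaches n1 s1 s2 -> reaches n2 s2 s3 -> reaches (n1 + n2) s1 s3.
Proof.
move=> [k1 h1 e1] [k2 h2 e2]; exists (k2 + k1); first by rewrite addnC leq_add.
by rewrite iterD e1.
Qed.

Lemma reaches_le n n' s s' : n <= n' -> reaches n s s' -> reaches n' s s'.
Proof. by move=> h [k hk e]; exists k => //; apply: leq_trans h. Qed.

Lemma reaches_step o m i n s :
  onth p o = Some i -> reaches n (exec w i (RamState o m)) s ->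
  reaches n.+1 (RamState o m) s.
Proof.
by move=> h [k hk e]; exists k.+1; rewrite // iterSr /ram_step /= h.
Qed.

Definition repr (s : store) (m : nat -> nat) : Prop :=
  [/\ forall x, x < nv -> m x = vr s x, m nv = 0
    & forall k i, k < 8 -> m (base + 8 * i + k) = ar s k i].

Lemma repr_agree s m m' :
  repr s m -> (forall j, j <= nv \/ base <= j -> m' j = m j) -> repr s m'.
Proof.
move=> [h1 h2 h3] h; split=> [x hx|| k i hk].
- by rewrite h ?h1 //; left; apply: ltnW.
- by rewrite h //; left.
- by rewrite h ?h3 //; right; rewrite -addnA leq_addr.
Qed.

Lemma repr_setv s m x v m' : repr s m -> x < nv ->
  (forall j, j <= nv \/ base <= j -> m' j = if j == x then v else m j) ->
  repr (setv s x v) m'.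
Proof.
move=> [h1 h2 h3] xnv h; split=> [y hy|| k i hk] /=.
- by rewrite h ?h1 //=; left; apply: ltnW.
- by rewrite h; [case: eqP xnv => // <-; rewrite ltnn | left].
- rewrite h ?h3 //; last by right; rewrite -addnA leq_addr.
  by have := nv_base; case: eqP xnv => // <-; lia.
Qed.

Lemma repr_seta s m k i v m' : repr s m -> k < 8 ->
  (forall j, j <= nv \/ base <= j ->
     m' j = if j == base + 8 * i + k then v else m j) ->
  repr (seta s k i v) m'.
Proof.
move=> [h1 h2 h3] k8 h; split=> [y hy|| k' i' hk] /=.
- rewrite h ?h1; [|by []|by left; apply: ltnW].
  by have := nv_base; case: eqP => // E; move: hy; rewrite E; lia.
- by have := nv_base; rewrite h; [case: eqP => // -> |left]; lia.
- rewrite h ?h3 //; last by right; rewrite -addnA leq_addr.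
  case: (eqVneq k' k) => [->|nk] /=.
    by rewrite eqn_add2r eqn_add2l eqn_pmul2l.
  by case: eqP => // E; move: nk; lia.
Qed.


Definition straight (i : instr) : bool :=
  if i is IJumpZero _ _ then false else true.

Definition regs_after (cs : seq instr) (m : nat -> nat) : nat -> nat :=
  foldl (fun m i => reg (exec w i (RamState 0 m))) m cs.

Lemma exec_straight o cs m : code_at o cs -> all straight cs ->
  reaches (size cs) (RamState o m) (RamState (o + size cs) (regs_after cs m)).
Proof.
elim: cs o m => [|i cs IH] o m.
  by move=> _ _; rewrite /= addn0; apply: reaches_refl.
case/code_at_cons=> hi hc /= /andP[si scs]; apply: reaches_step hi _.
have -> : exec w i (RamState o m) = RamState o.+1 (reg (exec w i (RamState 0 m))).
  by case: i si.
by rewrite addnS -addSn; apply: IH.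
Qed.

Lemma reaches_jump0 o m a l n s : onth p o = Some (IJumpZero a l) ->
  m a = 0 -> reaches n (RamState l m) s -> reaches n.+1 (RamState o m) s.
Proof. by move=> h e r; apply: reaches_step h _; rewrite /= e eqxx. Qed.

Lemma reaches_jumpS o m a l n s : onth p o = Some (IJumpZero a l) ->
  m a != 0 -> reaches n (RamState o.+1 m) s -> reaches n.+1 (RamState o m) s.
Proof. by move=> h e r; apply: reaches_step h _; rewrite /= (negbTE e). Qed.

Lemma wfE_lt t e : wfE t e -> t < base.
Proof.
elim: e t => //= [x|a IH b _|a IH b _|k a IH|a IH b _ c _|x y a IH] t.
- by case/andP.
- by case/andP=> /IH.
- by case/andP=> /IH.
- by case/and3P=> _ /IH.
- by case/and3P=> /IH.
- by case/and4P=> _ _ h _; apply: leq_ltn_trans h; rewrite !leqW.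
Qed.

Ltac ifs := repeat (case: eqP => ?; try lia).

(** The last clause carries the induction: operands already computed in temporaries below [t]
    survive the evaluation of later ones. A sum overwrites its index variable but restores it at the
    end, so variables survive as well. *)
Lemma compE_correct Z e o t s m :
  code_at o (compE o t e) -> nv < t -> wfE t e -> repr s m -> safeE Z e s ->
  exists m', [/\ reaches (timeE Z e) (RamState o m) (RamState (o + lenE e) m'),
    m' t = eval w e s & forall j, j < t \/ base <= j -> m' j = m j].
Proof.
have nvb := nv_base.
have agree s0 t0 m0 m1 : repr s0 m0 -> nv < t0 -> t0 <= base ->
    (forall j, j < t0 \/ base <= j -> m1 j = m0 j) -> repr s0 m1.
  move=> r0 h0 h1 h; apply: repr_agree r0 _ => j [jnv|jb]; apply: h.
    by left; apply: leq_ltn_trans h0.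
  by right.
elim: e o t s m => [c|x|a IHa b IHb|a IHa b IHb|k a IHa|a IHa||a IHa b IHb c IHc|x y a IHa]
  o t s m /= hc ht hw hr hs.
- have := exec_straight m hc isT; rewrite /= => h.
  eexists; split; first exact: h; first by rewrite /= eqxx.
  by move=> j hj /=; case: eqP hj => // ->; lia.
- have := exec_straight m hc isT; rewrite /= => h.
  case: hr => h1 h2 h3; case/andP: hw => hx htb.
  eexists; split; first exact: h; first by rewrite /= eqxx h2 addn0 h1.
  by move=> j hj /=; case: eqP hj => // ->; lia.
- case/code_at_cat: hc => hca /code_at_cat[hcb hcc].
  case/andP: hw => wa wb; case: hs => sa sb; rewrite !size_compE in hcb hcc.
  have tb := wfE_lt wb.
  have [m1 [r1 v1 k1]] := IHa _ _ _ _ hca ht wa hr sa.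
  have [m2 [r2 v2 k2]] := IHb _ _ _ _ hcb (ltnW ht) wb (agree _ _ _ _ hr ht (ltnW (ltnW tb)) k1) sb.
  have r3 := exec_straight m2 hcc isT.
  eexists; split.
  + rewrite !addnA; exact: reaches_trans (reaches_trans r1 r2) r3.
  + by rewrite /= eqxx v2 k2 ?v1 //; left.
  + move=> j hj /=; case: eqP => [E|_]; first by move: hj; rewrite E; lia.
    by rewrite k2 ?k1 //; lia.
- case/code_at_cat: hc => hca /code_at_cat[hcb hcc].
  case/andP: hw => wa wb; case: hs => sa sb; rewrite !size_compE in hcb hcc.
  have tb := wfE_lt wb.
  have [m1 [r1 v1 k1]] := IHa _ _ _ _ hca ht wa hr sa.
  have [m2 [r2 v2 k2]] := IHb _ _ _ _ hcb (ltnW ht) wb (agree _ _ _ _ hr ht (ltnW (ltnW tb)) k1) sb.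
  have r3 := exec_straight m2 hcc isT.
  eexists; split.
  + rewrite !addnA; exact: reaches_trans (reaches_trans r1 r2) r3.
  + by rewrite /= eqxx v2 k2 ?v1 //; left.
  + move=> j hj /=; case: eqP => [E|_]; first by move: hj; rewrite E; lia.
    by rewrite k2 ?k1 //; lia.
- case/code_at_cat: hc => hca hcc; rewrite size_compE in hcc.
  case/and3P: hw => hk wa tb.
  have [m1 [r1 v1 k1]] := IHa _ _ _ _ hca ht wa hr hs.
  have r2 := exec_straight m1 hcc isT.
  have [_ _ h3] := agree _ _ _ _ hr ht (ltnW (ltnW tb)) k1.
  eexists; split.
  + rewrite addnA; exact: reaches_trans r1 r2.
  + have nt : (t == t.+1) = false by lia.
    rewrite /regs_after /= ?eqxx ?nt /= ?eqxx ?nt /= v1 -h3 //.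
    set v := eval w a s.
    have E : v + v + (v + v) + (v + v + (v + v)) + (base + k) = base + 8 * v + k by lia.
    rewrite ?E; ifs.
  + move=> j hj; rewrite /regs_after /= -k1 //; ifs.
- case/code_at_cat: hc => hca hcc; rewrite size_compE in hcc.
  have [m1 [r1 v1 k1]] := IHa _ _ _ _ hca ht hw hr hs.
  have r2 := exec_straight m1 hcc isT.
  have tb := wfE_lt hw.
  eexists; split.
  + rewrite addnA; exact: reaches_trans r1 r2.
  + by rewrite /= eqxx v1.
  + move=> j hj; rewrite /= -k1 //; ifs.
- have := exec_straight m hc isT; rewrite /= => h.
  eexists; split; first exact: h; first by rewrite /= eqxx.
  by move=> j hj /=; case: eqP hj => // ->; lia.
- case/code_at_cat: hc => hca /code_at_cons[hj1 /code_at_cat[hcb /code_at_cons[hj2 hcc]]].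
  rewrite !size_compE in hj1 hcb hj2 hcc.
  rewrite -(addn1 (o + _)) in hcb hj2 hcc; rewrite -(addn1 (_ + lenE b)) in hcc.
  case/and3P: hw => wa wb wc; case: hs => sa sb sc.
  have [m1 [r1 v1 k1]] := IHa _ _ _ _ hca ht wa hr sa.
  have tb := wfE_lt wa.
  have hr1 := agree _ _ _ _ hr ht (ltnW tb) k1.
  case: (eqVneq (eval w a s) 0) => [E|E].
    have [m2 [r2 v2 k2]] := IHc _ _ _ _ hcc ht wc hr1 sc.
    exists m2; split=> //; last by move=> j hj; rewrite k2 ?k1.
    rewrite E in v1.
    rewrite !addnA; apply: reaches_le (reaches_trans r1 (reaches_jump0 hj1 v1 r2)).
    lia.
  have [m2 [r2 v2 k2]] := IHb _ _ _ _ hcb ht wb hr1 sb.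
  have hr2 := agree _ _ _ _ hr1 ht (ltnW tb) k2.
  exists m2; split=> //; last by move=> j hj; rewrite k2 ?k1.
  rewrite -v1 in E; case: (hr2) => _ z2 _.
  have r3 := reaches_jump0 hj2 z2 (@reaches_refl 0 _).
  have := reaches_trans r1 (reaches_jumpS hj1 E _).
  rewrite -addn1 => /(_ _ _ (reaches_trans r2 r3)).
  by apply: reaches_le; lia.
- case/and4P: hw => hx hy tb wa; case: hs => leZ sa.
  have [c1 c23] := @code_at_cat o [:: _; _; _; _; _; _] _ hc.
  have {c23} /code_at_cat[c2 c3] := c23.
  rewrite /= size_compE in c2 c3.
  have c11 : code_at o [:: IConst t 0; IConst t.+1 0; IAdd t.+2 x nv; IAdd t.+3 y nv].
    by move=> i hi; rewrite c1; [case: i hi => [|[|[|[|]]]] | apply: ltn_trans hi _].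
  have j1 : onth p (o + 4) = Some (IJumpZero t.+3 (o + lenE a + 11)) by rewrite c1.
  have c12 : code_at (o + 5) [:: IAdd x t.+1 nv].
    by case=> // _; rewrite -addnA c1.
  have c31 : code_at (o + 6 + lenE a) [:: IAdd t t t.+4; IConst t.+4 1; IAdd t.+1 t.+1 t.+4; ISub t.+3 t.+3 t.+4].
    by move=> i hi; rewrite c3; [case: i hi => [|[|[|[|]]]] | apply: ltn_trans hi _].
  have j2 : onth p (o + 6 + lenE a + 4) = Some (IJumpZero nv (o + 4)) by rewrite c3.
  have c32 : code_at (o + lenE a + 11) [:: IAdd x t.+2 nv].
    case=> // _; have <- : o + 6 + lenE a + 5 = o + lenE a + 11 + 0 by lia.
    by rewrite c3.
  have r1 := exec_straight m c11 isT; move: r1.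
  set m1 := regs_after _ _ => r1 /=.
  case: (hr) => hr1 hr2 hr3.
  have em1 j : m1 j = if j == t then 0 else if j == t.+1 then 0 else
      if j == t.+2 then m x else if j == t.+3 then m y else m j.
    by rewrite /m1 /regs_after /=; ifs; rewrite ?hr2; lia.
  set n := vr s y in leZ sa *.
  pose f i := eval w a (setv s x i).
  (* The four temporaries from [t] on hold the partial sum, the index, the saved value of variable
     [x] and the number of rounds left. Variable [x] is exempt from preservation until the loop is
     left. *)
  have loop k : k <= n -> exists m2, [/\
     reaches (k * (timeE Z a + 7)) (RamState (o + 4) m1) (RamState (o + 4) m2),
     m2 t = \sum_(i < k) f i /\ m2 t.+1 = k, m2 t.+2 = m x, m2 t.+3 = n - k &
     forall j, j != x -> j < t \/ base <= j -> m2 j = m j].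
    elim: k => [|k IH] hk.
      exists m1; rewrite mul0n big_ord0 subn0; split; first exact: reaches_refl.
      + by split; rewrite em1; ifs.
      + rewrite em1; ifs.
      + rewrite em1 /n -hr1 //; ifs.
      + move=> j jx hj; rewrite em1; ifs.
    have [m2 [r2 [at2 bt2] ct2 dt2 ot2]] := IH (ltnW hk).
    have nz : m2 t.+3 != 0 by rewrite dt2; lia.
    have z2 : m2 nv = 0 by rewrite ot2 ?hr2 //; [lia|left].
    have r3 := exec_straight m2 c12 isT; move: r3.
    set m3 := regs_after _ _; rewrite -addnA /= => r3.
    have em3 j : m3 j = if j == x then k else m2 j.
      by rewrite /m3 /regs_after /= bt2 z2 addn0.
    have rp3 : repr (setv s x k) m3.
      apply: repr_setv hr hx _ => j hj; rewrite em3; case: eqP => // /eqP jx.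
      by rewrite ot2 //; lia.
    have [|m4 [r4 v4 k4]] := IHa _ _ _ _ c2 _ wa rp3 (sa _ hk); first lia.
    have r5 := exec_straight m4 c31 isT; move: r5.
    set m5 := regs_after _ _; rewrite /= => r5.
    have em5 j : m5 j = if j == t then m4 t + m4 t.+4 else if j == t.+1 then (m4 t.+1).+1
        else if j == t.+3 then (m4 t.+3).-1 else if j == t.+4 then 1 else m4 j.
      by rewrite /m5 /regs_after /=; ifs.
    have z5 : m5 nv = 0.
      rewrite em5; do 4!(case: eqP => [|_]; first lia).
      by rewrite k4 ?em3; [case: eqP => // E; move: hx; rewrite -E ltnn|left; lia].
    exists m5; split.
    + rewrite mulSn addnC; apply: reaches_trans r2 _.
      have := reaches_trans r3 (reaches_trans r4 (reaches_trans r5 (reaches_jump0 j2 z5 (@reaches_refl 0 _)))).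
      have E : (o + 4).+1 = o + 5 by lia.
      rewrite -E => H; apply: reaches_le (reaches_jumpS j1 nz H).
      by lia.
    + split; first rewrite em5 eqxx big_ord_recr /= -at2 v4; first congr (_ + _).
        by rewrite k4 ?em3; [case: eqP => // E; lia|left; lia].
      rewrite em5; case: eqP => [|_]; first lia.
      by rewrite eqxx k4 ?em3 ?bt2; [case: eqP => // E; lia|left; lia].
    + rewrite em5; do 4!(case: eqP => [|_]; first lia).
      by rewrite k4 ?em3 ?ct2; [case: eqP => // E; lia|left; lia].
    + rewrite em5; do 2!(case: eqP => [|_]; first lia).
      rewrite eqxx k4 ?em3 ?dt2; last by left; lia.
      by case: eqP => [|_]; lia.
    + move=> j jx hj; rewrite em5; do 4!(case: eqP => [|_]; first lia).
      by rewrite k4 ?em3 ?(negbTE jx) ?ot2 //; lia.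
  have [m2 [r2 [at2 bt2] ct2 dt2 ot2]] := loop n (leqnn _).
  rewrite subnn in dt2.
  have r3 := exec_straight m2 c32 isT; move: r3.
  set m3 := regs_after _ _; rewrite /= => r3.
  have z2 : m2 nv = 0 by rewrite ot2 ?hr2 //; [lia|left].
  have em3 j : m3 j = if j == x then m x else m2 j.
    by rewrite /m3 /regs_after /= ct2 z2 addn0.
  exists m3; split.
  + have := reaches_trans r1 (reaches_trans r2 (reaches_jump0 j1 dt2 r3)).
    have -> : o + lenE a + 11 + 1 = o + (lenE a + 12) by lia.
    apply: reaches_le; rewrite /= -addn1 -addnA.
    have : n * (timeE Z a + 7) <= Z * (timeE Z a + 7) by rewrite leq_mul2r leZ orbT.
    by lia.
  + by rewrite em3; case: eqP => [|_]; [lia|].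
  + move=> j hj; rewrite em3; case: eqP => [->//|/eqP jx]; exact: ot2.
Qed.

(** Commands change variables and arrays, so only the temporaries between [nv] and [t] are claimed
    to survive. A loop keeps its index and the number of rounds left in temporaries; a body that
    overwrites the index or bound variable does not disturb the iteration, as in the semantics by
    [iteri]. *)
Lemma compC_correct Z c o t s m :
  code_at o (compC o t c) -> nv < t -> wfC t c -> repr s m -> safe w Z c s ->
  exists m', [/\ reaches (timeC Z c) (RamState o m) (RamState (o + lenC c) m'),
    repr (run w c s) m' & forall j, nv < j < t -> m' j = m j].
Proof.
have nvb := nv_base.
have agree s0 t0 m0 m1 : repr s0 m0 -> nv < t0 -> t0 <= base ->
    (forall j, j < t0 \/ base <= j -> m1 j = m0 j) -> repr s0 m1.
  move=> r0 h0 h1 h; apply: repr_agree r0 _ => j [jnv|jb]; apply: h.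
    by left; apply: leq_ltn_trans h0.
  by right.
elim: c o t s m => [x e|k a b|a IHa b IHb|x y c IHc] o t s m /= hc ht hw hr hs.
- case/code_at_cat: hc => hca hcc; rewrite size_compE in hcc.
  case/andP: hw => hx we; have tb := wfE_lt we.
  have [m1 [r1 v1 k1]] := compE_correct hca ht we hr hs.
  have [_ z1 _] := agree _ _ _ _ hr ht (ltnW tb) k1.
  have r2 := exec_straight m1 hcc isT.
  eexists; split.
  + rewrite addnA; exact: reaches_trans r1 r2.
  + apply: repr_setv hr hx _ => j hj; rewrite /= v1 z1 addn0.
    case: eqP => // _; apply: k1; lia.
  + move=> j hj; rewrite /= (k1 j); last by left; lia.
    by case: eqP => // E; move: hx; rewrite -E; lia.
- case/code_at_cat: hc => hca /code_at_cat[hcb hcc].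
  rewrite !size_compE in hcb hcc.
  case/and4P: hw => hk wa wb tb; case: hs => sa sb.
  have [m1 [r1 v1 k1]] := compE_correct hca ht wa hr sa.
  have hr1 := agree _ _ _ _ hr ht (ltnW (ltnW (ltnW tb))) k1.
  have [m2 [r2 v2 k2]] := compE_correct hcb (ltnW ht) wb hr1 sb.
  have r3 := exec_straight m2 hcc isT.
  have e2 : m2 t = eval w a s by rewrite k2 ?v1 //; left.
  eexists; split.
  + rewrite !addnA; exact: reaches_trans (reaches_trans r1 r2) r3.
  + apply: repr_seta hr hk _ => j hj; rewrite /regs_after /=.
    have n1 : (t == t.+2) = false by lia.
    have n2 : (t.+1 == t) = false by lia.
    have n3 : (t.+1 == t.+2) = false by lia.
    have n4 : (t.+2 == t) = false by lia.
    rewrite ?(eqxx, n1, n2, n3, n4) /= e2 v2.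
    set v := eval w a s.
    have -> : v + v + (v + v) + (v + v + (v + v)) + (base + k) = base + 8 * v + k by lia.
    case: eqP => // _; ifs; rewrite k2 ?k1 //; lia.
  + move=> j hj; rewrite /regs_after /=.
    have n1 : (t == t.+2) = false by lia.
    have n2 : (t.+2 == t) = false by lia.
    rewrite ?(eqxx, n1, n2) /=.
    ifs; rewrite k2 ?k1 //; lia.
- case/code_at_cat: hc => hca hcb; rewrite size_compC in hcb.
  case/andP: hw => wa wb; case: hs => sa sb.
  have [m1 [r1 v1 k1]] := IHa _ _ _ _ hca ht wa hr sa.
  have [m2 [r2 v2 k2]] := IHb _ _ _ _ hcb ht wb v1 sb.
  exists m2; split=> //; last by move=> j hj; rewrite k2 ?k1.
  by rewrite addnA; apply: reaches_trans r1 r2.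
- case/and4P: hw => hx hy tb wa; case: hs => leZ sa.
  have [c1 c23] := @code_at_cat o [:: _; _; _; _] _ hc.
  have {c23} /code_at_cat[c2 c3] := c23.
  rewrite /= size_compC in c2 c3.
  have c11 : code_at o [:: IConst t 0; IAdd t.+1 y nv].
    by move=> i hi; rewrite c1; [case: i hi => [|[|]] | apply: ltn_trans hi _].
  have j1 : onth p (o + 2) = Some (IJumpZero t.+1 (o + lenC c + 8)) by rewrite c1.
  have c12 : code_at (o + 3) [:: IAdd x t nv].
    by case=> // _; rewrite -addnA c1.
  have c31 : code_at (o + 4 + lenC c) [:: IConst t.+2 1; IAdd t t t.+2; ISub t.+1 t.+1 t.+2].
    by move=> i hi; rewrite c3; [case: i hi => [|[|[|]]] | apply: ltn_trans hi _].
  have j2 : onth p (o + 4 + lenC c + 3) = Some (IJumpZero nv (o + 2)) by rewrite c3.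
  have r1 := exec_straight m c11 isT; move: r1.
  set m1 := regs_after _ _ => r1 /=.
  case: (hr) => hr1 hr2 hr3.
  have em1 j : m1 j = if j == t then 0 else if j == t.+1 then m y else m j.
    by rewrite /m1 /regs_after /=; ifs; rewrite ?hr2; lia.
  set n := vr s y in leZ sa *.
  pose S i := iteri i (fun i s' => run w c (setv s' x i)) s.
  have loop k : k <= n -> exists m2, [/\
     reaches (k * (timeC Z c + 6)) (RamState (o + 2) m1) (RamState (o + 2) m2),
     repr (S k) m2, m2 t = k, m2 t.+1 = n - k &
     forall j, nv < j < t -> m2 j = m j].
    elim: k => [|k IH] hk.
      exists m1; rewrite mul0n subn0; split; first exact: reaches_refl.
      + by apply: agree hr ht (ltnW (ltnW (ltnW tb))) _ => j hj; rewrite em1; ifs.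
      + by rewrite em1 eqxx.
      + rewrite em1 /n -hr1 //; ifs.
      + move=> j hj; rewrite em1; ifs.
    have [m2 [r2 rp2 at2 bt2 ot2]] := IH (ltnW hk).
    have nz : m2 t.+1 != 0 by rewrite bt2; lia.
    have [_ z2 _] := rp2.
    have r3 := exec_straight m2 c12 isT; move: r3.
    set m3 := regs_after _ _; rewrite -addnA /= => r3.
    have em3 j : m3 j = if j == x then k else m2 j.
      by rewrite /m3 /regs_after /= at2 z2 addn0.
    have rp3 : repr (setv (S k) x k) m3.
      by apply: repr_setv rp2 hx _ => j hj; rewrite em3; case: eqP => // /eqP jx.
    have [|m4 [r4 rp4 k4]] := IHc _ _ _ _ c2 _ wa rp3 (sa _ hk); first lia.
    have r5 := exec_straight m4 c31 isT; move: r5.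
    set m5 := regs_after _ _; rewrite /= => r5.
    have em5 j : m5 j = if j == t then (m4 t).+1 else if j == t.+1 then (m4 t.+1).-1
        else if j == t.+2 then 1 else m4 j.
      by rewrite /m5 /regs_after /=; ifs.
    have [_ z4 _] := rp4.
    have z5 : m5 nv = 0 by rewrite em5; do 3!(case: eqP => [|_]; first lia).
    exists m5; split.
    + rewrite mulSn addnC; apply: reaches_trans r2 _.
      have := reaches_trans r3 (reaches_trans r4 (reaches_trans r5 (reaches_jump0 j2 z5 (@reaches_refl 0 _)))).
      have E : (o + 2).+1 = o + 3 by lia.
      rewrite -E => H; apply: reaches_le (reaches_jumpS j1 nz H).
      by lia.
    + apply: agree rp4 ht _ _; first lia.
      by move=> j hj; rewrite em5; ifs.
    + rewrite em5 eqxx k4 ?em3 ?at2; last lia.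
      by case: eqP => [E|_]; [move: hx; rewrite -E; lia|].
    + rewrite em5; case: eqP => [|_]; first lia.
      rewrite eqxx k4 ?em3 ?bt2; last lia.
      by case: eqP => [E|_]; [move: hx; rewrite -E; lia|lia].
    + move=> j hj; rewrite em5; do 3!(case: eqP => [|_]; first lia).
      rewrite k4 ?em3 ?ot2 //; last lia.
      by case: eqP => [E|_] //; move: hx; rewrite -E; lia.
  have [m2 [r2 rp2 at2 bt2 ot2]] := loop n (leqnn _).
  rewrite subnn in bt2.
  exists m2; split=> //.
  have := reaches_trans r1 (reaches_trans r2 (reaches_jump0 j1 bt2 (@reaches_refl 0 _))).
  rewrite (addnA o); apply: reaches_le => /=.
  have : n * (timeC Z c + 6) <= Z * (timeC Z c + 6) by rewrite leq_mul2r leZ orbT.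
  by lia.
Qed.

End Simulation.

Transparent nv base.

Definition store0 : store := Store (fun=> 0) (fun _ _ => 0).

Definition compile (c : cmd) : program := compC 0 nv.+1 c.

Theorem compile_correct Z c w : wfC nv.+1 c -> safe w Z c store0 ->
  halts_within (compile c) w (timeC Z c) (vr (run w c store0) 0).
Proof.
move=> wf sf.
have hc : code_at (compile c) 0 (compC 0 nv.+1 c) by [].
have r0 : repr store0 (fun=> 0) by [].
have [m [[k hk e] [r _ _] _]] := compC_correct hc (ltnSn _) wf r0 sf.
by exists k => //; rewrite e /= r // add0n /compile size_compC.
Qed.

Fixpoint depthE (e : expr) : nat :=
  match e with
  | EC _ | EV _ | ELen => 0
  | EAdd a b | ESub a b => maxn (depthE a) (depthE b)
  | EArr _ a | EIn a => depthE a
  | EIf a b c => maxn (depthE a) (maxn (depthE b) (depthE c))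
  | ESum _ _ a => (depthE a).+1
  end.

Fixpoint depthC (c : cmd) : nat :=
  match c with
  | CAssign _ e => depthE e
  | CStore _ a b => maxn (depthE a) (depthE b)
  | CSeq a b => maxn (depthC a) (depthC b)
  | CFor _ _ c => (depthC c).+1
  end.

Lemma timeE_le Z e : timeE Z e <= lenE e * Z.+1 ^ depthE e.
Proof.
have P n : 0 < Z.+1 ^ n by rewrite expn_gt0.
have M a b c : b <= c -> a * Z.+1 ^ b <= a * Z.+1 ^ c.
  by move=> h; rewrite leq_mul2l leq_pexp2l ?orbT.
elim: e => [c|x|a IHa b IHb|a IHa b IHb|k a IHa|a IHa||a IHa b IHb c IHc|x y a IHa] /=;
  rewrite ?expn0 ?muln1 //.
- have := M (lenE a) _ _ (leq_maxl (depthE a) (depthE b)).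
  have := M (lenE b) _ _ (leq_maxr (depthE a) (depthE b)).
  by have := P (maxn (depthE a) (depthE b)); nia.
- have := M (lenE a) _ _ (leq_maxl (depthE a) (depthE b)).
  have := M (lenE b) _ _ (leq_maxr (depthE a) (depthE b)).
  by have := P (maxn (depthE a) (depthE b)); nia.
- by have := P (depthE a); nia.
- by have := P (depthE a); nia.
- set d := maxn _ _.
  have := M (lenE a) (depthE a) d (leq_maxl _ _).
  have := M (lenE b) (depthE b) d (leq_trans (leq_maxl _ _) (leq_maxr _ _)).
  have := M (lenE c) (depthE c) d (leq_trans (leq_maxr _ _) (leq_maxr _ _)).
  by have := P d; nia.
- by rewrite expnS; have := P (depthE a); nia.
Qed.

Lemma timeC_le Z c : timeC Z c <= lenC c * Z.+1 ^ depthC c.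
Proof.
have P n : 0 < Z.+1 ^ n by rewrite expn_gt0.
have M a b c' : b <= c' -> a * Z.+1 ^ b <= a * Z.+1 ^ c'.
  by move=> h; rewrite leq_mul2l leq_pexp2l ?orbT.
elim: c => [x e|k a b|a IHa b IHb|x y c IHc] /=.
- by have := timeE_le Z e; have := P (depthE e); nia.
- have := M (lenE a) _ _ (leq_maxl (depthE a) (depthE b)).
  have := M (lenE b) _ _ (leq_maxr (depthE a) (depthE b)).
  have := timeE_le Z a; have := timeE_le Z b.
  by have := P (maxn (depthE a) (depthE b)); nia.
- have := M (lenC a) _ _ (leq_maxl (depthC a) (depthC b)).
  have := M (lenC b) _ _ (leq_maxr (depthC a) (depthC b)).
  by have := P (maxn (depthC a) (depthC b)); nia.
- by rewrite expnS; have := P (depthC c); nia.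
Qed.

(** * Reasoning about programs *)

Lemma safeE_le Z Z' e s : Z <= Z' -> safeE Z e s -> safeE Z' e s.
Proof.
move=> h; elim: e s => //= [a IHa b IHb|a IHa b IHb|a IHa b IHb c IHc|x y a IHa] s.
- by case=> /IHa ? /IHb ?.
- by case=> /IHa ? /IHb ?.
- by case=> /IHa ? /IHb ? /IHc.
- by case=> h1 h2; split=> [|i hi]; [apply: leq_trans h|apply/IHa/h2].
Qed.

Lemma safe_le w Z Z' c s : Z <= Z' -> safe w Z c s -> safe w Z' c s.
Proof.
move=> h; elim: c s => /= [x e|k a b|a IHa b IHb|x y c IHc] s.
- exact: safeE_le.
- by case=> /(safeE_le h) ? /(safeE_le h).
- by case=> /IHa ? /IHb.
- by case=> h1 h2; split=> [|i hi]; [apply: leq_trans h|apply/IHc/h2].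
Qed.

Lemma bounded_ex (P : nat -> nat -> Prop) n :
  (forall i Z Z', Z <= Z' -> P i Z -> P i Z') -> (forall i, exists Z, P i Z) ->
  exists Z, forall i, i < n -> P i Z.
Proof.
move=> mono ex; elim: n => [|n [Z IH]]; first by exists 0.
have [Z' h'] := ex n; exists (maxn Z Z') => i; rewrite ltnS leq_eqVlt.
case/orP=> [/eqP ->|/IH h].
  by apply: mono h'; apply: leq_maxr.
by apply: mono h; apply: leq_maxl.
Qed.

Lemma safeE_ex e s : exists Z, safeE Z e s.
Proof.
elim: e s => [c|x|a IHa b IHb|a IHa b IHb|k a IHa|a IHa||a IHa b IHb c IHc|x y a IHa] s;
  try by exists 0.
- have [Z1 h1] := IHa s; have [Z2 h2] := IHb s; exists (maxn Z1 Z2).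
  by split; [apply: safeE_le h1; apply: leq_maxl|apply: safeE_le h2; apply: leq_maxr].
- have [Z1 h1] := IHa s; have [Z2 h2] := IHb s; exists (maxn Z1 Z2).
  by split; [apply: safeE_le h1; apply: leq_maxl|apply: safeE_le h2; apply: leq_maxr].
- exact: IHa.
- exact: IHa.
- have [Z1 h1] := IHa s; have [Z2 h2] := IHb s; have [Z3 h3] := IHc s.
  exists (Z1 + Z2 + Z3); split; [apply: safeE_le h1|apply: safeE_le h2|apply: safeE_le h3]; lia.
- have [Z h] := @bounded_ex (fun i Z => safeE Z a (setv s x i)) (vr s y)
    (fun i Z Z' h => @safeE_le _ _ _ _ h) (fun i => IHa _).
  exists (maxn Z (vr s y)); split=> [|i hi]; first exact: leq_maxr.
  by apply: safeE_le (h i hi); apply: leq_maxl.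
Qed.

Lemma safe_ex w c s : exists Z, safe w Z c s.
Proof.
elim: c s => [x e|k a b|a IHa b IHb|x y c IHc] s /=.
- exact: safeE_ex.
- have [Z1 h1] := safeE_ex a s; have [Z2 h2] := safeE_ex b s; exists (maxn Z1 Z2).
  by split; [apply: safeE_le h1; apply: leq_maxl|apply: safeE_le h2; apply: leq_maxr].
- have [Z1 h1] := IHa s; have [Z2 h2] := IHb (run w a s); exists (maxn Z1 Z2).
  by split; [apply: safe_le h1; apply: leq_maxl|apply: safe_le h2; apply: leq_maxr].
- have [Z h] := @bounded_ex (fun i Z => safe w Z c
      (setv (iteri i (fun i s' => run w c (setv s' x i)) s) x i)) (vr s y)
    (fun i Z Z' h => @safe_le _ _ _ _ _ h) (fun i => IHc _).
  exists (maxn Z (vr s y)); split=> [|i hi]; first exact: leq_maxr.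
  by apply: safe_le (h i hi); apply: leq_maxl.
Qed.

(** [computable] allows any halting time, so for each input whatever [Z] comes out of [safe_ex] will
    do. *)
Lemma run_computable c (f : nat -> nat) : wfC nv.+1 c ->
  (forall n, vr (run [:: n] c store0) 0 = f n) -> computable f.
Proof.
move=> wf h; exists (compile c) => n; have [Z sf] := safe_ex [:: n] c store0.
by exists (timeC Z c); rewrite -h; apply: compile_correct.
Qed.

Fixpoint modv (c : cmd) : seq nat :=
  match c with
  | CAssign x _ => [:: x]
  | CStore _ _ _ => [::]
  | CSeq a b => modv a ++ modv b
  | CFor x _ c => x :: modv c
  end.

Fixpoint moda (c : cmd) : seq nat :=
  match c with
  | CAssign _ _ => [::]
  | CStore k _ _ => [:: k]
  | CSeq a b => moda a ++ moda b
  | CFor _ _ c => moda c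
  end.

Lemma run_modv w c s x : x \notin modv c -> vr (run w c s) x = vr s x.
Proof.
elim: c s => [y e|k a b|a IHa b IHb|y z c IHc] s //=.
- by rewrite inE => /negbTE ->.
- by rewrite mem_cat negb_or => /andP[ha hb]; rewrite IHb ?IHa.
- rewrite inE negb_or => /andP[/negbTE xy hc].
  by elim: (vr s z) => //= n IH; rewrite IHc //= xy.
Qed.

Lemma run_moda w c s k : k \notin moda c -> ar (run w c s) k = ar s k.
Proof.
elim: c s => [y e|k' a b|a IHa b IHb|y z c IHc] s //=.
- by rewrite inE => /negbTE ->.
- by rewrite mem_cat negb_or => /andP[ha hb]; rewrite IHb ?IHa.
- by move=> hc; elim: (vr s z) => //= n IH; rewrite IHc.
Qed.

Lemma for_ind w (I : nat -> store -> Prop) x y c s : I 0 s ->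
  (forall i s', i < vr s y -> I i s' -> I i.+1 (run w c (setv s' x i))) ->
  I (vr s y) (run w (CFor x y c) s).
Proof.
move=> h0 hS; rewrite /=; elim: {-2}(vr s y) (leqnn (vr s y)) => //= n IH hn.
by apply: hS => //; apply: IH; apply: ltnW.
Qed.

(* Variables below 8 are the only loop bounds. *)
Fixpoint bndE (e : expr) : bool :=
  match e with
  | EC _ | EV _ | ELen => true
  | EAdd a b | ESub a b => bndE a && bndE b
  | EArr _ a | EIn a => bndE a
  | EIf a b c => [&& bndE a, bndE b & bndE c]
  | ESum x y a => [&& 8 <= x, y < 8 & bndE a]
  end.

Fixpoint bndC (c : cmd) : bool :=
  match c with
  | CAssign _ e => bndE e
  | CStore _ a b => bndE a && bndE b
  | CSeq a b => bndC a && bndC b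
  | CFor x y c => [&& 8 <= x, y < 8 & bndC c]
  end.

Definition small (Z : nat) (s : store) : Prop := forall x, x < 8 -> vr s x <= Z.

Lemma bndE_safe Z e s : bndE e -> small Z s -> safeE Z e s.
Proof.
elim: e s => //= [a IHa b IHb|a IHa b IHb|a IHa b IHb c IHc|x y a IHa] s.
- by case/andP=> ha hb sm; split; [apply: IHa|apply: IHb].
- by case/andP=> ha hb sm; split; [apply: IHa|apply: IHb].
- by case/and3P=> ha hb hc sm; split; [apply: IHa|apply: IHb|apply: IHc].
- case/and3P=> hx hy ha sm; split; first exact: sm.
  move=> i hi; apply: IHa => // z hz /=; case: eqP => [E|_]; last exact: sm.
  by move: hx; rewrite -E leqNgt hz.
Qed.

Lemma small_run w Z c s : all (leq 8) (modv c) -> small Z s -> small Z (run w c s).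
Proof.
move=> /allP h sm x hx; rewrite run_modv; first exact: sm.
by apply/negP=> /h; rewrite leqNgt hx.
Qed.

Lemma small_setv Z s x v : x < 8 -> v <= Z -> small Z s -> small Z (setv s x v).
Proof. by move=> hx hv sm y hy /=; case: eqP => // _; apply: sm. Qed.

Lemma small_setv8 Z s x v : 8 <= x -> small Z s -> small Z (setv s x v).
Proof.
move=> hx sm y hy /=; case: eqP => [E|_]; last exact: sm.
by move: hx; rewrite -E leqNgt hy.
Qed.

(** Loop bounds are read from variables below 8 and the command assigns only variables from 8 on, so
    smallness persists through all iterations. Safety of most program blocks thus becomes a boolean
    computation. *)
Lemma bndC_safe w Z c s : bndC c -> all (leq 8) (modv c) -> small Z s ->
  safe w Z c s.
Proof.
elim: c s => /= [x e|k a b|a IHa b IHb|x y c IHc] s.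
- by move=> he _ sm; apply: bndE_safe.
- by case/andP=> ha hb _ sm; split; apply: bndE_safe.
- case/andP=> ba bb; rewrite all_cat => /andP[ha hb] sm.
  by split; [apply: IHa|apply: IHb => //; apply: small_run].
- case/and3P=> hx hy bc /andP[_ hc] sm; split; first exact: sm.
  move=> i hi; apply: IHc => //; apply: small_setv8 => //.
  elim: i {hi} => //= i IH; apply: small_run => //; exact: small_setv8.
Qed.

(** * The model checking program *)

Lemma sum_ord_const n c : \sum_(i < n) c = n * c.
Proof. by rewrite big_const_ord iter_addn_0 mulnC. Qed.

Lemma nat_of_bool_eq0 (b : bool) : (b == 0 :> nat) = ~~ b.
Proof. by case: b. Qed.

Definition ENot a := EIf a (EC 0) (EC 1).
Definition EEq a b := EIf (ESub a b) (EC 0) (EIf (ESub b a) (EC 0) (EC 1)).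
Definition ELt a b := EIf (ESub b a) (EC 1) (EC 0).
Definition EAnd a b := EIf a (EIf b (EC 1) (EC 0)) (EC 0).
Definition EOr a b := EIf a (EC 1) (EIf b (EC 1) (EC 0)).
Definition ECap a b := EIf (ESub a b) b a.

Section Helpers.
Variables (w : seq nat) (s : store).

Lemma evalNot a : eval w (ENot a) s = (eval w a s == 0).
Proof. by rewrite /=; case: eqP. Qed.

Lemma evalEq a b : eval w (EEq a b) s = (eval w a s == eval w b s).
Proof. by rewrite /= !subn_eq0; case: ltngtP. Qed.

Lemma evalLt a b : eval w (ELt a b) s = (eval w a s < eval w b s).
Proof. by rewrite /= subn_eq0; case: ltngtP. Qed.

Lemma evalAnd a b : eval w (EAnd a b) s = (eval w a s != 0) && (eval w b s != 0).
Proof. by rewrite /=; case: eqP => // _; case: eqP. Qed.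

Lemma evalOr a b : eval w (EOr a b) s = (eval w a s != 0) || (eval w b s != 0).
Proof. by rewrite /=; case: eqP => // _; case: eqP. Qed.

Lemma evalCap a b : eval w (ECap a b) s = minn (eval w b s) (eval w a s).
Proof. by rewrite /= subn_eq0 /minn; case: ltngtP. Qed.

Lemma evalSum x y a : eval w (ESum x y a) s = \sum_(i < vr s y) eval w a (setv s x i).
Proof. by []. Qed.

Lemma evalIf a b c : eval w (EIf a b c) s = if eval w a s == 0 then eval w c s else eval w b s.
Proof. by []. Qed.

Definition evalB := (evalNot, evalEq, evalLt, evalAnd, evalOr, evalCap).

End Helpers.

Arguments ENot : simpl never.
Arguments EEq : simpl never.
Arguments ELt : simpl never.
Arguments EAnd : simpl never.
Arguments EOr : simpl never.
Arguments ECap : simpl never.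

(** The hypothesis says that [e] does not read array [k]: entries already written then cannot
    influence later ones, and the table is filled as if all at once. *)
Lemma run_table w k x y e s (g : nat -> nat) :
  (forall i s', i < vr s y -> vr s' x = i ->
     (forall z, z != x -> vr s' z = vr s z) ->
     (forall k', k' != k -> ar s' k' = ar s k') -> eval w e s' = g i) ->
  forall i, i < vr s y -> ar (run w (CFor x y (CStore k (EV x) e)) s) k i = g i.
Proof.
move=> h; pose I n s' := [/\ forall i, i < n -> ar s' k i = g i,
  forall z, z != x -> vr s' z = vr s z & forall k', k' != k -> ar s' k' = ar s k'].
have [] : I (vr s y) (run w (CFor x y (CStore k (EV x) e)) s).
  apply: for_ind => [|i s' hi [h1 h2 h3]]; first by split.
  have hz z : z != x -> vr (setv s' x i) z = vr s z by move=> zx /=; rewrite (negbTE zx) h2.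
  split=> //=.
  - move=> j; rewrite !eqxx /= ltnS leq_eqVlt; case: eqP => [-> _|ne /= hj].
      by apply: h => //=; rewrite eqxx.
    exact: h1.
  - by move=> k' /negbTE kk; rewrite -h3 ?kk.
by move=> h1 _ _.
Qed.

(** Minimum search in the form of a double sum, which a single expression can compute: [q] is
    counted as long as no [v <= q] satisfies [P]. The value is [n] if nothing satisfies [P]. *)
Definition least n (P : nat -> bool) : nat :=
  \sum_(q < n) (\sum_(v < n) (~~ (q < v) && P v) == 0).

Lemma leastE n P : least n P = find P (iota 0 n).
Proof.
rewrite /least.
have H (q : 'I_n) : (\sum_(v < n) (~~ (q < v) && P v) == 0) = (q < find P (iota 0 n)).
  rewrite sum_nat_eq0; apply/forallP/idP=> [h|h v].
    rewrite ltnNge; apply/negP=> hq.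
    have fn : find P (iota 0 n) < n by apply: leq_ltn_trans hq (ltn_ord q).
    have := h (Ordinal fn); rewrite /= -leqNgt hq /=.
    have /(nth_find 0) : has P (iota 0 n) by rewrite has_find size_iota.
    by rewrite nth_iota // add0n => ->.
  apply/implyP=> _; rewrite nat_of_bool_eq0 -leqNgt; apply/negP=> /andP[vq Pv].
  have := before_find 0 (leq_ltn_trans vq h).
  by rewrite nth_iota // add0n Pv.
under eq_bigr => q _ do rewrite H.
rewrite -(big_mkord xpredT (fun q => (q < find P (iota 0 n)) : nat)).
have hf : find P (iota 0 n) <= n by rewrite -{2}(size_iota 0 n) find_size.
rewrite (big_cat_nat (leq0n _) hf) //= [X in _ + X]big1_seq ?addn0; last first.
  by move=> i /andP[_]; rewrite mem_index_iota => /andP[h _]; rewrite ltnNge h.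
rewrite (eq_big_nat _ _ (F2 := fun=> 1)); last by move=> i /andP[_ ->].
by rewrite sum_nat_const_nat subn0 muln1.
Qed.

(** An equivalence class is named by its least member, so equality of names decides the relation. *)
Lemma least_rel n (r : rel nat) u v : (forall x, x < n -> r x x) ->
  (forall x y z, x < n -> y < n -> z < n -> r x y -> r z y = r z x) ->
  u < n -> v < n -> (least n (r^~ u) == least n (r^~ v)) = r u v.
Proof.
move=> rr rt un vn.
have nthf x : x < n -> let f := find (r^~ x) (iota 0 n) in f < n /\ r f x.
  move=> xn f; have hs : has (r^~ x) (iota 0 n).
    by apply/hasP; exists x; rewrite ?mem_iota ?rr.
  have fn : f < n by rewrite /f -{2}(size_iota 0 n) -has_find.
  by have := nth_find 0 hs; rewrite nth_iota.
rewrite !leastE; apply/eqP/idP=> [e|uv].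
  have [f1 r1] := nthf u un; have [f2 r2] := nthf v vn.
  rewrite e in r1 f1.
  by rewrite (rt _ _ _ f2 vn un r2) -(rt _ _ _ f1 un un r1) rr.
apply: eq_in_find => x; rewrite mem_iota add0n => /andP[_ xn].
by rewrite (rt u v x).
Qed.

Lemma evalC w s c : eval w (EC c) s = c. Proof. by []. Qed.
Lemma evalV w s x : eval w (EV x) s = vr s x. Proof. by []. Qed.
Lemma evalAdd w s a b : eval w (EAdd a b) s = eval w a s + eval w b s. Proof. by []. Qed.
Lemma evalSub w s a b : eval w (ESub a b) s = eval w a s - eval w b s. Proof. by []. Qed.
Lemma evalArr w s k a : eval w (EArr k a) s = ar s k (eval w a s). Proof. by []. Qed.
Lemma evalIn w s a : eval w (EIn a) s = nth 0 w (eval w a s). Proof. by []. Qed.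
Lemma evalLen w s : eval w ELen s = size w. Proof. by []. Qed.
Definition evalE := (evalC, evalV, evalAdd, evalSub, evalArr, evalIn, evalLen).

Lemma run_seq w c1 c2 s : run w (CSeq c1 c2) s = run w c2 (run w c1 s). Proof. by []. Qed.
Lemma run_assign w x e s : run w (CAssign x e) s = setv s x (eval w e s). Proof. by []. Qed.
Lemma run_store w k a b s : run w (CStore k a b) s = seta s k (eval w a s) (eval w b s).
Proof. by []. Qed.
Lemma run_for w x y c s : run w (CFor x y c) s =
  iteri (vr s y) (fun i s' => run w c (setv s' x i)) s.
Proof. by []. Qed.

Arguments eval : simpl never.
Arguments run : simpl never.

(* Variables: 1 [N], 2 [L], 3 [K], 5 the number of tree nodes, 6 and 7 scratch
   loop bounds; 8-18 and 24 indices, 12 a dummy index; 19 the next free node, 20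
   the first node of the current level, 21 [mode], 22 [M], 23 an accumulator.
   Arrays: 0 numbers of non-neighbours, 1 labels, 2 and 3 colour classes,
   4 environments of nodes, 5 parents, 6 ends of subformulas, 7 truth values. *)

Definition EMul y e := ESum 12 y e.
Definition EAdj a b := EIn (EAdd (EC 1) (EAdd (EMul 1 a) b)).
Definition ELeast e :=
  ESum 24 1 (ENot (ESum 9 1 (EAnd (ENot (ELt (EV 24) (EV 9))) e))).
Definition EEnv t j := EArr 4 (EAdd (EMul 2 t) j).
Arguments EMul : simpl never.
Arguments EAdj : simpl never.
Arguments ELeast : simpl never.
Arguments EEnv : simpl never.

Definition c_nn := CFor 8 1 (CStore 0 (EV 8)
  (ESum 10 1 (EAnd (ENot (EEq (EV 8) (EV 10))) (ENot (EAdj (EV 8) (EV 10)))))).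

Definition c_mode :=
  CAssign 21 (ELt (EC 3) (ESum 10 1 (ELt (EC 2) (EArr 0 (EV 10))))).

Definition e_twin := ENot (ESum 10 1 (EAnd (ENot (EEq (EV 10) (EV 9)))
  (EAnd (ENot (EEq (EV 10) (EV 8)))
        (ENot (EEq (EAdj (EV 9) (EV 10)) (EAdj (EV 8) (EV 10))))))).

Definition c_lab := CFor 8 1 (CStore 1 (EV 8)
  (EIf (EV 21) (ELt (EArr 0 (EV 8)) (EC 3)) (ELeast e_twin))).

Definition c_label := CSeq c_nn (CSeq c_mode c_lab).

Definition ESparse a b :=
  EAnd (EV 21) (EAnd (ENot (EEq (EArr 1 a) (EArr 1 b))) (ENot (EAdj a b))).
Definition e_same0 := EAnd (EEq (EArr 1 (EV 9)) (EArr 1 (EV 8)))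
  (ENot (ESum 13 2 (EAnd (ELt (EV 13) (EV 15))
     (ENot (EEq (EEq (EEnv (EV 14) (EV 13)) (EV 9)) (EEq (EEnv (EV 14) (EV 13)) (EV 8))))))).
Definition ECount a :=
  ECap (ESum 10 1 (EAnd (ESparse a (EV 10)) (EEq (EArr 2 (EV 10)) (EV 11)))) (EV 3).
Definition e_sameS := EAnd (EEq (EArr 2 (EV 9)) (EArr 2 (EV 8)))
  (ENot (ESum 11 1 (ENot (EEq (ECount (EV 9)) (ECount (EV 8)))))).
Arguments ESparse : simpl never.
Arguments ECount : simpl never.

(** The new classes go to array 3 first, because every vertex treated in the round still has to see
    the old classes in array 2. *)
Definition c_round := CSeq (CFor 8 1 (CStore 3 (EV 8) (ELeast e_sameS)))
                           (CFor 8 1 (CStore 2 (EV 8) (EArr 3 (EV 8)))).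
Definition c_refine := CSeq (CFor 8 1 (CStore 2 (EV 8) (ELeast e_same0)))
                            (CFor 16 3 c_round).

(** * Labels, colour classes and candidates as functions on numbers *)

Section Spec.
Variables (N L K M : nat) (A : nat -> nat -> bool).

Definition nnb (u : nat) := \sum_(x < N) ((u != x :> nat) && ~~ A u x).
(** A vertex of [A] has at most two non-neighbours, namely its ends, while a vertex of [B] misses
    all others of [B]. Hence, if at least four vertices of [B] are present, all of them have at
    least three non-neighbours and the sides can be told apart; [mode] detects exactly this case. *)
Definition mode := 3 < \sum_(x < N) (2 < nnb x).
Definition twinb (v u : nat) :=
  \sum_(x < N) [&& x != v :> nat, x != u :> nat & A v x != A u x] == 0.
(** In [mode] the label is the side, 1 standing for [A]. Otherwise the sparse relation [Sn] is empty
    and the labels alone must determine adjacency, which twin classes do. *)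
Definition labn (u : nat) : nat := if mode then nat_of_bool (nnb u < 3) else least N (twinb^~ u).
Definition Sn (a b : nat) := [&& mode, labn a != labn b & ~~ A a b].

Definition same0 (ps : seq nat) v u :=
  (labn v == labn u) && all (fun p => (p == v) == (p == u)) ps.

Definition count_col (f : nat -> nat) a y := \sum_(x < N) (Sn a x && (f x == y)).

Definition sameS (f : nat -> nat) v u := (f v == f u) &&
  (\sum_(y < N) (minn K (count_col f v y) != minn K (count_col f u y)) == 0).

Fixpoint cl (ps : seq nat) l : nat -> nat :=
  if l is l'.+1 then fun u => least N (sameS (cl ps l') ^~ u)
  else fun u => least N (same0 ps ^~ u).

(** The program cannot know which of the two cases of the analysis it is in. The first alternative
    is exhaustive if the graph has at most [M] vertices; the second picks the vertex naming each
    colour class. *)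
Definition cand ps u := (u < M) || (cl ps K u == u).

End Spec.

Section Blocks.
Variables (w : seq nat) (N L K M : nat) (A : nat -> nat -> bool).
Hypothesis inA : forall u v, u < N -> v < N -> nth 0 w (1 + (N * u + v)) = A u v.

Definition params s := [/\ vr s 1 = N, vr s 2 = L, vr s 3 = K & vr s 22 = M].

Lemma evalMul y a s c : (forall i, eval w a (setv s 12 i) = c) ->
  eval w (EMul y a) s = vr s y * c.
Proof.
by move=> h; rewrite /EMul evalSum -sum_ord_const; apply: eq_bigr => i _; rewrite h.
Qed.

Lemma evalAdj x y s : x != 12 -> vr s 1 = N -> vr s x < N -> vr s y < N ->
  eval w (EAdj (EV x) (EV y)) s = A (vr s x) (vr s y).
Proof.
move=> x12 sN hx hy; rewrite -inA // /EAdj !evalE (@evalMul _ _ _ (vr s x)) ?sN //.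
by move=> i; rewrite evalE /= (negbTE x12).
Qed.

Lemma evalLeast e s (P : nat -> bool) :
  (forall q v, v < vr s 1 -> eval w e (setv (setv s 24 q) 9 v) = P v) ->
  eval w (ELeast e) s = least (vr s 1) P.
Proof.
move=> h; rewrite /ELeast evalSum; apply: eq_bigr => q _.
rewrite evalNot evalSum; congr (nat_of_bool (_ == 0)); apply: eq_bigr => v _.
by rewrite evalAnd evalNot evalLt h // !nat_of_bool_eq0 !negbK.
Qed.

Lemma run_nn s : vr s 1 = N ->
  forall u, u < N -> ar (run w c_nn s) 0 u = nnb N A u.
Proof.
move=> sN u un; rewrite /c_nn (run_table (g := nnb N A)) ?sN //.
move=> i s' hi xi hv ha; rewrite evalSum hv // sN; apply: eq_bigr => x _.
rewrite !evalB evalAdj ?evalE /= ?xi ?hv ?sN // !nat_of_bool_eq0.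
by rewrite !negbK.
Qed.

Definition labelled s := vr s 21 = mode N A /\ forall u, u < N -> ar s 1 u = labn N A u.

Lemma run_label s : vr s 1 = N -> labelled (run w c_label s).
Proof.
move=> sN; rewrite /c_label !run_seq /c_mode run_assign; set s1 := run w c_nn s.
have s1N : vr s1 1 = N by rewrite run_modv.
have nn1 := run_nn sN; rewrite -/s1 in nn1.
set s2 := setv _ _ _.
have m2 : vr s2 21 = mode N A.
  rewrite /s2 /= evalLt /mode evalC evalSum s1N; congr (nat_of_bool (_ < _)).
  by apply: eq_bigr => x _; rewrite evalLt !evalE /= nn1.
split; first by rewrite run_modv.
have s2N : vr s2 1 = N by rewrite /s2 /=.
move=> u un; rewrite /c_lab (run_table (g := labn N A)) ?s2N //.
move=> i s' hi xi hv ha; rewrite evalIf evalE hv // m2 nat_of_bool_eq0 /labn.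
case: mode => /=.
  by rewrite evalLt !evalE xi ha //= nn1.
rewrite (evalLeast (P := fun v => twinb N A v i)) ?hv ?s2N // => q v vN.
rewrite /e_twin evalNot evalSum /twinb /= hv // s2N; congr (nat_of_bool (_ == 0)).
apply: eq_bigr => x _; rewrite !evalB !evalAdj ?evalE /= ?xi ?hv ?s2N //.
by rewrite !nat_of_bool_eq0 !negbK; case: (A _ _); case: (A _ _).
Qed.

Lemma evalSparse x y s : x != 12 -> vr s 1 = N -> labelled s ->
  vr s x < N -> vr s y < N -> eval w (ESparse (EV x) (EV y)) s = Sn N A (vr s x) (vr s y).
Proof.
move=> x12 sN [sm sl] hx hy; rewrite /ESparse !evalB evalAdj // ?evalE sm !sl //.
by rewrite !nat_of_bool_eq0 !negbK.
Qed.

Lemma evalEnv x y s : x != 12 -> vr s 2 = L ->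
  eval w (EEnv (EV x) (EV y)) s = ar s 4 (L * vr s x + vr s y).
Proof.
by move=> x12 sL; rewrite /EEnv !evalE (@evalMul _ _ _ (vr s x)) ?sL // => i; rewrite evalE /= (negbTE x12).
Qed.

Definition has_env s t ps :=
  size ps <= L /\ forall j, j < size ps -> ar s 4 (L * t + j) = nth 0 ps j.

Lemma run_refine s ps : params s -> labelled s -> vr s 15 = size ps ->
  has_env s (vr s 14) ps ->
  forall u, u < N -> ar (run w c_refine s) 2 u = cl N K A ps K u.
Proof.
move=> [sN sL sK sM] [sm sl] sd [szL env].
pose I l s' := [/\ forall u, u < N -> ar s' 2 u = cl N K A ps l u,
  vr s' 1 = N /\ vr s' 3 = K & labelled s'].
rewrite /c_refine run_seq; set c0 := CFor 8 1 _; set s0 := run w c0 s.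
have : I K (run w (CFor 16 3 c_round) s0).
  have s0K : vr s0 3 = K by rewrite /s0 run_modv.
  rewrite -s0K; apply: for_ind.
    split; last by split=> [|u un]; rewrite ?run_modv ?run_moda ?sl.
      move=> u un; rewrite /s0 /c0 (run_table (g := cl N K A ps 0)) ?sN //.
      move=> i s' hi xi hv ha.
      rewrite (evalLeast (P := same0 N A ps ^~ i)) ?hv ?sN // => q v vN.
      rewrite /e_same0 evalAnd evalEq evalNot evalSum !evalE /= xi ha // !sl //.
      rewrite !nat_of_bool_eq0 !negbK /same0; congr (nat_of_bool (_ && _)).
      rewrite hv // sL; apply/eqP/allP=> [h p pps|h].
        have jp : index p ps < size ps by rewrite index_mem.
        have jL := leq_trans jp szL.
        move/eqP: h; rewrite sum_nat_eq0 => /forallP/(_ (Ordinal jL)).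
        rewrite /= evalAnd evalLt evalNot !evalEq !evalEnv ?evalE /= ?xi ?hv // !ha // ?sd jp.
        by rewrite env // nth_index //; case: (p == v); case: (p == i).
      apply: big1 => j _; rewrite /= evalAnd evalLt evalNot !evalEq !evalEnv ?evalE /= ?xi ?hv // !ha // sd.
      case: (ltnP j (size ps)) => // jp.
      rewrite env //; have := h (nth 0 ps j) (mem_nth _ jp).
      by case: (_ == v); case: (_ == i).
    by rewrite !run_modv.
  move=> l s' _ [hc [s'N s'K] s'l]; rewrite /c_round run_seq.
  set t0 := setv s' 16 l; set c1 := CFor 8 1 (CStore 3 _ _); set t1 := run w c1 t0.
  have t0N : vr t0 1 = N by [].
  have t1N : vr t1 1 = N by rewrite run_modv.
  have h1 u : u < N -> ar t1 3 u = cl N K A ps l.+1 u.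
    move=> un; rewrite /t1 /c1 (run_table (g := cl N K A ps l.+1)) ?t0N //.
    move=> i s2 hi xi hv ha.
    have lab2 : forall q v y z, labelled (setv (setv (setv (setv s2 24 q) 9 v) 11 y) 10 z).
      case: s'l => m1 m2 q v y z; split=> [|x xN] /=; first by rewrite hv.
      by rewrite ha //= m2.
    rewrite (evalLeast (P := sameS N K A (cl N K A ps l) ^~ i)) ?hv ?t0N // => q v vN.
    rewrite /e_sameS evalAnd evalEq evalNot evalSum !evalE /= xi ha //= !hc //.
    rewrite !nat_of_bool_eq0 !negbK /sameS; congr (nat_of_bool (_ && (_ == _))).
    rewrite hv // t0N; apply: eq_bigr => y _.
    have cnt z : z \in [:: 8; 9] -> eval w (ECount (EV z)) (setv (setv (setv s2 24 q) 9 v) 11 y) =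
        minn K (count_col N A (cl N K A ps l) (if z == 8 then i else v) y).
      rewrite !inE => /orP[] /eqP ->; rewrite /ECount evalCap evalSum evalE /= hv //= s'K hv //= s'N;
      congr minn; apply: eq_bigr => x _; rewrite evalAnd evalEq evalSparse ?evalE /= ?xi ?ha ?hc ?hv //=;
      by rewrite !nat_of_bool_eq0 !negbK.
    by rewrite evalNot evalEq !cnt // nat_of_bool_eq0.
  split.
  - move=> u un; rewrite (run_table (g := cl N K A ps l.+1)) ?t1N //.
    by move=> i s2 hi xi hv ha; rewrite !evalE xi ha // h1.
  - by rewrite !run_modv.
  - by case: s'l => m1 m2; split=> [|u un]; rewrite ?run_modv ?run_moda //= m2.
by case.
Qed.

End Blocks.

(** * Programs for the tree of environments and for the evaluation on it *)

(** There is no conditional command: the prospective child is always written into the free row, and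
    the counter 19 advances only if the vertex is a candidate and the parent belongs to the current
    level. A rejected row is overwritten by the next attempt. The new vertex comes first, in
    accordance with the de Bruijn indices. *)
Definition c_exp1 := CSeq
  (CFor 13 2 (CStore 4 (EAdd (EMul 2 (EV 19)) (EV 13))
     (EIf (EV 13) (EEnv (EV 14) (ESub (EV 13) (EC 1))) (EV 8))))
  (CSeq (CStore 5 (EV 19) (EV 14))
        (CAssign 19 (EAdd (EV 19) (EAnd (ENot (ELt (EV 14) (EV 20)))
           (EOr (ELt (EV 8) (EV 22)) (EEq (EArr 2 (EV 8)) (EV 8))))))).

Definition c_node := CSeq c_refine (CFor 8 1 c_exp1).

Definition c_level := CSeq (CAssign 5 (EV 19))
  (CSeq (CFor 14 5 c_node) (CAssign 20 (EV 5))).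

Definition c_tree := CSeq (CAssign 19 (EC 1)) (CSeq (CAssign 20 (EC 0))
  (CSeq (CFor 15 2 c_level) (CAssign 5 (EV 19)))).

Definition ETok k := EIn (EAdd (EC k.+1) (EAdd (EMul 1 (EV 1)) (EV 17))).
Definition EVal p t := EArr 7 (EAdd (EMul 5 p) t).
Definition e_next := EArr 6 (EAdd (EV 17) (EC 1)).
(** The encoding is in prefix form without lengths. Atoms take three letters; otherwise the end is
    that of the last subformula, and the second conjunct starts where the first one ends, at
    [e_next]. *)
Definition e_end := EIf (ELt (ETok 0) (EC 2)) (EAdd (EV 17) (EC 3))
  (EIf (EEq (ETok 0) (EC 3)) (EArr 6 e_next) e_next).
(** In the quantifier case the leading test on variable 10 excludes the root, whose parent entry
    keeps its initial value 0 and would make it a child of itself. *)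
Definition e_val :=
  EIf (EEq (ETok 0) (EC 0)) (EEq (EEnv (EV 14) (ETok 1)) (EEnv (EV 14) (ETok 2)))
  (EIf (EEq (ETok 0) (EC 1)) (EAdj (EEnv (EV 14) (ETok 1)) (EEnv (EV 14) (ETok 2)))
  (EIf (EEq (ETok 0) (EC 2)) (ENot (EVal (EAdd (EV 17) (EC 1)) (EV 14)))
  (EIf (EEq (ETok 0) (EC 3)) (EAnd (EVal (EAdd (EV 17) (EC 1)) (EV 14)) (EVal e_next (EV 14)))
  (ELt (EC 0) (ESum 10 5 (EAnd (EV 10) (EAnd (EEq (EArr 5 (EV 10)) (EV 14))
     (EVal (EAdd (EV 17) (EC 1)) (EV 10))))))))).
Arguments ETok : simpl never.
Arguments EVal : simpl never.

(** Positions are treated from right to left, so subformulas come before the formulas containing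
    them. Each position is evaluated at every node; the values are meaningful where the length of
    the environment fits the subformula. *)
Definition c_eval := CFor 18 2
  (CSeq (CAssign 17 (ESub (ESub (EV 2) (EC 1)) (EV 18)))
  (CSeq (CStore 6 (EV 17) e_end)
        (CFor 14 5 (CStore 7 (EAdd (EMul 5 (EV 17)) (EV 14)) e_val)))).

(** The tree program reassigns the loop bound 5 to the current number of nodes, so its safety
    depends on the invariant and both have to be proved together. *)
Lemma for_ind_safe w Z (I : nat -> store -> Prop) x y c s : vr s y <= Z -> I 0 s ->
  (forall i s', i < vr s y -> I i s' ->
     safe w Z c (setv s' x i) /\ I i.+1 (run w c (setv s' x i))) ->
  safe w Z (CFor x y c) s /\ I (vr s y) (run w (CFor x y c) s).
Proof.
move=> hZ h0 hS; rewrite run_for.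
have Ii i : i <= vr s y -> I i (iteri i (fun i s' => run w c (setv s' x i)) s).
  by elim: i => //= i IH hi; apply: (hS i _ hi _).2; apply: IH; apply: ltnW.
split; last exact: Ii.
by split=> // i hi; apply: (hS i _ hi (Ii _ (ltnW hi))).1.
Qed.

(** * Correctness of the tree of environments *)

Section TreeBuilding.
Variables (w : seq nat) (N L K M C Z : nat) (A : nat -> nat -> bool).
Hypothesis inA : forall u v, u < N -> v < N -> nth 0 w (1 + (N * u + v)) = A u v.
Let cnd := cand N K M A.
Hypothesis cand_le : forall ps, size ps < L -> all (fun u => u < N) ps ->
  \sum_(u < N) cnd ps u <= C.

Lemma evalEnvG x e s : x != 12 -> vr s 2 = L ->
  eval w (EEnv (EV x) e) s = ar s 4 (L * vr s x + eval w e s).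
Proof.
move=> x12 sL; rewrite /EEnv !evalE (@evalMul _ _ _ _ (vr s x)) ?sL // => i.
by rewrite evalE /= (negbTE x12).
Qed.

Lemma run_exp1 s : params N L K M s -> vr s 14 < vr s 19 ->
  let s1 := run w c_exp1 s in
  [/\ vr s1 19 = vr s 19 + ((vr s 20 <= vr s 14) &&
        ((vr s 8 < M) || (ar s 2 (vr s 8) == vr s 8))),
      forall x, ar s1 5 x = if x == vr s 19 then vr s 14 else ar s 5 x,
      forall j, j < L -> ar s1 4 (L * vr s 19 + j) =
        if j is j'.+1 then ar s 4 (L * vr s 14 + j') else vr s 8
    & forall x, x < L * vr s 19 -> ar s1 4 x = ar s 4 x].
Proof.
move=> [sN sL sK sM] tn; rewrite /c_exp1 !run_seq run_store run_assign.
set c0 := CFor 13 2 _; set s0 := run w c0 s.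
have fv x : x != 13 -> vr s0 x = vr s x by move=> hx; rewrite run_modv // inE.
have fa k : k != 4 -> ar s0 k = ar s k by move=> hk; rewrite run_moda // inE.
pose I n s' := [/\ forall x, x != 13 -> vr s' x = vr s x,
  forall j, j < n -> ar s' 4 (L * vr s 19 + j) =
        if j is j'.+1 then ar s 4 (L * vr s 14 + j') else vr s 8
  & forall x, x < L * vr s 19 -> ar s' 4 x = ar s 4 x].
have [] : I (vr s 2) s0.
  apply: for_ind => [|i s' hi [h1 h2 h3]]; first by split.
  have ea : eval w (EAdd (EMul 2 (EV 19)) (EV 13)) (setv s' 13 i) = L * vr s 19 + i.
    rewrite !evalE (@evalMul _ _ _ _ (vr s 19)) /= ?h1 ?sL // => q.
    by rewrite evalE /= h1.
  rewrite run_store ea; split=> //=.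
  - by move=> x hx; rewrite (negbTE hx) h1.
  - move=> j; rewrite ltnS leq_eqVlt eqn_add2l; case: eqP => [-> _|ne /= hj]; last exact: h2.
    rewrite evalIf evalEnvG //= ?h1 // !evalE /=; case: i hi {ea h2} => [|i] hi; first by rewrite h1.
    rewrite /= subn1 h3 //; rewrite sL in hi.
    apply: leq_trans (_ : L * (vr s 14).+1 <= _); last by rewrite leq_mul2l tn orbT.
    by rewrite mulnS addnC ltn_add2r ltnW.
  - move=> x hx; case: eqP => [e|_]; last exact: h3.
    by move: hx; rewrite e ltnNge leq_addr.
rewrite sL => _ h2 h3; split=> /=.
- rewrite !evalE !evalB !evalE /= !fv // !fa // sM; congr (_ + _).
  by rewrite !nat_of_bool_eq0 !negbK -leqNgt.
- by move=> x; rewrite !evalE /= !fv // fa.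
- by move=> j hj; rewrite h2.
- by move=> x hx; rewrite h3.
Qed.

Definition node_ok s (E : nat -> seq nat) n x :=
  ar s 5 x < n /\ exists u, [/\ u < N, cnd (E (ar s 5 x)) u & E x = u :: E (ar s 5 x)].

Definition complete s (E : nat -> seq nat) n t :=
  forall u, u < N -> cnd (E t) u -> exists x, [/\ 0 < x < n, ar s 5 x = t & E x = u :: E t].

(** [E] is a ghost function: the store has a row of [L] cells for every node, and [E x] is the part
    of row [x] in use. Node 0 is the root. *)
Definition tree_ok s (E : nat -> seq nat) n :=
  [/\ 0 < n, E 0 = [::], forall x, x < n -> has_env L s x (E x)
    & forall x, 0 < x < n -> node_ok s E n x].

Lemma env_lt s E n x : tree_ok s E n -> x < n -> all (fun u => u < N) (E x).
Proof.
move=> [_ E0 _ hn]; have [m] := ubnP (size (E x)); elim: m x => // m IH x hm xc.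
case: (posnP x) => [->|x0]; first by rewrite E0.
have [|yc [u [uN _ e]]] := hn x; first by rewrite x0.
by rewrite e /= uN IH //; move: hm; rewrite e.
Qed.

Definition sizes (E : nat -> seq nat) d lo cnt n :=
  [/\ forall x, x < lo -> size (E x) < d, forall x, lo <= x < cnt -> size (E x) = d
    & forall x, cnt <= x < n -> size (E x) = d.+1].

(** The state while environments of length [d] are extended: [cnt] nodes existed when the level
    began, the nodes below [t] are done, and at node [t] the vertices below [u] have been tried.
    Nodes before [vr s 20] belong to earlier levels and are already complete. *)
Definition level_inv d cnt t u s :=
  [/\ params N L K M s, labelled N A s,
   [/\ vr s 15 = d, vr s 5 = cnt & cnt <= vr s 19] &
   exists E,
   [/\ tree_ok s E (vr s 19), sizes E d (vr s 20) cnt (vr s 19),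
    forall x, x < vr s 20 \/ x < t -> x < cnt -> complete s E (vr s 19) x,
    forall v, v < u -> v < N -> vr s 20 <= t -> cnd (E t) v ->
      exists x, [/\ 0 < x < vr s 19, ar s 5 x = t & E x = v :: E t]
    & vr s 19 <= cnt + t * C + \sum_(v < u) ((vr s 20 <= t) && cnd (E t) v)]].

Lemma run_exp_step d cnt t u s : d < L -> t < cnt -> u < N ->
  level_inv d cnt t u s -> vr s 14 = t -> vr s 8 = u ->
  (vr s 20 <= t -> forall E, has_env L s t (E t) -> size (E t) = d -> ar s 2 u = cl N K A (E t) K u) ->
  level_inv d cnt t u.+1 (run w c_exp1 s).
Proof.
move=> dL tc uN [sp sl [sd sc cn] [E [tok [z1 z2 z3] comp part bnd]]] st su sCL.
have tn : vr s 14 < vr s 19 by rewrite st; apply: leq_trans cn.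
have [e19 e5 e4 e4'] := run_exp1 sp tn; set s1 := run w c_exp1 s in e19 e5 e4 e4' *.
have fv x : x \notin [:: 13; 19] -> vr s1 x = vr s x by move=> hx; rewrite run_modv.
have fa k : k \notin [:: 4; 5] -> ar s1 k = ar s k by move=> hk; rewrite run_moda.
clearbody s1.
have [sN sL sK sM] := sp; have [t0 tE tenv tnode] := tok.
split; first by split; rewrite fv.
- by case: sl => m1 m2; split=> [|x xN]; rewrite ?fv ?fa // m2.
- by split; [rewrite fv | rewrite fv | rewrite e19; apply: leq_trans cn (leq_addr _ _)].
set n := vr s 19 in e19 e5 e4 e4' tn tok z3 comp part bnd cn t0 tenv tnode *.
have envt : has_env L s t (E t) by apply: tenv; rewrite -st.
pose flag := (vr s 20 <= t) && cnd (E t) u.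
have e19' : vr s1 19 = n + flag.
  rewrite e19 st su /flag /cnd /cand; case: (leqP (vr s 20) t) => //= lot.
  by rewrite (sCL lot E envt) // z2 ?lot.
have old_env E' : (forall x, x < n -> E' x = E x) ->
    forall x, x < n -> has_env L s1 x (E' x).
  move=> hE x xn; have [h1 h2] := tenv x xn; rewrite hE //; split=> // j hj.
  rewrite e4' ?h2 //; apply: leq_trans (_ : L * x.+1 <= _); last by rewrite leq_mul2l xn orbT.
  by rewrite mulnS addnC ltn_add2r; apply: leq_trans h1.
have old5 x : x < n -> ar s1 5 x = ar s 5 x by move=> xn; rewrite e5; case: eqP xn => // ->; rewrite ltnn.
have ntt : t < n by rewrite -st.
have lo' : vr s1 20 = vr s 20 by rewrite fv.
case: (boolP flag) => hf; rewrite /flag in hf e19'; last first.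
  rewrite (negbTE hf) addn0 in e19'.
  exists E; rewrite e19' lo'; split.
  - split=> //; first exact: old_env.
    by move=> x hx; have := tnode x hx; rewrite /node_ok old5 //; case/andP: hx.
  - by split.
  - move=> x hx xc v vN hv; have [y [y1 y2 y3]] := comp x hx xc v vN hv.
    by exists y; split=> //; rewrite old5 //; case/andP: y1.
  - move=> v; rewrite ltnS leq_eqVlt => /orP[/eqP ->|vu] vN lot hv.
      by rewrite lot hv in hf.
    have [y [y1 y2 y3]] := part v vu vN lot hv.
    by exists y; split=> //; rewrite old5 //; case/andP: y1.
  - by rewrite big_ord_recr /= (negbTE hf) addn0.
case/andP: (hf) => lot cu; rewrite hf addn1 in e19'.
have szt : size (E t) = d by rewrite z2 ?lot.
pose E' x := if x == n then u :: E t else E x.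
have E'old x : x < n -> E' x = E x by rewrite /E'; case: eqP => // ->; rewrite ltnn.
have E'n : E' n = u :: E t by rewrite /E' eqxx.
exists E'; rewrite e19' lo'; split.
- split=> //; first by rewrite E'old.
    move=> x; rewrite ltnS leq_eqVlt => /orP[/eqP ->|xn]; last exact: old_env.
    case: (envt) => _ h2; rewrite E'n; split=> /= [|j hj]; first by rewrite szt.
    rewrite e4; last by apply: leq_trans hj _; rewrite szt.
    by case: j hj => [|j] hj; rewrite /= ?su // st h2.
  move=> x /andP[x0]; rewrite ltnS leq_eqVlt => /orP[/eqP ->|xn].
    by rewrite /node_ok e5 eqxx st ltnW // E'n E'old //; split=> //; exists u.
  have [h1 [v [v1 v2 v3]]] : node_ok s E n x by apply: tnode; rewrite x0.
  by rewrite /node_ok old5 // ltnW //; split=> //; exists v; rewrite !E'old.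
- split=> x hx.
  + by rewrite E'old ?z1 //; apply: leq_trans (leq_trans hx lot) _; apply: ltnW.
  + by rewrite E'old ?z2 //; case/andP: hx => _ /leq_trans; apply.
  + case/andP: hx => hx1; rewrite ltnS leq_eqVlt => /orP[/eqP ->|xn].
      by rewrite E'n /= szt.
    by rewrite E'old // z3 ?hx1.
- move=> x hx xc v vN; rewrite E'old; last exact: leq_trans xc cn.
  move=> hv; have [y [/andP[y0 y1] y2 y3]] := comp x hx xc v vN hv.
  by exists y; rewrite old5 // E'old // y0 leqW.
- move=> v; rewrite ltnS leq_eqVlt => vu vN _; rewrite E'old // => hv.
  case/orP: vu => [/eqP ->|vu].
    by exists n; rewrite e5 eqxx st E'n ltnSn t0; split.
  have [y [/andP[y0 y1] y2 y3]] := part v vu vN lot hv.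
  by exists y; rewrite old5 // E'old // y0 leqW.
- rewrite big_ord_recr /= (E'old t) // lot cu /= addn1 addnS ltnS.
  apply: leq_trans bnd _; rewrite leq_add2l; apply: eq_leq; apply: eq_bigr => v _.
  by rewrite lot.
Qed.

Lemma run_node d cnt t s : d < L -> t < cnt -> level_inv d cnt t 0 s -> vr s 14 = t ->
  level_inv d cnt t.+1 0 (run w c_node s).
Proof.
move=> dL tc inv st; rewrite /c_node run_seq; set s0 := run w c_refine s.
have [sp sl [sd sc cn] [E [tok zs comp part bnd]]] := inv.
have fv x : x \notin [:: 8; 16; 8; 8] -> vr s0 x = vr s x by move=> hx; rewrite run_modv.
have fa k : k \notin [:: 2; 3; 2] -> ar s0 k = ar s k by move=> hk; rewrite run_moda.
have inv0 : level_inv d cnt t 0 s0.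
  case: (sp) => sN sL sK sM; split; first by split; rewrite fv.
  - by case: sl => m1 m2; split=> [|x xN]; rewrite ?fv ?fa // m2.
  - by split; rewrite ?fv.
  - exists E; rewrite !fv //; split=> //.
    + case: tok => h1 h2 h3 h4; split=> // x hx.
        by have := h3 x hx; rewrite /has_env fa.
      by have := h4 x hx; rewrite /node_ok fa.
    + by move=> x hx xc; have := comp x hx xc; rewrite /complete fa.
(* Colours were computed from row [t] before the children are written, so row [t] must stay fixed
   meanwhile. Only its first [L] cells do: later offsets run into rows that may be overwritten. *)
pose I u s' := [/\ level_inv d cnt t u s', vr s' 14 = t, vr s' 20 = vr s 20,
  ar s' 2 = ar s0 2 & forall j, ar s' 4 (L * t + j) = ar s 4 (L * t + j) \/ L <= j].
have s0N : vr s0 1 = N by rewrite fv //; case: sp.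
have sCL E' : vr s 20 <= t -> has_env L s t (E' t) -> size (E' t) = d ->
    forall u, u < N -> ar s0 2 u = cl N K A (E' t) K u.
  by move=> lot he sz u uN; apply: (run_refine (ps := E' t) inA sp sl) => //; rewrite ?sz ?st.
have [] : I (vr s0 1) (run w (CFor 8 1 c_exp1) s0).
  apply: for_ind => [|u s' uN [h1 h2 h3 h4 h5]].
    by split=> //; rewrite ?fv // => j; left; rewrite fa.
  rewrite s0N in uN.
  have inv' : level_inv d cnt t u (setv s' 8 u).
    case: h1 => [[? ? ? ?] [? ?] [? ? ?] [E' [[? ? ? ?] ? ? ? ?]]].
    by split=> //; exists E'.
  have [[_ sL' _ _] _ [_ _ cn'] _] := h1.
  have tn' : t < vr s' 19 by apply: leq_trans cn'.
  split.
  - apply: run_exp_step inv' _ _ _ => //= lot E' he sz.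
    rewrite h4; apply: sCL => //; first by rewrite -h3.
    case: he => hz he; split=> // j hj.
    by case: (h5 j) => [<-|]; [exact: he | rewrite leqNgt (leq_trans hj hz)].
  - by rewrite run_modv.
  - by rewrite run_modv.
  - by rewrite run_moda.
  - move=> j; case: (ltnP j L) => jL; last by right.
    left; case: (h5 j) => [<-|]; last by rewrite leqNgt jL.
    have [] := @run_exp1 (setv s' 8 u); first by case: inv'.
      by rewrite /= h2.
    move=> _ _ _ ->//=; apply: leq_trans (_ : L * t.+1 <= _); last by rewrite leq_mul2l tn' orbT.
    by rewrite mulnS addnC ltn_add2r.
rewrite s0N; set s1 := run w _ s0 => i1 _ _ _ _ {I}.
have [p1 l1 c1 [E1 [tok1 z1 comp1 part1 bnd1]]] := i1.
clearbody s1.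
split; [exact: p1 | exact: l1 | exact: c1 | exists E1; split=> //].
- move=> x hx xc; case: (ltnP x (vr s1 20)) => [xlo|lox]; first by apply: comp1 => //; left.
  case: hx => [xlo|]; first by rewrite ltnNge lox in xlo.
  rewrite ltnS leq_eqVlt => /orP[/eqP ext|xt]; last by apply: comp1 => //; right.
  by rewrite ext in lox *; move=> v vN hv; apply: part1.
- rewrite big_ord0 addn0; apply: leq_trans bnd1 _; rewrite -addnA leq_add2l mulSn addnC leq_add2r.
  case: (leqP (vr s1 20) t) => lot; last by rewrite big1.
  have [_ _ cn1] := c1; apply: cand_le; first by case: z1 => _ -> //; rewrite lot.
  by apply: (env_lt tok1); apply: leq_trans cn1.
Qed.

Definition tree_inv d s :=
  [/\ params N L K M s, labelled N A s, vr s 19 <= C.+1 ^ d &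
   exists E, [/\ tree_ok s E (vr s 19), vr s 20 <= vr s 19,
     (forall x, x < vr s 20 -> size (E x) < d),
     (forall x, vr s 20 <= x < vr s 19 -> size (E x) = d)
   & forall x, x < vr s 20 -> complete s E (vr s 19) x]].

Lemma run_level d s : d < L -> tree_inv d s -> vr s 15 = d -> small Z s ->
  vr s 19 <= Z -> safe w Z c_level s /\ tree_inv d.+1 (run w c_level s).
Proof.
move=> dL [sp sl nb [E [tok lon z1 z2 comp]]] sd sm nZ.
rewrite /c_level !run_seq !run_assign evalE; set n := vr s 19 in nb tok lon z2 comp nZ *.
set s0 := setv s 5 n.
have sm0 : small Z s0 by apply: small_setv.
split; first by split=> //; apply: bndC_safe.
have inv0 : level_inv d n 0 0 s0.
  case: sp => ? ? ? ?; split=> //; exists E => /=; split=> //.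
  - by split=> // x /andP[h1 h2]; move: (leq_ltn_trans h1 h2); rewrite ltnn.
  - by move=> x [hx|//] _; apply: comp.
  - by rewrite big_ord0 mul0n !addn0.
have : level_inv d n n 0 (run w (CFor 14 5 c_node) s0).
  have {2}-> : n = vr s0 5 by [].
  apply: (for_ind (I := fun t s' => level_inv d n t 0 s')) => // t s' tn.
  move=> [[? ? ? ?] [? ?] [? ? ?] [E' [[? ? ? ?] ? ? ? ?]]].
  by apply: run_node => //; split=> //; exists E'.
set s1 := run w _ s0 => -[p1 l1 [_ c5 cn1] [E1 [tok1 [y1 y2 y3] comp1 _ bnd1]]].
case: (p1) => ? ? ? ?; split=> //=.
- rewrite big_ord0 addn0 in bnd1; apply: leq_trans bnd1 _.
  by rewrite expnS mulSn leq_add // mulnC leq_mul2l nb orbT.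
exists E1; rewrite evalE c5; split=> //.
- move=> x xn; case: (ltnP x (vr s1 20)) => [/y1/ltnW//|lox].
  by rewrite y2 ?lox.
- by move=> x xn; apply: comp1 => //; right.
Qed.

Lemma run_tree s : params N L K M s -> labelled N A s -> small Z s ->
  C.+1 ^ L <= Z -> safe w Z c_tree s /\
  let s1 := run w c_tree s in
  [/\ params N L K M s1, vr s1 5 <= C.+1 ^ L, small Z s1 &
    exists E, tree_ok s1 E (vr s1 5) /\
      forall x, x < vr s1 5 -> size (E x) < L -> complete s1 E (vr s1 5) x].
Proof.
move=> sp sl sm hZ.
rewrite /c_tree !run_seq !run_assign !evalE; set s0 := setv (setv s 19 1) 20 0.
have sL : vr s0 2 = L by case: sp.
have LZ : vr s0 2 <= Z by have := sm 2 isT.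
have i0 : tree_inv 0 s0 /\ small Z s0.
  split; last by do 2!apply: small_setv8 => //.
  case: sp => ? ? ? ?; split=> //; exists (fun=> [::]) => /=; split=> //.
  by split=> // x /andP[x0]; rewrite ltnS leqNgt x0.
have := @for_ind_safe w Z (fun d s' => tree_inv d s' /\ small Z s') 15 2 c_level s0 LZ i0.
case.
  move=> d s' dL [i1 sm1]; rewrite sL in dL.
  have nb : vr s' 19 <= Z.
    by case: i1 => _ _ nb _; apply: leq_trans nb (leq_trans _ hZ); rewrite leq_pexp2l // ltnW.
  have i1' : tree_inv d (setv s' 15 d).
    case: i1 => [[? ? ? ?] [? ?] ? [E' [[? ? ? ?] ? ? ? ?]]].
    by split=> //; exists E'.
  have [] := run_level dL i1' erefl (small_setv8 _ _ sm1) nb => // h1 h2; split=> //; split=> //.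
  rewrite /c_level !run_seq !run_assign; apply: small_setv8 => //.
  by apply: small_run => //; apply: small_setv => //; apply: small_setv8.
rewrite sL; set s1 := run w _ s0 => h1 [[p1 l1 nb [E [tok lon z1 z2 comp]]] sm1].
split.
  by do !split=> //.
split.
- by case: p1 => ? ? ? ?; split.
- exact: nb.
- by apply: small_setv => //; apply: leq_trans hZ.
exists E; split; first by case: tok => ? ? ? ?; split.
move=> x xn sz; apply: comp; rewrite ltnNge; apply/negP=> lox.
by rewrite z2 ?lox // ltnn in sz.
Qed.

End TreeBuilding.

Lemma evalIfEq w s a b c d : eval w (EIf (EEq a b) c d) s =
  if eval w a s == eval w b s then eval w c s else eval w d s.
Proof. by rewrite evalIf evalEq nat_of_bool_eq0 if_neg. Qed.

Lemma evalIfLt w s a b c d : eval w (EIf (ELt a b) c d) s =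
  if eval w a s < eval w b s then eval w c s else eval w d s.
Proof. by rewrite evalIf evalLt nat_of_bool_eq0 if_neg. Qed.

Lemma size_encode_gt0 k (phi : fo k) : 0 < size (encode_fo phi).
Proof. by case: phi. Qed.

(** * Evaluation with restricted quantifiers *)

Section Teval.
Variables (N : nat) (A : nat -> nat -> bool) (cnd : seq nat -> nat -> bool).

Fixpoint teval k (phi : fo k) (ps : seq nat) : bool :=
  match phi with
  | FEq _ i j => nth 0 ps i == nth 0 ps j
  | FAdj _ i j => A (nth 0 ps i) (nth 0 ps j)
  | FNot _ psi => ~~ teval psi ps
  | FAnd _ psi chi => teval psi ps && teval chi ps
  | FEx _ psi => has (fun u => cnd ps u && teval psi (u :: ps)) (iota 0 N)
  end.

End Teval.

Section Evaluation.
Variables (w : seq nat) (N L K M cnt : nat) (A : nat -> nat -> bool).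
Hypothesis inA : forall u v, u < N -> v < N -> nth 0 w (1 + (N * u + v)) = A u v.
Variable fw : seq nat.
Hypothesis inF : forall p, p < L -> nth 0 w (1 + (N * N + p)) = nth 0 fw p.
Hypothesis fwL : size fw = L.
Let cnd := cand N K M A.
Variables (s : store) (E : nat -> seq nat).
Hypotheses (sN : vr s 1 = N) (sL : vr s 2 = L) (sC : vr s 5 = cnt).
Hypothesis tok : tree_ok N L K M A s E cnt.
Hypothesis comp : forall x, x < cnt -> size (E x) < L -> complete N K M A s E cnt x.

Lemma evalTok j s' p : vr s' 1 = N -> vr s' 17 = p -> p + j < L ->
  eval w (ETok j) s' = nth 0 fw (p + j).
Proof.
move=> e1 e2 pj; rewrite -inF // /ETok !evalE (@evalMul _ _ _ _ N) ?e1 ?e2; first by congr nth; lia.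
by move=> i; rewrite evalE /= e1.
Qed.

Lemma evalVal pe te s' c : vr s' 5 = cnt -> (forall i, eval w pe (setv s' 12 i) = c) ->
  eval w (EVal pe te) s' = ar s' 7 (cnt * c + eval w te s').
Proof. by move=> e h; rewrite /EVal !evalE (@evalMul _ _ _ _ c) ?e. Qed.

Definition located k (phi : fo k) p :=
  exists2 pre, size pre = p & exists post, fw = pre ++ encode_fo phi ++ post.

Lemma located_nth k (phi : fo k) p j : located phi p -> j < size (encode_fo phi) ->
  nth 0 fw (p + j) = nth 0 (encode_fo phi) j /\ p + j < L.
Proof.
move=> [pre <- [post e]] hj; rewrite -fwL e; split.
  by rewrite nth_cat ltnNge leq_addr /= addKn nth_cat hj.
by rewrite !size_cat; lia.
Qed.

Lemma located_cons k k' (phi : fo k) (psi : fo k') c rest p : located phi p ->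
  encode_fo phi = c :: encode_fo psi ++ rest -> located psi p.+1.
Proof.
move=> [pre <- [post e]] ep; exists (rcons pre c); first by rewrite size_rcons.
by exists (rest ++ post); rewrite e ep cat_rcons /= -catA.
Qed.

Lemma located_and k (psi chi : fo k) p : located (FAnd psi chi) p ->
  located chi (p.+1 + size (encode_fo psi)).
Proof.
move=> [pre <- [post e]]; exists (rcons pre 3 ++ encode_fo psi).
  by rewrite size_cat size_rcons.
by exists post; rewrite e /= -!catA cat_rcons.
Qed.

Definition good_end s' p := forall k (phi : fo k), located phi p ->
  ar s' 6 p = p + size (encode_fo phi).
(** The encoding does not mention the number [k] of free variables; it is fixed by the length of the
    environment at the node. The condition [k + size (encode_fo phi) <= L] guarantees enough levels
    below: a quantifier raises [k] by one but uses up one letter. *)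
Definition good_val s' p t := forall k (phi : fo k), located phi p ->
  k + size (encode_fo phi) <= L -> size (E t) = k ->
  ar s' 7 (cnt * p + t) = teval N A cnd phi (E t).

Definition frame s' :=
  [/\ vr s' 1 = N, vr s' 2 = L, vr s' 5 = cnt, ar s' 4 = ar s 4 & ar s' 5 = ar s 5].

Lemma eval_end s' p : frame s' -> vr s' 17 = p ->
  (forall p', p < p' < L -> good_end s' p') ->
  forall k (phi : fo k), located phi p -> eval w e_end s' = p + size (encode_fo phi).
Proof.
move=> [e1 e2 e5 _ _] e17 hE k phi loc.
have [t0 t0L] := located_nth loc (size_encode_gt0 phi).
rewrite /e_end evalIfLt evalIfEq (evalTok e1 e17) // /e_next t0 !evalE e17 addn1.
case: k / phi loc {t0 t0L} => [k i j|k i j|k psi|k psi chi|k psi] loc //=.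
- have lp := @located_cons _ _ _ psi 2 [::] _ loc.
  have {}lp := lp (congr1 (cons 2) (esym (cats0 _))).
  have [_ lt] := located_nth lp (size_encode_gt0 psi).
  by rewrite (hE _ _ _ _ lp) ?addnS ?addSn // ltnSn; lia.
- have lp := @located_cons _ _ _ psi 3 (encode_fo chi) _ loc erefl.
  have lq := located_and loc.
  have [_ lt] := located_nth lp (size_encode_gt0 psi).
  have [_ lt'] := located_nth lq (size_encode_gt0 chi).
  rewrite (hE _ _ _ _ lp) ?(hE _ _ _ _ lq) ?size_cat; lia.
- have lp := @located_cons _ _ _ psi 4 [::] _ loc.
  have {}lp := lp (congr1 (cons 4) (esym (cats0 _))).
  have [_ lt] := located_nth lp (size_encode_gt0 psi).
  by rewrite (hE _ _ _ _ lp) ?addnS ?addSn // ltnSn; lia.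
Qed.

Lemma eval_val s' p t : frame s' -> vr s' 17 = p -> vr s' 14 = t -> t < cnt ->
  (forall p', p < p' < L -> good_end s' p' /\ forall x, x < cnt -> good_val s' p' x) ->
  forall k (phi : fo k), located phi p -> k + size (encode_fo phi) <= L ->
    size (E t) = k -> eval w e_val s' = teval N A cnd phi (E t).
Proof.
move=> [e1 e2 e5 e4 e5'] e17 e14 tc hG k phi loc hL szt.
have [_ E0 henv hnode] := tok.
have [_ env] := henv t tc; have lt := env_lt tok tc.
have [t0 t0L] := located_nth loc (size_encode_gt0 phi).
have envE s2 j q : frame s2 -> vr s2 17 = p -> vr s2 14 = t -> p + j < L ->
    nth 0 fw (p + j) = q -> q < size (E t) ->
    eval w (EEnv (EV 14) (ETok j)) s2 = nth 0 (E t) q.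
  move=> [f1 f2 f5 f4 f5'] f17 f14 pj <- hq.
  by rewrite (@evalEnvG w L) // (evalTok f1 f17) // f14 f4 env.
have valE x q : frame x -> vr x 17 = p ->
    eval w (EVal (EAdd (EV 17) (EC 1)) (EV q)) x = ar x 7 (cnt * p.+1 + vr x q).
  move=> [f1 f2 f5 f4 f5'] f17; rewrite (@evalVal _ _ _ p.+1) // => i.
  by rewrite !evalE /= f17 addn1.
have fr : frame s' by split.
have fr12 i : frame (setv s' 12 i) by split.
rewrite /e_val !evalIfEq (evalTok e1 e17) // t0 !evalC.
case: k / phi loc {t0 t0L} hL szt => [k i j|k i j|k psi|k psi chi|k psi] loc hL szt /=.
- have [n1 l1] := @located_nth _ _ _ 1 loc isT; have [n2 l2] := @located_nth _ _ _ 2 loc isT.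
  by rewrite evalEq (envE _ 1 i) ?(envE _ 2 j) ?szt.
- have [n1 l1] := @located_nth _ _ _ 1 loc isT; have [n2 l2] := @located_nth _ _ _ 2 loc isT.
  have ilt (q : 'I_k) : nth 0 (E t) q < N by apply: (allP lt); rewrite mem_nth ?szt.
  rewrite /EAdj evalIn 2!evalAdd evalC (@evalMul _ _ _ _ (nth 0 (E t) i)); last first.
    by move=> q; rewrite (envE _ 1 i) ?szt.
  by rewrite e1 (envE _ 2 j) ?szt // inA.
- have lp := @located_cons _ _ _ psi 2 [::] _ loc (congr1 (cons 2) (esym (cats0 _))).
  have [_ lL] := located_nth lp (size_encode_gt0 psi).
  have [|_ hv] := hG p.+1; first by rewrite ltnSn; lia.
  rewrite evalNot valE // e14 (hv t tc _ _ lp) ?nat_of_bool_eq0 //.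
  by move: hL => /=; lia.
- have lp := @located_cons _ _ _ psi 3 (encode_fo chi) _ loc erefl.
  have lq := located_and loc.
  have [_ lL] := located_nth lp (size_encode_gt0 psi).
  have [_ lL'] := located_nth lq (size_encode_gt0 chi).
  have szc := size_cat (encode_fo psi) (encode_fo chi).
  have [|he hv] := hG p.+1; first by rewrite ltnSn; lia.
  have [|_ hv'] := hG (p.+1 + size (encode_fo psi)); first by lia.
  rewrite evalAnd valE // e14 (hv t tc _ _ lp) //; last by move: hL => /=; lia.
  rewrite (@evalVal _ _ _ (p.+1 + size (encode_fo psi))) //; last first.
    by move=> i; rewrite /e_next !evalE /= e17 addn1 (he _ _ lp).
  rewrite !evalE e14 (hv' t tc _ _ lq) //; last by move: hL => /=; lia.
  by rewrite !nat_of_bool_eq0 !negbK.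
- have lp := @located_cons _ _ _ psi 4 [::] _ loc (congr1 (cons 4) (esym (cats0 _))).
  have [_ lL] := located_nth lp (size_encode_gt0 psi).
  have [|_ hv] := hG p.+1; first by rewrite ltnSn; lia.
  have hL' : k.+1 + size (encode_fo psi) <= L by move: hL => /=; lia.
  rewrite evalLt evalC evalSum e5; congr nat_of_bool; rewrite lt0n sum_nat_eq0 negb_forall.
  have valx (x : 'I_cnt) : eval w (EAnd (EV 10) (EAnd (EEq (EArr 5 (EV 10)) (EV 14))
       (EVal (EAdd (EV 17) (EC 1)) (EV 10)))) (setv s' 10 x) =
       [&& x != 0 :> nat, ar s 5 x == t & ar s' 7 (cnt * p.+1 + x) != 0].
    rewrite !evalAnd evalEq valE //= !evalE /= e14 e5'.
    by rewrite !nat_of_bool_eq0 !negbK.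
  apply/existsP/hasP => [[x]|[u]].
    rewrite valx nat_of_bool_eq0 !negbK /= => /and3P[x0 /eqP xt hvx].
    have [|_ [u [uN cu Ex]]] := hnode x; first by rewrite lt0n x0 /=.
    rewrite xt in Ex cu; exists u; first by rewrite mem_iota.
    move: hvx; rewrite (hv x (ltn_ord x) _ _ lp) ?Ex /= ?szt //.
    by rewrite nat_of_bool_eq0 negbK => ->; rewrite andbT; exact: cu.
  rewrite mem_iota add0n => /andP[_ uN] /andP[cu tu].
  have [|x [/andP[x0 xc] xt Ex]] := comp tc _ uN cu; first by rewrite szt; lia.
  exists (Ordinal xc); rewrite valx nat_of_bool_eq0 !negbK /= -lt0n x0 xt eqxx /=.
  by rewrite (hv x xc _ _ lp) ?Ex /= ?szt // tu.
Qed.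

Lemma run_eval (phi : fo 0) : fw = encode_fo phi ->
  ar (run w c_eval s) 7 0 = teval N A cnd phi [::].
Proof.
(* After [i] rounds the last [i] positions are finished. *)
move=> efw; pose J i s' := frame s' /\ forall p, L - i <= p < L ->
  good_end s' p /\ forall x, x < cnt -> good_val s' p x.
have : J (vr s 2) (run w c_eval s).
  apply: for_ind => [|i s' hi [[f1 f2 f5 f4 f5'] hG]].
    split; first by split.
    by move=> p /andP[h1 h2]; move: (leq_ltn_trans h1 h2); rewrite subn0 ltnn.
  rewrite sL in hi; rewrite !run_seq run_assign run_store !evalE /= f2.
  set p := L - 1 - i; set s1 := setv _ 17 p.
  have fr1 : frame s1 by split.
  set s2 := seta s1 6 p (eval w e_end s1).
  have fr2 : frame s2 by case: fr1 => *; split.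
  have hGE q : p < q < L -> good_end s' q.
    by move=> hq; apply: (hG q _).1; rewrite /p in hq; lia.
  have end2 q : p <= q < L -> good_end s2 q.
    move=> /andP[pq qL] k psi lq; rewrite /s2 /=; case: eqP => [e|ne] /=.
      rewrite e in lq *; apply: (eval_end fr1) => // q' /hGE; exact.
    by apply: hGE lq; lia.
  set c := CFor 14 5 _; set s3 := run w c s2.
  pose I t s'' := [/\ frame s'', vr s'' 17 = p, ar s'' 6 = ar s2 6,
     forall x, cnt * p.+1 <= x -> ar s'' 7 x = ar s' 7 x & forall x, x < t -> x < cnt -> good_val s'' p x].
  have : I (vr s2 5) s3.
    apply: for_ind => [|t s'' ht [[g1 g2 g5 g4 g5'] g17 g6 g7 gv]]; first by split.
    have tc : t < cnt by move: ht; rewrite /= f5.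
    have fr'' : frame (setv s'' 14 t) by split.
    rewrite run_store; set v := eval w e_val _.
    have ea : eval w (EAdd (EMul 5 (EV 17)) (EV 14)) (setv s'' 14 t) = cnt * p + t.
      have h17 q : eval w (EV 17) (setv (setv s'' 14 t) 12 q) = p by exact: g17.
      by rewrite evalAdd (evalMul _ h17) evalV /= g5.
    rewrite ea; split=> //.
    - move=> x hx /=; case: eqP => [e|_]; last exact: g7.
      by move: hx; rewrite e mulnS addnC leq_add2l leqNgt tc.
    - move=> x; rewrite ltnS leq_eqVlt => /orP[/eqP ->|xt] xc k psi lp hL szx /=.
        rewrite eqxx; apply: (eval_val fr'') lp hL szx => // q hq; split.
          move=> k' psi' lq; rewrite /= g6; apply: end2 lq; lia.
        move=> y yc k' psi' lq hL' szy; rewrite /= g7; last first.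
          by apply: leq_trans (leq_addr _ _); rewrite leq_mul2l; case/andP: hq => ->; rewrite orbT.
        by apply: ((hG q _).2 y yc) lq hL' szy; rewrite /p in hq; lia.
      rewrite eqn_add2l; case: eqP => [e|_]; first by rewrite e ltnn in xt.
      exact: gv.
  rewrite [vr s2 5]/= f5 => -[fr3 _ h6 h7 hv]; split=> // q hq.
  have pq : p <= q < L by rewrite /p; lia.
  split.
    by move=> k psi lq; rewrite h6; apply: end2 lq.
  move=> x xc; case: (eqVneq q p) => [->|ne]; first exact: hv.
  move=> k psi lq hL szx; rewrite h7; last first.
    by apply: leq_trans (leq_addr _ _); rewrite leq_mul2l; apply/orP; right; lia.
  by apply: ((hG q _).2 x xc) lq hL szx; move: pq ne; rewrite /p; lia.
rewrite sL => -[_ /(_ 0)]; rewrite subnn /=.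
have L0 : 0 < L by rewrite -fwL efw size_encode_gt0.
have [c0 E0 _ _] := tok; case=> // _ /(_ 0 c0) h.
have := h 0 phi; rewrite muln0 addn0 E0; apply=> //.
  by exists [::] => //; exists [::]; rewrite cats0.
by rewrite add0n -efw fwL.
Qed.

End Evaluation.

Lemma safe_seq w Z a b s : safe w Z a s -> safe w Z b (run w a s) ->
  safe w Z (CSeq a b) s.
Proof. by []. Qed.

(** * The parameters and the assembled program *)

Definition c_pow y z := CSeq (CAssign 23 (EC 1)) (CFor 18 y (CAssign 23 (EMul z (EV 23)))).

Lemma run_pow w y z s : y \notin [:: 18; 23] -> z \notin [:: 12; 18; 23] ->
  vr (run w (c_pow y z) s) 23 = vr s z ^ vr s y.
Proof.
rewrite !inE !negb_or => /andP[y1 y2] /and3P[z1 z2 z3].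
rewrite run_seq run_assign evalE; set s0 := setv _ _ _.
have -> : vr s y = vr s0 y by rewrite /= (negbTE y2).
pose I i s' := vr s' 23 = vr s z ^ i /\ vr s' z = vr s z.
have [] : I (vr s0 y) (run w (CFor 18 y (CAssign 23 (EMul z (EV 23)))) s0); last by [].
apply: for_ind => [|i s' _ [h1 h2]]; first by split=> //=; rewrite (negbTE z3).
rewrite run_assign; split=> /=; last by rewrite (negbTE z3) (negbTE z2).
by rewrite (@evalMul _ _ _ _ (vr s z ^ i)) /= ?(negbTE z2) ?h2 ?expnS.
Qed.

(** This one number serves as the number of refinement rounds, as the cap for counting, and as the
    girth from which the tree analysis applies; it exceeds the radii and thresholds of all ranks up
    to [L]. For [n < kparam L] the graph of index [n] has at most [mparam L] vertices, since it has
    at most [n.+2] times as many as there are permutations of at most [n.+1 ^ n.+1] words. *)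
Definition kparam L := 2 ^ ((L + 3) * (L + 3)).
Definition qparam L := kparam L ^ kparam L.
Definition mparam L := (kparam L).+1 * qparam L ^ qparam L.

Definition c_params :=
  CSeq (CAssign 6 (EAdd (EV 2) (EC 3)))
  (CSeq (CAssign 7 (EMul 6 (EV 6)))
  (CSeq (CAssign 6 (EC 2))
  (CSeq (c_pow 7 6)
  (CSeq (CAssign 3 (EV 23))
  (CSeq (c_pow 3 3)
  (CSeq (CAssign 6 (EV 23))
  (CSeq (c_pow 6 6)
        (CAssign 22 (EAdd (EV 23) (EMul 3 (EV 23))))))))))).

Lemma run_params w Z s L : vr s 2 = L -> small Z s ->
  (L + 3) * (L + 3) <= Z -> kparam L <= Z -> qparam L <= Z -> 2 <= Z ->
  let s1 := run w c_params s in
  [/\ safe w Z c_params s, small Z s1, vr s1 3 = kparam L, vr s1 22 = mparam L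
    & forall x, x \notin [:: 3; 6; 7; 18; 22; 23] -> vr s1 x = vr s x].
Proof.
move=> sL sm z1 z2 z3 z4 s1.
have fr x : x \notin [:: 3; 6; 7; 18; 22; 23] -> vr s1 x = vr s x.
  move=> hx; rewrite /s1 run_modv //; apply: contra hx.
  by rewrite !inE => h; repeat (case/orP: h => [->|h]; first by rewrite ?orbT); rewrite h ?orbT.
have z0 : L + 3 <= Z by apply: leq_trans z1; rewrite leq_pmull // addn3.
move: fr; rewrite {}/s1 /c_params.
rewrite run_seq run_assign !evalE; set a1 := setv _ _ _.
have m1 : small Z a1 by apply: small_setv => //; rewrite sL.
rewrite run_seq run_assign; have e2 : eval w (EMul 6 (EV 6)) a1 = (L + 3) * (L + 3).
  by rewrite (@evalMul _ _ _ _ (L + 3)) /= ?sL // => i; rewrite evalE /= sL.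
rewrite e2; set a2 := setv a1 _ _.
have m2 : small Z a2 by apply: small_setv.
rewrite run_seq run_assign evalE; set a3 := setv a2 _ _.
have m3 : small Z a3 by apply: small_setv.
rewrite run_seq; have p4 := @run_pow w 7 6 a3 isT isT; set a4 := run w _ a3 in p4 *.
have m4 : small Z a4 by apply: small_run.
have p4' : vr a4 23 = kparam L by rewrite p4.
rewrite run_seq run_assign evalE p4'; set a5 := setv a4 _ _.
have m5 : small Z a5 by apply: small_setv.
rewrite run_seq; have p6 := @run_pow w 3 3 a5 isT isT; set a6 := run w _ a5 in p6 *.
have m6 : small Z a6 by apply: small_run.
have p6' : vr a6 23 = qparam L by rewrite p6.
have k6 : vr a6 3 = kparam L by rewrite run_modv.
rewrite run_seq run_assign evalE p6'; set a7 := setv a6 _ _.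
have m7 : small Z a7 by apply: small_setv.
rewrite run_seq; have p8 := @run_pow w 6 6 a7 isT isT; set a8 := run w _ a7 in p8 *.
have m8 : small Z a8 by apply: small_run.
have p8' : vr a8 23 = qparam L ^ qparam L by rewrite p8.
have k8 : vr a8 3 = kparam L by rewrite run_modv.
rewrite run_assign !evalE p8' (@evalMul _ _ _ _ (qparam L ^ qparam L)) ?k8 // => fr; split.
- apply: safe_seq => //; rewrite run_assign !evalE -/a1.
  apply: safe_seq; first by apply: (@bndE_safe _ (EMul 6 (EV 6))).
  rewrite run_assign e2 -/a2; apply: safe_seq => //; rewrite run_assign evalE -/a3.
  apply: safe_seq; first by apply: bndC_safe.
  rewrite -/a4; apply: safe_seq => //; rewrite run_assign evalE p4' -/a5.
  apply: safe_seq; first by apply: bndC_safe.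
  rewrite -/a6; apply: safe_seq => //; rewrite run_assign evalE p6' -/a7.
  apply: safe_seq; first by apply: bndC_safe.
  by rewrite -/a8; apply: (@bndE_safe _ (EAdd (EV 23) (EMul 3 (EV 23)))).
- exact: small_setv8.
- by rewrite /= k8.
- by rewrite /= /mparam mulSn.
- exact: fr.
Qed.

Definition c_main := CSeq c_label (CSeq c_tree (CSeq c_eval (CAssign 0 (EArr 7 (EC 0))))).

Definition model_checker :=
  CSeq (CAssign 1 (EIn (EC 0)))
  (CSeq (CAssign 2 (ESub ELen (EAdd (EC 1) (EMul 1 (EV 1)))))
  (CSeq c_params c_main)).

Theorem model_checker_correct w N L (A : nat -> nat -> bool) (phi : fo 0) C Z :
  nth 0 w 0 = N -> size w = 1 + N * N + L -> L = size (encode_fo phi) ->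
  (forall u v, u < N -> v < N -> nth 0 w (1 + (N * u + v)) = A u v) ->
  (forall p, p < L -> nth 0 w (1 + (N * N + p)) = nth 0 (encode_fo phi) p) ->
  let cnd := cand N (kparam L) (mparam L) A in
  (forall ps, size ps < L -> all (fun u => u < N) ps -> \sum_(u < N) cnd ps u <= C) ->
  N <= Z -> L <= Z -> (L + 3) * (L + 3) <= Z -> kparam L <= Z -> qparam L <= Z ->
  2 <= Z -> C.+1 ^ L <= Z ->
  safe w Z model_checker store0 /\
  vr (run w model_checker store0) 0 = teval N A cnd phi [::].
Proof.
move=> wN wsz Lsz inA inF cnd cle z1 z2 z3 z4 z5 z6 z7.
rewrite /model_checker run_seq run_assign !evalE wN; set s1 := setv _ _ _.
have m1 : small Z s1 by apply: small_setv.
rewrite run_seq run_assign.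
have e2 : eval w (ESub ELen (EAdd (EC 1) (EMul 1 (EV 1)))) s1 = L.
  rewrite !evalE (@evalMul _ _ _ _ N) /= ?wsz ?addKn //.
set s2 := setv s1 _ _; rewrite e2 in s2 *.
have m2 : small Z s2 by apply: small_setv.
have [sf3 m3 k3 M3 fr3] := @run_params w Z s2 L erefl m2 z3 z4 z5 z6.
rewrite run_seq; set s3 := run w c_params s2 in m3 k3 M3 fr3 *.
have p3 : params N L (kparam L) (mparam L) s3.
  by split; [rewrite fr3 | rewrite fr3 | exact: k3 | exact: M3].
rewrite /c_main run_seq; have lab4 := run_label inA (s := s3) (fr3 1 isT).
set s4 := run w c_label s3 in lab4 *.
have m4 : small Z s4 by apply: small_run.
have p4 : params N L (kparam L) (mparam L) s4 by case: p3 => *; split; rewrite run_modv.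
have [sf5 [p5 n5 m5 [E [tok comp]]]] := run_tree inA cle p4 lab4 m4 z7.
rewrite run_seq; set s5 := run w c_tree s4 in p5 n5 m5 tok comp *.
have ev : ar (run w c_eval s5) 7 0 = teval N A cnd phi [::].
  by case: p5 => *; apply: (run_eval inA inF _ _ _ erefl tok comp) => //; rewrite -?Lsz.
rewrite run_seq run_assign evalArr evalC; split; last exact: ev.
apply: safe_seq => //; rewrite run_assign !evalE wN -/s1.
apply: safe_seq; first by apply: (@bndE_safe _ (ESub ELen (EAdd (EC 1) (EMul 1 (EV 1))))).
rewrite run_assign e2 -/s2; apply: safe_seq; first exact: sf3.
rewrite -/s3; apply: safe_seq; first by apply: bndC_safe.
rewrite -/s4; apply: safe_seq; first exact: sf5.
by rewrite -/s5; apply: safe_seq => //; apply: bndC_safe.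
Qed.

(** * Capped colour refinement *)

Lemma minn_sum (I : finType) T (F : I -> nat) :
  minn T (\sum_i F i) = minn T (\sum_i minn T (F i)).
Proof.
have H (r : seq I) : minn T (\sum_(i <- r) F i) = minn T (\sum_(i <- r) minn T (F i)).
  by elim: r => [|i r IH]; rewrite ?big_nil // !big_cons; lia.
exact: H.
Qed.

(** Split both sets by colour. A colour occurs in both or in neither as soon as the cap is positive,
    and it then satisfies the predicate entirely or not at all, so the capped counts can be summed
    colour by colour. *)
Lemma capped_count (V K : finType) T (X Y : {set V}) (f g : V -> K) (P Q : pred V) :
  (forall k, minn T #|[set x in X | f x == k]| = minn T #|[set y in Y | g y == k]|) ->
  (forall x y, x \in X -> y \in Y -> f x = g y -> P x = Q y) ->
  minn T #|[set x in X | P x]| = minn T #|[set y in Y | Q y]|.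
Proof.
case: T => [|T] hk hPQ; first by rewrite !min0n.
have split_sum (Z : {set V}) (h : V -> K) (p : pred V) :
    #|[set x in Z | p x]| = \sum_k #|[set x in Z | p x & h x == k]|.
  rewrite -sum1_card (partition_big h xpredT) //=; apply: eq_bigr => k _.
  by rewrite -sum1_card; apply: eq_bigl => x; rewrite !inE andbA.
rewrite (split_sum X f P) (split_sum Y g Q) minn_sum [RHS]minn_sum.
congr minn; apply: eq_bigr => k _; have := hk k.
set A := [set x in X | f x == k]; set B := [set y in Y | g y == k] => hAB.
have eA p : [set x in X | p x & f x == k] = [set x in A | p x].
  by apply/setP=> x; rewrite !inE; case: (x \in X); rewrite //= andbC.
have eB p : [set x in Y | p x & g x == k] = [set x in B | p x].
  by apply/setP=> x; rewrite !inE; case: (x \in Y); rewrite //= andbC.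
rewrite eA eB.
have [A0|[x0 x0A]] := set_0Vmem A.
  have B0 : B = set0 by apply/eqP; rewrite -cards_eq0; move: hAB; rewrite A0 cards0; lia.
  by rewrite A0 B0 !setIdE !set0I.
have [B0|[y0 y0B]] := set_0Vmem B.
  have : 0 < #|A| by apply/card_gt0P; exists x0.
  by move: hAB; rewrite B0 cards0; lia.
have hx x : x \in A -> P x = Q y0.
  rewrite inE => /andP[xX /eqP fx]; move: y0B; rewrite inE => /andP[yY /eqP gy].
  by apply: hPQ => //; rewrite fx gy.
have hy y : y \in B -> Q y = P x0.
  rewrite inE => /andP[yY /eqP gy]; move: x0A; rewrite inE => /andP[xX /eqP fx].
  by apply/esym/hPQ => //; rewrite fx gy.
have e0 := hx _ x0A.
have -> : [set x in A | P x] = if Q y0 then A else set0.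
  apply/setP=> x; rewrite [LHS]inE; case: (boolP (x \in A)) => xA.
    by rewrite (hx _ xA); case: (Q y0); rewrite ?xA ?in_set0.
  by case: (Q y0); rewrite ?(negbTE xA) ?in_set0.
have -> : [set y in B | Q y] = if Q y0 then B else set0.
  apply/setP=> y; rewrite [LHS]inE; case: (boolP (y \in B)) => yB.
    by rewrite (hy _ yB) e0; case: (Q y0); rewrite ?yB ?in_set0.
  by case: (Q y0); rewrite ?(negbTE yB) ?in_set0.
by case: (Q y0).
Qed.

Lemma cons_eq (T : Type) (x y : T) s t : x :: s = y :: t -> x = y /\ s = t.
Proof. by case. Qed.

Section Refinement.
Variables (V L : finType) (S : rel V) (lab : V -> L).
Hypothesis S_sym : symmetric S.

(** Colours live in a type that depends on the labels, the number of parameters, the cap and the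
    depth but not on the graph; its cardinality will bound the number of candidates. *)
Fixpoint ctype k T l : finType :=
  if l is l'.+1 then (ctype k T l' * {ffun ctype k T l' -> 'I_T.+1})%type
  else (L * k.-tuple bool)%type.

Fixpoint col k T (ps : k.-tuple V) l : V -> ctype k T l :=
  match l return V -> ctype k T l with
  | 0 => fun v => (lab v, [tuple of [seq v == p | p <- ps]])
  | l'.+1 => fun v => (col T ps l' v,
      [ffun c => inord (minn T #|[set u in [set u | S v u] | col T ps l' u == c]|)])
  end.

Lemma colS k T (ps qs : k.-tuple V) l u v :
  col T ps l.+1 u = col T qs l.+1 v <->
  col T ps l u = col T qs l v /\ forall c,
    minn T #|[set x in [set x | S u x] | col T ps l x == c]| =
    minn T #|[set x in [set x | S v x] | col T qs l x == c]|.
Proof.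
split=> [[e /ffunP h]|[e h]]; last first.
  by rewrite /= e; congr pair; apply/ffunP=> c; rewrite !ffunE h.
split=> // c; have := h c; rewrite !ffunE => /(congr1 (@nat_of_ord _)).
by rewrite !inordK ?ltnS ?geq_minl.
Qed.

Lemma col_le k T (ps qs : k.-tuple V) l l' u v : l' <= l ->
  col T ps l u = col T qs l v -> col T ps l' u = col T qs l' v.
Proof.
move=> h; rewrite -(subnK h); elim: (l - l') => // n IH.
by rewrite addSn => /colS[/IH].
Qed.

(* The predicates [P] and [Q] restrict the vertices on which the level 0 labels
   have to agree; they shrink by one step of [S] per level. *)
Lemma col_transfer k T k' T' (ps qs : k.-tuple V) (ps' qs' : k'.-tuple V)
    (P Q : nat -> pred V) : T' <= T ->
  (forall l v, P l.+1 v -> P l v /\ forall x, S v x -> P l x) ->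
  (forall l v, Q l.+1 v -> Q l v /\ forall x, S v x -> Q l x) ->
  (forall u v, P 0 u -> Q 0 v ->
     col T ps 0 u = col T qs 0 v -> col T' ps' 0 u = col T' qs' 0 v) ->
  forall l u v, P l u -> Q l v ->
    col T ps l u = col T qs l v -> col T' ps' l u = col T' qs' l v.
Proof.
move=> leT hP hQ h0; elim=> [|l IH] u v Pu Qv; first exact: h0.
have [Pu' hPu] := hP _ _ Pu; have [Qv' hQv] := hQ _ _ Qv.
case/colS=> e hc; apply/colS; split; first exact: IH.
move=> c; set X := #|_|; set Y := #|_|.
suff : minn T X = minn T Y by lia.
apply: capped_count hc _ => x y; rewrite !inE => Sx Sy exy.
by congr (_ == _); apply: IH => //; [apply: hPu|apply: hQv].
Qed.

Lemma col_mono k T T' l (ps qs : k.-tuple V) u v : T' <= T ->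
  col T ps l u = col T qs l v -> col T' ps l u = col T' qs l v.
Proof.
move=> leT.
exact: (@col_transfer _ _ _ _ _ _ _ _ (fun=> predT) (fun=> predT)).
Qed.

Lemma col_plain k T l (ps qs : k.-tuple V) u v :
  col T ps l u = col T qs l v -> col T [tuple] l u = col T [tuple] l v.
Proof.
apply: (@col_transfer _ _ _ _ _ _ _ _ (fun=> predT) (fun=> predT)) => // x y _ _ [e _].
by congr pair => //; apply: val_inj.
Qed.

Lemma col_tnth k T l (ps qs : k.-tuple V) u v i :
  col T ps l u = col T qs l v -> (u == tnth ps i) = (v == tnth qs i).
Proof.
move=> /(col_le (leq0n l)) [_ /(congr1 (fun t => nth false t i))].
by rewrite !(nth_map (tnth ps i)) ?size_tuple // -!tnth_nth.
Qed.

(** * Distances and reduced walks *)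

Fixpoint reach D x y : bool :=
  if D is D'.+1 then (x == y) || [exists z, S x z && reach D' z y] else x == y.

Lemma reach_refl D x : reach D x x.
Proof. by case: D => [|D] /=; rewrite eqxx. Qed.

Lemma reach_le D D' x y : D <= D' -> reach D x y -> reach D' x y.
Proof.
elim: D D' x => [|D IH] D' x; first by move=> _ /eqP ->; apply: reach_refl.
case: D' => // D' h /orP[/eqP ->|/existsP[z /andP[xz zy]]]; first exact: reach_refl.
by apply/orP; right; apply/existsP; exists z; rewrite xz; exact: IH zy.
Qed.

Lemma reach_step D x z y : S x z -> reach D z y -> reach D.+1 x y.
Proof. by move=> xz zy; apply/orP; right; apply/existsP; exists z; rewrite xz. Qed.

Lemma reach_trans D D' x y z : reach D x y -> reach D' y z -> reach (D + D') x z.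
Proof.
elim: D x => [|D IH] x; first by move/eqP->.
case/orP=> [/eqP -> yz|/existsP[t /andP[xt ty]] yz].
  by apply: reach_le yz; apply: leq_addl.
by rewrite addSn; apply: reach_step xt (IH _ ty yz).
Qed.

Lemma reach_sym D x y : reach D x y -> reach D y x.
Proof.
elim: D x => [|D IH] x; first by rewrite /= eq_sym.
case/orP=> [/eqP ->|/existsP[t /andP[xt ty]]]; first exact: reach_refl.
rewrite -addn1; apply: reach_trans (IH _ ty) _ => /=.
by apply/orP; right; apply/existsP; exists x; rewrite S_sym xt /=.
Qed.

(** Non-backtracking walks. They play the part of paths in a tree: the absence of short closed ones
    is the form in which the girth is used. *)
Fixpoint walk (s : seq V) : bool :=
  if s is x :: s1 then
    if s1 is y :: s2 then
      [&& S x y, (if s2 is z :: _ then x != z else true) & walk s1]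
    else true
  else true.

Lemma walk_cons x y s : walk [:: x, y & s] =
  [&& S x y, (if s is z :: _ then x != z else true) & walk (y :: s)].
Proof. by []. Qed.

Lemma walk_belast s x : walk (rcons s x) -> walk s.
Proof.
elim: s => // y [|z s] IH //; rewrite !rcons_cons !walk_cons.
case/and3P=> -> h /IH ->; rewrite andbT /=; by case: s h {IH}.
Qed.

Lemma walk_reach x s : walk (x :: s) -> reach (size s) x (last x s).
Proof.
elim: s x => [|y s IH] x; first by rewrite /= eqxx.
case/and3P=> xy _ /IH; exact: reach_step.
Qed.

(** Whenever prefixing a step would backtrack, that step and the following one cancel. *)
Lemma reach_walk D x y : reach D x y ->
  exists s, [/\ walk (x :: s), last x s = y & size s <= D].
Proof.
elim: D x => [|D IH] x; first by move=> /eqP ->; exists [::].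
case/orP=> [/eqP ->|/existsP[z /andP[xz /IH[s [ws ls ss]]]]]; first by exists [::].
case: s ws ls ss => [|t s] ws ls ss.
  by exists [:: z]; rewrite /= xz; split.
case: (eqVneq x t) => [->|xt].
  exists s; split=> //; first by case/and3P: ws.
  by apply: ltnW; apply: ltnW.
by exists (z :: t :: s); split=> //; rewrite /= xz xt; apply: ws.
Qed.

(** * Back-and-forth moves in graphs without short cycles *)

Section Locality.
Variable K : nat.
Hypothesis no_short_cycle :
  forall x s, walk (x :: s) -> 0 < size s <= K -> last x s != x.

(** The walk is copied from its end backwards, one level of colour being spent per step. To prevent
    backtracking a neighbour different from the previous vertex [z'] is needed. If [v] and [z] have
    the same colour, a cap of at least 2 provides two such neighbours; otherwise any neighbour
    coloured like [v] differs from [z']. *)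
Lemma walk_transfer k T (ps qs : k.-tuple V) s v m x' : walk (v :: s) ->
  col T.+2 ps (m + size s) (last v s) = col T.+2 qs (m + size s) x' ->
  exists v' s', [/\ walk (v' :: s'), last v' s' = x' &
    map (col T.+2 ps m) (v :: s) = map (col T.+2 qs m) (v' :: s')].
Proof.
elim: s v m => [|p s IH] v m ws hc.
  by exists x', [::]; split=> //=; congr cons; rewrite addn0 in hc.
case/and3P: (ws) => vp hvz wps.
rewrite /= addnS -addSn in hc; have [p' [s' [ws' ls' hm]]] := IH p m.+1 wps hc.
have [/colS[hp hcnt] hs] := cons_eq hm.
have hs' : map (col T.+2 ps m) s = map (col T.+2 qs m) s'.
  by have := congr1 (map fst) hs; rewrite -!map_comp.
suff [v' [vp' cv' nv']] : exists v', [/\ S p' v', col T.+2 ps m v = col T.+2 qs m v' &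
    is_true (if s' is z :: _ then v' != z else true)].
  exists v', (p' :: s'); split=> //; last by rewrite /= cv' hp hs'.
  by rewrite /= S_sym vp' nv'; exact: ws'.
have := hcnt (col T.+2 ps m v).
set X := [set x in _ | _]; set Y := [set x in _ | _] => hXY.
have vX : v \in X by rewrite !inE S_sym vp eqxx.
have inY y : y \in Y -> S p' y /\ col T.+2 ps m v = col T.+2 qs m y.
  by rewrite !inE => /andP[h /eqP ->].
case: s s' hs' hvz wps ws' {ws hs IH hc ls' hm} => [|z s] [|z' s'] // => [_ _ _ _|[hz _] vz wz wz'].
  have /card_gt0P[y /inY[]] : 0 < #|Y|.
    have : 0 < #|X| by apply/card_gt0P; exists v.
    by move: hXY; lia.
  by exists y.
case: (eqVneq (col T.+2 ps m v) (col T.+2 ps m z)) => [e|ne].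
  have : 1 < #|X|.
    apply/card_gt1P; exists v, z; split=> //.
    by rewrite !inE -e eqxx andbT; case/and3P: wz.
  move=> X1; have : 1 < #|Y| by move: hXY; lia.
  case/card_gt1P=> y1 [y2 [/inY[? ?] /inY[? ?] ny]].
  case: (eqVneq y1 z') => [ez|ny1]; last by exists y1.
  by exists y2; split=> //; rewrite -ez eq_sym.
have /card_gt0P[y /inY[Sy ey]] : 0 < #|Y|.
  have : 0 < #|X| by apply/card_gt0P; exists v.
  by move: hXY; lia.
exists y; split=> //; apply: contraNneq ne => yz.
by rewrite hz -yz ey.
Qed.

(** The end of the walk becomes a new parameter. Seen from [v], one neighbour lies on the walk and
    has a shorter walk to the parameter, while all others prolong it; both kinds fall under the
    induction hypothesis. Splitting off the special neighbour costs one unit of the cap. Since all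
    walks involved have length at most [K], only the trivial one ends where it starts, which settles
    level 0. *)
Lemma col_cons_walk k T l (ps qs : k.-tuple V) v s v' s' :
  walk (v :: s) -> walk (v' :: s') -> size s + l <= K ->
  map (col T.+1 ps l) (v :: s) = map (col T.+1 qs l) (v' :: s') ->
  col T [tuple of last v s :: ps] l v = col T [tuple of last v' s' :: qs] l v'.
Proof.
elim: l v s v' s' => [|l IH] v s v' s' ws ws' hK hm.
  have es : size s = size s' by have /(congr1 size) := hm; rewrite /= !size_map => -[].
  have head0 x t : walk (x :: t) -> size t <= K -> (x == last x t) = nilp t.
    case: t => [|y t] wt st; first by rewrite /= eqxx.
    by apply/negbTE; rewrite eq_sym; apply: no_short_cycle.
  case: hm => elab etup _; congr pair => //; apply: val_inj => /=.
  by rewrite etup !head0 // ?/nilp ?es // -?es; move: hK; rewrite addn0.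
have hml : map (col T.+1 ps l) (v :: s) = map (col T.+1 qs l) (v' :: s').
  by have := congr1 (map fst) hm; rewrite -!map_comp.
have hKl : size s + l <= K by apply: leq_trans hK; rewrite leq_add2l.
apply/colS; split; first exact: IH.
move=> c; have [/colS[_ hcnt] _] := cons_eq hm.
set X := [set x | S v x] in hcnt *; set Y := [set x | S v' x] in hcnt *.
case: s s' ws ws' hK hm hml hKl => [|p s] [|p' s'] ws ws' hK hm hml hKl //.
  have := @capped_count _ _ T X Y (col T.+1 ps l) (col T.+1 qs l); apply.
    by move=> c0; have := hcnt c0; lia.
  move=> x y; rewrite !inE => Sx Sy exy; congr (_ == _).
  apply: (IH x [:: v] y [:: v']).
  - by rewrite /= S_sym Sx.
  - by rewrite /= S_sym Sy.
  - by move: hK; clear; rewrite /=; lia.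
  - by rewrite map_cons exy hml.
have [wps wps'] : walk (p :: s) /\ walk (p' :: s').
  by split; [case/and3P: (ws)|case/and3P: (ws')].
have [pX pY] : p \in X /\ p' \in Y.
  by rewrite !inE; case/and3P: (ws) => -> _ _; case/and3P: (ws').
have hp : col T [tuple of last v (p :: s) :: ps] l p =
          col T [tuple of last v' (p' :: s') :: qs] l p'.
  apply: (IH p s p' s') => //; first by move: hKl; clear; rewrite /=; lia.
  by have [_] := cons_eq hml.
have remove1 (Z : {set V}) (q : V) (P : pred V) : q \in Z ->
    #|[set x in Z | P x]| = P q + #|[set x in Z :\ q | P x]|.
  move=> qZ; rewrite (cardsD1 q) inE qZ /=; congr (_ + _).
  by apply: eq_card => x; rewrite !inE andbA.
rewrite (remove1 X p) // (remove1 Y p') // hp.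
set e := (_ == c) : nat.
suff : minn T #|[set x in X :\ p | col T [tuple of last v (p :: s) :: ps] l x == c]| =
       minn T #|[set x in Y :\ p' | col T [tuple of last v' (p' :: s') :: qs] l x == c]|.
  by lia.
apply: (@capped_count _ _ T _ _ (col T.+1 ps l) (col T.+1 qs l)) => [c0|x y].
  have := hcnt c0; rewrite (remove1 X p) // (remove1 Y p') //.
  by case: hml => _ -> _; lia.
rewrite !inE => /andP[xp Sx] /andP[yp Sy] exy; congr (_ == _).
apply: (IH x (v :: p :: s) y (v' :: p' :: s')).
- by rewrite S_sym in Sx; rewrite /= Sx xp; exact: ws.
- by rewrite S_sym in Sy; rewrite /= Sy yp; exact: ws'.
- by move: hK; clear; rewrite /=; lia.
- by rewrite map_cons exy hml.
Qed.

(** The invariant of the Ehrenfeucht-Fraisse game, with both tuples in the same graph. *)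
Definition similar k T R (a b : k.-tuple V) : Prop :=
  forall i, col T a R (tnth a i) = col T b R (tnth b i).

Lemma similar_sym k T R (a b : k.-tuple V) : similar T R a b -> similar T R b a.
Proof. by move=> h i. Qed.

Lemma similar_le k T T' R R' (a b : k.-tuple V) : T' <= T -> R' <= R ->
  similar T R a b -> similar T' R' a b.
Proof. by move=> hT hR h i; apply: col_mono hT _; apply: col_le hR _. Qed.

Lemma similar_reach k T R D (a b : k.-tuple V) i j : similar T.+2 R a b -> D <= R ->
  reach D (tnth a i) (tnth a j) -> reach D (tnth b i) (tnth b j).
Proof.
move=> hE hD /reach_walk[s [ws ls ss]].
have := @walk_transfer _ T a b s _ 0 (tnth b j) ws.
rewrite ls add0n => /(_ (col_le (leq_trans ss hD) (hE j))) [v' [s' [ws' ls' hm]]].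
have es : size s = size s' by have /(congr1 size) := hm; rewrite /= !size_map => -[].
have := walk_reach ws'; rewrite ls' -es => /(reach_le ss).
have /eqP -> // : v' == tnth b i.
have hv : col T.+2 a 0 (tnth a i) = col T.+2 b 0 v' by case: hm => h1 h2 _; congr pair => //; apply: val_inj.
by rewrite -(col_tnth i hv).
Qed.

(** An entry within distance [l] of the new vertex is joined to it by a walk that can be
    transferred, at a cost of [l] levels, leaving the [l] levels which [col_cons_walk] uses. An
    entry further away does not see the new vertex within [l] steps, so its colour is just copied.
    The radius is halved and the cap drops by one. *)
Lemma similar_cons k T l (a b : k.-tuple V) c d :
  l + l <= K -> similar T.+2 (l + l) a b ->
  col T.+2 a (l + l) c = col T.+2 b (l + l) d ->
  similar T.+1 l [tuple of c :: a] [tuple of d :: b].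
Proof.
move=> hK hE hcd i.
have one_side (a' b' : k.-tuple V) c' d' j : similar T.+2 (l + l) a' b' ->
    col T.+2 a' (l + l) c' = col T.+2 b' (l + l) d' -> reach l (tnth a' j) c' ->
    exists s s', [/\ walk (tnth a' j :: s) /\ last (tnth a' j) s = c',
      walk (tnth b' j :: s') /\ last (tnth b' j) s' = d', size s <= l, size s' <= l
      & map (col T.+2 a' l) (tnth a' j :: s) = map (col T.+2 b' l) (tnth b' j :: s')].
  move=> hE' hcd' /reach_walk[s [ws ls ss]].
  have := @walk_transfer _ T a' b' s _ l d' ws; rewrite ls.
  have hl : l + size s <= l + l by rewrite leq_add2l.
  move=> /(_ (col_le hl hcd')) [v' [s' [ws' ls' hm]]].
  have es : size s = size s' by have /(congr1 size) := hm; rewrite /= !size_map => -[].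
  have /eqP ev : v' == tnth b' j.
    by case: (hm) => hv _; rewrite -(col_tnth j hv).
  by exists s, s'; rewrite -ev -es; split.
case: (unliftP ord0 i) => [j|] ->; last first.
  rewrite !tnth0; apply: (@col_cons_walk _ _ _ _ _ _ [::] _ [::]) => //.
    by apply: leq_trans hK; apply: leq_addr.
  by rewrite /= (col_le (leq_addr l l) hcd).
rewrite !tnthS; case: (boolP (reach l (tnth a j) c)) => hr.
  have [s [s' [[ws ls] [ws' ls'] ss _ hm]]] := one_side _ _ _ _ _ hE hcd hr.
  have := @col_cons_walk _ T.+1 l a b _ s _ s' ws ws'; rewrite ls ls'; apply=> //.
  by apply: leq_trans hK; rewrite leq_add2r.
have hr' : ~~ reach l (tnth b j) d.
  apply: contra hr => hr.
  have [s [s' [_ [ws' ls'] _ ss _]]] := one_side _ _ _ _ _ (similar_sym hE) (esym hcd) hr.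
  by rewrite -ls'; apply: reach_le (walk_reach ws').
apply: (@col_transfer _ T.+2 _ _ a b _ _ (fun m x => ~~ reach m x c) (fun m x => ~~ reach m x d)) => //.
- move=> m v h; split=> [|x vx]; apply: contra h; last exact: reach_step.
  exact: reach_le.
- move=> m v h; split=> [|x vx]; apply: contra h; last exact: reach_step.
  exact: reach_le.
- move=> u v /= /negbTE uc /negbTE vd [e et].
  by congr pair => //; apply: val_inj; rewrite /= uc vd et.
- exact: (col_le (leq_addr l l) (hE j)).
Qed.

(** Far from all parameters the parameter bits are constantly false within the relevant ball. *)
Lemma col_far k T l (ps qs : k.-tuple V) u v :
  (forall i, ~~ reach l u (tnth ps i)) -> (forall i, ~~ reach l v (tnth qs i)) ->
  col T [tuple] l u = col T [tuple] l v -> col T ps l u = col T qs l v.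
Proof.
pose far (rs : k.-tuple V) m x := [forall i, ~~ reach m x (tnth rs i)].
have far_step rs m x : far rs m.+1 x -> far rs m x /\ forall y, S x y -> far rs m y.
  move/forallP=> h; split=> [|y xy]; apply/forallP=> i; apply: contra (h i).
    exact: reach_le.
  exact: reach_step.
move=> /forallP hu /forallP hv.
apply: (@col_transfer 0 T k T _ _ _ _ (far ps) (far qs)) => //; try exact: far_step.
move=> {hu hv}x y /forallP hx /forallP hy [e]; congr pair => //; apply: eq_from_tnth => i.
by have := hx i; have := hy i; rewrite !tnth_map /= => /negbTE -> /negbTE ->.
Qed.

(** A vertex near an entry of [a] is answered by the start of the transferred walk at the
    corresponding entry of [b]. *)
Lemma near_move k T R D l (a b : k.-tuple V) c j : R <= K ->
  similar T.+2 R a b -> D + (l + l) <= R -> reach D c (tnth a j) ->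
  exists2 d, reach D d (tnth b j) & similar T.+1 l [tuple of c :: a] [tuple of d :: b].
Proof.
move=> hRK hE hR /reach_walk[s [ws ls ss]].
have := @walk_transfer _ T a b s _ (l + l) (tnth b j) ws; rewrite ls.
have hl : l + l + size s <= R by apply: leq_trans hR; rewrite addnC leq_add2r.
move=> /(_ (col_le hl (hE j))) [d [s' [ws' ls' hm]]].
have es : size s = size s' by have /(congr1 size) := hm; rewrite /= !size_map => -[].
have hlR : l + l <= R by apply: leq_trans hR; apply: leq_addl.
exists d; first by rewrite -ls'; apply: reach_le (walk_reach ws'); rewrite -es.
apply: similar_cons; first exact: leq_trans hRK.
  exact: similar_le hE.
by case: hm.
Qed.

(* If every vertex of the plain colour of [c] were close to [b], then a
   scattered family of such vertices could be copied next to [a] and enlarged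
   by [c], so there would be arbitrarily large scattered families near [b]. *)
Lemma far_move k T R rho l (a b : k.-tuple V) c : R <= K -> l <= rho ->
  3 * 2 ^ k * rho <= R -> similar (T.+2 + k) R a b ->
  (forall j, ~~ reach (3 * rho) c (tnth a j)) ->
  exists d, (forall j, ~~ reach rho d (tnth b j)) /\
    col T.+2 [tuple] l c = col T.+2 [tuple] l d.
Proof.
move=> hRK hl hR hE hc.
case: (boolP [exists d, [forall j, ~~ reach rho d (tnth b j)] &&
    (col T.+2 [tuple] l c == col T.+2 [tuple] l d)]).
  by case/existsP=> d /andP[/forallP h1 /eqP h2]; exists d.
move/existsPn=> hno; exfalso.
have near v : col T.+2 [tuple] l c = col T.+2 [tuple] l v ->
    exists j, reach rho v (tnth b j).
  move=> e; have := hno v; rewrite e eqxx andbT => /forallPn[j].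
  by rewrite negbK; exists j.
pose scattered (s : seq V) := pairwise (fun x y => ~~ reach (2 * rho) x y) s.
(* Here [m] counts the near moves that must still be possible afterwards. The radii satisfy [rho + 2
   * (3 * 2 ^ m * rho - rho) = 3 * 2 ^ m.+1 * rho - rho], as [near_move] demands for a vertex within
   [rho]; at [m = 0] a radius of [2 * rho] remains, enough to compare distances of copies. *)
have copy n s : size s = n -> (forall x, x \in s -> col T.+2 [tuple] l c = col T.+2 [tuple] l x) ->
    forall m, n + m <= k -> exists k' (b' a' : k'.-tuple V) s',
    [/\ similar (T.+2 + m) (3 * 2 ^ m * rho - rho) b' a', size s' = n,
        forall i, i < n -> exists j, tnth b' j = nth c s i /\ tnth a' j = nth c s' i,
        forall i, i < n -> exists j, reach rho (nth c s' i) (tnth a j) &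
        forall j, exists i, tnth b' i = tnth b j /\ tnth a' i = tnth a j].
  elim: n s => [|n IH] s.
    move=> _ _ m hm; exists k, b, a, [::]; split=> //; last by move=> j; exists j.
    apply: similar_sym; apply: similar_le hE; first by rewrite leq_add2l.
    apply: leq_trans hR; apply: leq_trans (leq_subr _ _) _.
    by rewrite leq_mul2r leq_mul2l leq_pexp2l ?orbT.
  case: s => // x s [ss] hs m hm.
  have hs' y : y \in s -> col T.+2 [tuple] l c = col T.+2 [tuple] l y.
    by move=> ys; apply: hs; rewrite inE ys orbT.
  have [|k' [b' [a' [s' [hE' ss' hsi hsn hba]]]]] := IH s ss hs' m.+1; first lia.
  have [j hj] := near x (hs x (mem_head _ _)).
  have [i [ebi eai]] := hba j.
  have p0 : 0 < 2 ^ m by rewrite expn_gt0.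
  have [||||d hd hE2] := @near_move _ (T + m.+1) (3 * 2 ^ m.+1 * rho - rho) rho (3 * 2 ^ m * rho - rho) b' a' x i.
  - apply: leq_trans hRK; apply: leq_trans hR; apply: leq_trans (leq_subr _ _) _.
    by rewrite leq_mul2r leq_mul2l leq_pexp2l ?orbT //; lia.
  - exact: hE'.
  - rewrite expnS; nia.
  - by rewrite ebi.
  exists k'.+1, [tuple of x :: b'], [tuple of d :: a'], (d :: s'); split.
  - by move: hE2; rewrite addnS.
  - by rewrite /= ss'.
  - case=> [|t] ht; first by exists ord0; rewrite !tnth0.
    by have [i' [e1 e2]] := hsi t ht; exists (lift ord0 i'); rewrite !tnthS.
  - case=> [|t] ht; last exact: hsn.
    by exists j; rewrite -eai.
  - move=> j'; have [i' [e1 e2]] := hba j'.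
    by exists (lift ord0 i'); rewrite !tnthS.
(* The copies lie within [rho] of [a] while [c] is further than [3 * rho] from [a], so [c] is
   further than [2 * rho] from each copy and can be added. *)
have family n : n <= k.+1 -> exists s, [/\ size s = n, scattered s &
    forall x, x \in s -> col T.+2 [tuple] l c = col T.+2 [tuple] l x].
  elim: n => [|n IH] hn; first by exists [::].
  have [s [ss sc hs]] := IH (ltnW hn).
  have [|k' [b' [a' [s' [hE' ss' hsi hsn _]]]]] := copy n s ss hs 0; first by rewrite addn0.
  rewrite expn0 muln1 addn0 in hE'.
  have h2 : 2 * rho <= 3 * rho - rho by lia.
  exists (c :: s'); split; first by rewrite /= ss'.
    rewrite /scattered /= -/(scattered s'); apply/andP; split.
      apply/(all_nthP c) => i; rewrite ss' => hi; have [j hj] := hsn i hi.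
      apply: contra (hc j) => hci; have -> : 3 * rho = 2 * rho + rho by lia.
      exact: reach_trans hj.
    apply/(pairwiseP c) => i j; rewrite !inE ss' => hi hj hij.
    have [i' [ei ei']] := hsi i hi; have [j' [ej ej']] := hsi j hj.
    rewrite -ei' -ej'; apply/negP => /(similar_reach (similar_sym hE') h2).
    rewrite ei ej; apply/negP.
    by move/(pairwiseP c): sc; apply=> //; rewrite inE ss.
  move=> x; rewrite inE => /orP[/eqP ->//|/(nthP c)[i]]; rewrite ss' => hi <-.
  have [i' [ei ei']] := hsi i hi; rewrite -ei'.
  rewrite (hs (nth c s i)) ?mem_nth ?ss // -ei.
  apply: (@col_plain k' _ _ b' a'); apply: col_le (hE' i'); lia.
(* Among [k.+1] vertices near the [k] entries of [b], two are near the same entry, hence within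
   [2 * rho] of each other. *)
have [s [ss sc hs]] := family k.+1 (leqnn _).
have nearb (i : 'I_k.+1) : exists j, reach rho (nth c s i) (tnth b j).
  by apply/near/hs; rewrite mem_nth ?ss.
pose f i := xchoose (nearb i).
have /injectivePn[i [j ij ef]] : ~~ injectiveb f.
  apply/injectiveP => /leq_card; rewrite !card_ord ltnn //.
wlog hij : i j ij ef / i < j.
  move=> W; case: (ltngtP i j) => h; [exact: (W i j)|apply: (W j i) => //|].
    by rewrite eq_sym.
  by move/val_inj: h ij => ->; rewrite eqxx.
have : ~~ reach (2 * rho) (nth c s i) (nth c s j).
  by move/(pairwiseP c): sc; apply=> //; rewrite inE ss.
apply/negP; rewrite negbK mul2n -addnn; apply: reach_trans (xchooseP (nearb i)) _.
rewrite -/(f i) ef; apply: reach_sym; exact: (xchooseP (nearb j)).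
Qed.

End Locality.
End Refinement.

(** * First-order equivalence *)

Fixpoint qrank k (phi : fo k) : nat :=
  match phi with
  | FEq _ _ _ | FAdj _ _ _ => 0
  | FNot _ psi => qrank psi
  | FAnd _ psi chi => maxn (qrank psi) (qrank chi)
  | FEx _ psi => (qrank psi).+1
  end.

Lemma eq_sat (G : sgraph) k (phi : fo k) (r1 r2 : 'I_k -> G) :
  r1 =1 r2 -> sat phi r1 = sat phi r2.
Proof.
elim: k / phi r1 r2 => [k i j|k i j|k psi IH|k psi IH1 chi IH2|k psi IH] r1 r2 e /=.
- by rewrite !e.
- by rewrite !e.
- by rewrite (IH _ r2).
- by rewrite (IH1 _ r2) // (IH2 _ r2).
- apply: eq_existsb => x; apply: IH => i.
  by rewrite /env_cons; case: unlift.
Qed.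

Lemma env_cons_tnth (T : Type) k (x : T) (a : k.-tuple T) :
  env_cons x (tnth a) =1 tnth [tuple of x :: a].
Proof.
by move=> i; rewrite /env_cons; case: unliftP => [j|] ->; rewrite ?tnthS ?tnth0.
Qed.

(** The increments are dictated by [far_move] with [rho] twice the next radius [R] and at most [L]
    parameters: it needs the radius [6 * 2 ^ k * R], below [2 ^ (L + 3) * R], and a cap larger by
    one per possible copy. *)
Definition radius L i := 2 ^ ((L + 3) * i).
Definition threshold L i := 2 + (L + 2) * i.

Section Invariance.
Variables (G : sgraph) (Lb : finType) (S : rel G) (lab : G -> Lb) (K L : nat).
Hypothesis S_sym : symmetric S.
Hypothesis no_short_cycle :
  forall x s, walk S (x :: s) -> 0 < size s <= K -> last x s != x.
Hypothesis adjE : forall u v u' v' : G, u != v -> u' != v' ->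
  lab u = lab u' -> lab v = lab v' -> S u v = S u' v' -> adj u v = adj u' v'.

(** One round of the game per quantifier. For atoms, adjacency of distinct vertices is recovered by
    [adjE] from labels and the sparse relation, and the latter is reachability in one step. *)
Lemma similar_sat i k (phi : fo k) (a b : k.-tuple G) :
  qrank phi <= i -> k + i <= L -> radius L i <= K ->
  similar S lab (threshold L i) (radius L i) a b ->
  sat phi (tnth a) = sat phi (tnth b).
Proof.
elim: k / phi i a b => [k x y|k x y|k psi IH|k psi IH1 chi IH2|k psi IH] i a b /=.
- move=> _ _ _ hE; exact: col_tnth (hE x).
- move=> _ _ _ hE.
  have [/eqP exy|nxy] := boolP (tnth a x == tnth a y).
    have := hE x => /(col_tnth y); rewrite exy eqxx => /esym/eqP ->.
    by rewrite !adj_irr.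
  have nxy' : tnth b x != tnth b y by rewrite -(col_tnth y (hE x)).
  have lb z : lab (tnth a z) = lab (tnth b z).
    by have /(col_le (leq0n _)) := hE z; case.
  apply: adjE => //.
  have R1 : 1 <= radius L i by rewrite expn_gt0.
  have T2 : 2 <= threshold L i by apply: leq_addr.
  have step (c d : k.-tuple G) : tnth c x != tnth c y -> tnth d x != tnth d y ->
      similar S lab (threshold L i) (radius L i) c d -> S (tnth c x) (tnth c y) -> S (tnth d x) (tnth d y).
    move=> nc nd hcd hS.
    have : reach S 1 (tnth c x) (tnth c y).
      by apply: reach_step hS _; rewrite /= eqxx.
    have E2 : threshold L i = (threshold L i - 2).+2 by rewrite /threshold; lia.
    rewrite E2 in hcd.
    move=> /(similar_reach S_sym hcd R1) /=; rewrite (negbTE nd) /=.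
    by case/existsP=> z /andP[h /eqP <-].
  by apply/idP/idP => h; [apply: step h|apply: step h => //; apply: similar_sym].
- by move=> h1 h2 h3 h4; congr negb; apply: IH h4.
- rewrite geq_max => /andP[h1 h2] hk hK hE.
  by rewrite (IH1 _ _ _ h1 hk hK hE) (IH2 _ _ _ h2 hk hK hE).
- case: i => // i; rewrite ltnS => hq hk hK.
  set R := radius L i; set rho := 2 * R.
  have ER : radius L i.+1 = 2 ^ (L + 3) * R by rewrite /radius mulnS expnD.
  have p3 : 2 ^ (L + 3) = 2 ^ L * 8 by rewrite expnD.
  have pL : 0 < 2 ^ L by rewrite expn_gt0.
  have hR8 : 8 * R <= radius L i.+1 by rewrite ER p3; nia.
  have hRK : R <= K by lia.
  pose T := L * i + 2 * i + 1.
  have ET : threshold L i = T.+1 by rewrite /threshold /T mulnDl; lia.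
  have half (c d : k.-tuple G) x : similar S lab (threshold L i.+1) (radius L i.+1) c d ->
      sat psi (env_cons x (tnth c)) -> exists y, sat psi (env_cons y (tnth d)).
    move=> hE hx.
    suff [y hy] : exists y, similar S lab T.+1 R [tuple of x :: c] [tuple of y :: d].
      exists y; rewrite (eq_sat _ (env_cons_tnth y d)).
      rewrite -(IH i [tuple of x :: c]) //; last by rewrite ET.
        by rewrite -(eq_sat _ (env_cons_tnth x c)).
      by rewrite addSn -addnS.
    (* A near move at distance [3 * rho] that leaves the radius [R] needs [6 * R + 2 * R], which is
       the origin of [hR8]. *)
    case: (boolP [exists j, reach S (3 * rho) x (tnth c j)]) => [/existsP[j hj]|/existsPn far].
      have hT : T.+2 <= threshold L i.+1 by rewrite /threshold /T mulnS mulnDl; lia.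
      have hE' := similar_le hT (leqnn _) hE.
      have hD : 3 * rho + (R + R) <= radius L i.+1 by rewrite /rho; lia.
      have [y _ hy] := near_move S_sym no_short_cycle hK hE' hD hj.
      by exists y.
    have hT : T.+2 + k <= threshold L i.+1 by rewrite /threshold /T mulnS mulnDl; lia.
    have hE' := similar_le hT (leqnn _) hE.
    have hkR : 3 * 2 ^ k * rho <= radius L i.+1.
      have : 2 ^ k <= 2 ^ L by rewrite leq_pexp2l //; lia.
      by rewrite ER p3 /rho; nia.
    have [y [fary ecol]] := far_move S_sym no_short_cycle hK (leqnn rho) hkR hE' far.
    exists y; apply: (similar_cons S_sym no_short_cycle); first by lia.
      by apply: similar_le hE => //; rewrite ?ER; [rewrite /threshold /T mulnS mulnDl; lia|rewrite -ER; lia].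
    have er : R + R = rho by rewrite /rho mul2n addnn.
    rewrite er; apply: col_far ecol => // j.
    by apply: contra (far j); apply: reach_le; rewrite leq_pmull.
  move=> hE; apply/existsP/existsP=> -[x hx]; first exact: half hE hx.
  exact: half (similar_sym hE) hx.
Qed.

(** The tuple is similar to itself, so equal colours over it make the two extensions similar. This
    justifies trying one vertex per colour class. *)
Theorem same_colour_sat i k (phi : fo k.+1) (a : k.-tuple G) c d T R :
  qrank phi <= i -> k.+1 + i <= L -> 2 * radius L i <= R -> 2 * radius L i <= K ->
  threshold L i < T -> col S lab T a R c = col S lab T a R d ->
  sat phi (env_cons c (tnth a)) = sat phi (env_cons d (tnth a)).
Proof.
move=> hq hk hR hK hT hc.
rewrite !(eq_sat _ (env_cons_tnth _ a)); apply: (similar_sat hq hk); first lia.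
have ET : threshold L i = ((L + 2) * i).+1.+1 by [].
rewrite ET in hT *; apply: (similar_cons S_sym no_short_cycle); first lia.
  by [].
apply: col_le (col_mono hT hc); first lia.
Qed.

End Invariance.

(** * Flipped incidence graphs *)

Section Flip.
Variables (B A : finType) (inc : B -> A -> bool).

Definition flip_adj (x y : B + A) : bool :=
  match x, y with
  | inl _, inl _ => false
  | inr a, inr a' => a != a'
  | inl b, inr a | inr a, inl b => ~~ inc b a
  end.

Lemma flip_adj_sym : symmetric flip_adj.
Proof. by move=> [b|a] [b'|a'] //=; rewrite eq_sym. Qed.

Lemma flip_adj_irr : irreflexive flip_adj.
Proof. by move=> [b|a] //=; rewrite eqxx. Qed.

Definition flip_graph : sgraph := SGraph flip_adj_sym flip_adj_irr.

End Flip.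

Lemma first_true (T : Type) (e : rel T) (P : pred T) x s :
  path e x s -> ~~ P x -> P (last x s) ->
  exists s1 z s2, [/\ s = s1 ++ z :: s2, ~~ P (last x s1) & P z].
Proof.
elim: s x => [|y s IH] x /=; first by move=> _ /negbTE ->.
case/andP=> _ ps nx ly; case: (boolP (P y)) => py.
  by exists [::], y, s.
have [s1 [z [s2 [-> h1 h2]]]] := IH y ps py ly.
by exists (y :: s1), z, s2.
Qed.

Lemma card_le_fibers (T U : finType) (D : {set T}) (f : T -> U) m n :
  #|f @: D| <= m -> (forall y, #|[set x in D | f x == y]| <= n) -> #|D| <= m * n.
Proof.
move=> hm hn; rewrite -sum1_card (partition_big_imset f) /=.
apply: leq_trans (_ : \sum_(y in f @: D) n <= _); last by rewrite sum_nat_const leq_mul2r hm orbT.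
apply: leq_sum => y _; apply: leq_trans (hn y); rewrite -sum1_card.
by apply: eq_leq; apply: eq_bigl => x; rewrite inE.
Qed.

(** * Lower bounds for twin-width and merge-width *)

Section LowerBounds.
Variables (B A : finType) (inc : B -> A -> bool) (oth : B -> A -> B) (d : nat).
Hypothesis Bgt1 : 1 < #|B|.
Hypothesis deg : forall b, d <= #|[set a | inc b a]|.
Hypothesis othP : forall b a, inc b a -> oth b a != b /\ inc (oth b a) a.
Hypothesis linear : forall b b' a a', b != b' ->
  inc b a -> inc b' a -> inc b a' -> inc b' a' -> a = a'.

Let G := flip_graph inc.
Implicit Types (P Q : {set {set G}}) (X Y : {set G}).

Definition collides X : bool :=
  [exists b : B, exists b' : B, [&& b != b', (inl b : G) \in X & (inl b' : G) \in X]].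

Definition collision P : bool := [exists X in P, collides X].

Lemma collidesPn X b b' : ~~ collides X -> (inl b : G) \in X -> (inl b' : G) \in X -> b = b'.
Proof.
move=> /existsPn h1 bX b'X; apply/eqP; have /existsPn/(_ b') := h1 b.
by rewrite bX b'X !andbT negbK.
Qed.

Lemma collision_singletons : ~~ collision (singletons G).
Proof.
apply/existsPn=> X; rewrite negb_and; apply/orP.
case: (boolP (X \in _)) => [/imsetP[x _ ->]|]; [right|by left].
apply/existsPn=> b; apply/existsPn=> b'; rewrite !inE.
by case: eqP => //= ne; apply/negP=> /andP[/eqP <- /eqP[/esym]].
Qed.

Lemma collision_one_block : collision (one_block G).
Proof.
have /card_gt1P[b [b' [_ _ ne]]] := Bgt1.
apply/existsP; exists setT; rewrite !inE eqxx andbT /=; apply/andP; split.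
  by apply/eqP=> /setP/(_ (inl b)); rewrite !inE.
by apply/existsP; exists b; apply/existsP; exists b'; rewrite ne !inE.
Qed.

Lemma merge_step_partition P Q : partition P setT -> merge_step P Q ->
  partition Q setT.
Proof.
move=> pP /existsP[X /andP[XP /existsP[Y /and3P[YP ne /eqP ->]]]].
exact: partition_merge.
Qed.

(** Both merged parts had at most one element of [B] each, so the new part has exactly two and all
    others still have at most one. *)
Lemma first_collision P Q : ~~ collision P -> merge_step P Q -> collision Q ->
  exists X b b', [/\ X \in Q /\ b != b', (inl b : G) \in X, (inl b' : G) \in X,
    forall c, (inl c : G) \in X -> c = b \/ c = b' &
    forall Y c c', Y \in Q -> Y != X -> (inl c : G) \in Y -> (inl c' : G) \in Y -> c = c'].
Proof.
move=> /existsPn nP /existsP[X1 /andP[X1P /existsP[X2 /and3P[X2P ne /eqP ->]]]].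
have nc Y : Y \in P -> ~~ collides Y by move=> YP; have := nP Y; rewrite YP.
case/existsP=> X /andP[XQ].
case/existsP=> b /existsP[b' /and3P[bb' bX b'X]].
have eX : X = X1 :|: X2.
  move: XQ; rewrite !inE => /orP[/eqP //|/and3P[_ _ XP]].
  by move/eqP: bb'; case; exact: collidesPn (nc _ XP) bX b'X.
exists X, b, b'; split=> //.
  move=> c; move: bX b'X; rewrite eX !inE.
  have h1 x y : inl x \in X1 -> inl y \in X1 -> x = y := collidesPn (nc _ X1P).
  have h2 x y : inl x \in X2 -> inl y \in X2 -> x = y := collidesPn (nc _ X2P).
  move=> /orP[] hb /orP[] hb' /orP[] hc; try (by left; apply: h1); try (by left; apply: h2);
    try (by right; apply: h1); try (by right; apply: h2);
    case/negP: bb'; apply/eqP; by [apply: h1|apply: h2].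
move=> Y c c'; rewrite !inE eX => /orP[/eqP ->|/and3P[_ _ YP]]; first by rewrite eqxx.
by move=> _; apply: collidesPn (nc _ YP).
Qed.

Section AtCollision.
Variables (P : {set {set G}}) (X : {set G}) (b b' : B).
Hypothesis partP : partition P setT.
Hypothesis XP : X \in P.
Hypothesis neb : b != b'.
Hypothesis bX : (inl b : G) \in X.
Hypothesis b'X : (inl b' : G) \in X.
Hypothesis onlyX : forall c, (inl c : G) \in X -> c = b \/ c = b'.
Hypothesis other : forall Y c c', Y \in P -> Y != X ->
  (inl c : G) \in Y -> (inl c' : G) \in Y -> c = c'.

Definition private : {set A} := [set a | inc b a && ~~ inc b' a].

Lemma card_private : d <= #|private|.+1.
Proof.
apply: leq_trans (deg b) _.
rewrite (_ : [set a | inc b a] = private :|: [set a | inc b a && inc b' a]); last first.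
  by apply/setP=> a; rewrite !inE -andb_orr orNb andbT.
apply: leq_trans (leq_card_setU _ _) _; rewrite -addn1 leq_add2l.
apply/card_le1_eqP=> a a'; rewrite !inE => /andP[h1 h2] /andP[h3 h4].
exact: (linear neb).
Qed.

Let block (x : G) := pblock P x.

Lemma blockP x : block x \in P /\ x \in block x.
Proof.
case/and3P: partP => /eqP cov tr _.
by rewrite pblock_mem ?mem_pblock cov inE.
Qed.

Lemma block_eq Y x : Y \in P -> x \in Y -> block x = Y.
Proof. by case/and3P: partP => _ tr _; apply: def_pblock. Qed.

(** The other ends are neither [b] nor [b'], so they lie outside [X], where a part holds at most one
    element of [B]; and equal other ends mean equal [a] by linearity. *)
Lemma oth_block_inj a a' : a \in private -> a' \in private ->
  block (inl (oth b a)) = block (inl (oth b a')) -> a = a'.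
Proof.
rewrite !inE => /andP[ia na] /andP[ia' na'] e.
have [n1 i1] := othP ia; have [n2 i2] := othP ia'.
have [m1 m1'] := blockP (inl (oth b a)); have [m2 m2'] := blockP (inl (oth b a')).
suff ec : oth b a = oth b a'.
  by apply: (linear (b := b) (b' := oth b a)) => //; rewrite 1?eq_sym // ec.
apply: (other m1 _ m1'); last by rewrite e.
apply: contraTneq m1' => ->; apply/negP=> /onlyX[] h; first by rewrite h eqxx in n1.
by rewrite h (negbTE na) in i1.
Qed.

Lemma fiber_bound (F : {set A}) n (Z : {set {set G}}) : F \subset private ->
  #|Z| <= n -> (1 < #|F| -> forall a, a \in F -> block (inl (oth b a)) \in Z) ->
  #|F| <= n.+1.
Proof.
move=> sF hZ h; case: (leqP #|F| 1) => [/leq_trans->//|F1].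
apply: leqW; apply: leq_trans hZ.
rewrite -(card_in_imset (f := fun a => block (inl (oth b a)))).
  by apply: subset_leq_card; apply/subsetP=> _ /imsetP[a aF ->]; apply: h.
by move=> a a' aF a'F; apply: oth_block_inj; apply: (subsetP sF).
Qed.

(** A private [a] distinguishes [b] from [b'], so its part is [X] or an error neighbour of [X],
    giving at most [k.+1] parts. If such a part [Y] contains two private elements, then for each
    private [a] in it the other end of [a] is non-adjacent to [a] and adjacent to a second one; so
    the parts of these ends, all different, are [Y] or error neighbours of [Y]. *)
Lemma tww_at_collision k : error_degree P <= k -> d <= (k.+2 * k.+2).+1.
Proof.
move=> hk; apply: leq_trans card_private _; rewrite ltnS.
have err Y : Y \in P -> #|[set Z in P | (Z != Y) && non_homogeneous Y Z]| <= k.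
  by move=> YP; apply: leq_trans hk; apply: (bigmax_sup Y).
have errU Y : Y \in P -> #|Y |: [set Z in P | (Z != Y) && non_homogeneous Y Z]| <= k.+1.
  by move=> YP; apply: leq_trans (leq_card_setU _ _) _; rewrite cards1 add1n ltnS err.
apply: leq_trans (_ : k.+1 * k.+2 <= _); last by rewrite leq_mul2r leqnSn orbT.
apply: (@card_le_fibers _ _ _ (fun a : A => block (inr a))).
  apply: leq_trans (errU X XP); apply: subset_leq_card.
  apply/subsetP=> _ /imsetP[a ap ->]; move: ap; rewrite inE => /andP[ia na].
  have [m1 m2] := blockP (inr a).
  rewrite in_setU1; case: eqVneq => //= ne; rewrite inE m1 ne /=; apply/andP; split.
    apply/existsP; exists (inl b'); rewrite b'X; apply/existsP; exists (inr a).
    by rewrite m2 /= na.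
  apply/existsP; exists (inl b); rewrite bX; apply/existsP; exists (inr a).
  by rewrite m2 /= ia.
move=> Y; set F := [set _ in _ | _].
case: (set_0Vmem F) => [->|[a0]]; first by rewrite cards0.
rewrite inE => /andP[_ /eqP eY].
have [YP _] := blockP (inr a0); rewrite eY in YP.
apply: fiber_bound (errU Y YP) _; first by apply/subsetP=> a; rewrite inE => /andP[].
move=> F1 a aF; have [m1 m2] := blockP (inl (oth b a)).
rewrite in_setU1; case: eqVneq => //= ne; rewrite inE m1 ne /=.
have inY x : x \in F -> (inr x : G) \in Y.
  by rewrite inE => /andP[_ /eqP <-]; have [] := blockP (inr x).
have [a2 a2F na2] : exists2 a2, a2 \in F & a2 != a.
  by case/card_gt1P: F1 => x [y [xF yF nxy]]; case: (eqVneq x a) nxy => [->|]; [exists y; rewrite // eq_sym|exists x].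
have : a \in private by move: aF; rewrite inE => /andP[].
rewrite inE => /andP[ia na]; have [n1 i1] := othP ia.
have ia2 : inc b a2 by move: a2F; rewrite !inE => /andP[/andP[]].
apply/andP; split.
  apply/existsP; exists (inr a2); rewrite inY //; apply/existsP.
  exists (inl (oth b a)); rewrite m2 /=; apply: contra na2 => i2.
  by apply/eqP; apply: (linear (b := oth b a) (b' := b)).
apply/existsP; exists (inr a); rewrite inY //; apply/existsP.
by exists (inl (oth b a)); rewrite m2 /= i1.
Qed.

(** As [b] and [b'] now share a part, each private [a] must already be resolved with one of them,
    say [c]. So its part is reachable from [c] in one step. If two such elements share a part, the
    other end of either one distinguishes them and is resolved with one of the two, hence lies
    within distance 2 of [c]. Counting parts of other ends bounds each class, and the factor 2
    accounts for the choice of [c]. *)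
Lemma mw_at_collision k (s : mw_state G) : mw_part s = P ->
  (forall v : G, #|reachable_parts 2 s v| <= k) ->
  (forall x y z : G, block y = block z -> x != y -> x != z ->
     [set x; y] \notin mw_R s -> [set x; z] \notin mw_R s -> adj x y = adj x z) ->
  d <= (2 * (k * k.+1)).+1.
Proof.
move=> sP hk res; apply: leq_trans card_private _; rewrite ltnS.
pose D c := [set a in private | [set inl c; inr a] \in mw_R s].
have cover_private : private \subset D b :|: D b'.
  apply/subsetP=> a ap; move: (ap); rewrite inE => /andP[ia na].
  rewrite in_setU ![_ \in [set _ in _ | _]]in_set ap /=.
  apply/negPn/negP; rewrite negb_or => /andP[h1 h2].
  have := res (inr a) (inl b) (inl b'); rewrite /= ia (negbTE na) => /(_ _ isT isT).
  rewrite ![[set inr a; _]]setUC => /(_ _ h1 h2).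
  by rewrite !(block_eq XP) // => /(_ erefl).
have near_b c Y x : Y \in P -> x \in Y ->
    (dist_le (fun y z : G => [set y; z] \in mw_R s) 2 (inl c) x) ->
    Y \in reachable_parts 2 s (inl c).
  by move=> YP xY h; rewrite inE sP YP; apply/existsP; exists x; rewrite xY.
have boundD c : #|D c| <= k * k.+1.
  apply: (@card_le_fibers _ _ _ (fun a : A => block (inr a))).
    apply: leq_trans (hk (inl c)); apply: subset_leq_card.
    apply/subsetP=> _ /imsetP[a ap ->]; move: ap; rewrite inE => /andP[_ ra].
    have [m1 m2] := blockP (inr a); apply: near_b m1 m2 _ => /=.
    by apply/existsP; exists (inr a); rewrite ra eqxx.
  move=> Y; set F := [set _ in _ | _].
  apply: fiber_bound (hk (inl c)) _.
    by apply/subsetP=> a; rewrite !inE => /andP[/andP[]].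
  move=> F1 a aF.
  have [m1 m2] := blockP (inl (oth b a)); apply: near_b m1 m2 _ => /=.
  have [a2 a2F na2] : exists2 a2, a2 \in F & a2 != a.
    by case/card_gt1P: F1 => x [y [xF yF nxy]]; case: (eqVneq x a) nxy => [->|]; [exists y; rewrite // eq_sym|exists x].
  have inF x : x \in F -> [/\ inc b x, ~~ inc b' x, [set inl c; inr x] \in mw_R s & block (inr x) = Y].
    by rewrite !inE => /andP[/andP[/andP[-> ->] ->] /eqP ->].
  have [ia na ra ea] := inF _ aF; have [ia2 _ ra2 ea2] := inF _ a2F.
  have [n1 i1] := othP ia.
  have ni2 : ~~ inc (oth b a) a2.
    by apply: contra na2 => i2; apply/eqP; apply: (linear (b := oth b a) (b' := b)).
  suff [x rx cx] : exists2 x, [set inl c; inr x] \in mw_R s &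
      [set inr x; inl (oth b a)] \in mw_R s.
    by apply/orP; right; apply/existsP; exists (inr x); rewrite rx /=; apply/existsP; exists (inl (oth b a)); rewrite cx eqxx.
  case: (boolP ([set inr a; inl (oth b a)] \in mw_R s)) => h1; first by exists a.
  case: (boolP ([set inr a2; inl (oth b a)] \in mw_R s)) => h2; first by exists a2.
  have := res (inl (oth b a)) (inr a) (inr a2); rewrite ea ea2 /= i1 ni2.
  by rewrite setUC in h1; rewrite setUC in h2; move/(_ erefl isT isT h1 h2).
apply: leq_trans (subset_leq_card cover_private) _.
by apply: leq_trans (leq_card_setU _ _) _; rewrite mul2n -addnn leq_add.
Qed.

End AtCollision.

Lemma path_partition (P : {set {set G}}) s :
  path (fun P Q => merge_step P Q || (P == Q)) P s -> partition P setT ->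
  partition (last P s) setT.
Proof.
elim: s P => //= Q s IH P /andP[h ps] pP; apply: IH => //.
by case/orP: h => [/(merge_step_partition pP)//|/eqP <-].
Qed.

Theorem tww_flip k : tww G <= k -> d <= (k.+2 * k.+2).+1.
Proof.
rewrite /tww; case: ex_minnP => w /boolp.asboolP[s /andP[ps /eqP ls] ws] _ wk.
have [] := first_true ps collision_singletons.
  by rewrite ls collision_one_block.
move=> s1 [Q [s2 [es nc cQ]]].
move: ps; rewrite es cat_path /= => /and3P[p1 st _].
have hP : partition (last (singletons G) s1) setT.
  apply: path_partition (partition_singletons G).
  by apply: sub_path p1 => X Y ->.
have [X [b [b' [[XQ ne] bX b'X o1 o2]]]] := first_collision nc st cQ.
apply: (tww_at_collision (merge_step_partition hP st) XQ ne bX b'X o1 o2).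
apply: leq_trans wk; rewrite -ws /contraction_width.
by apply: (bigmaxn_sup_seq Q) => //; rewrite es inE mem_cat mem_head !orbT.
Qed.

Definition same_parts (s : mw_state G) (y z : G) : Prop :=
  forall Z, Z \in mw_part s -> (y \in Z) = (z \in Z).

Lemma mem_pairs_between (X Y : {set G}) x y : x != y ->
  ([set x; y] \in pairs_between X Y) = (x \in X) && (y \in Y) || (y \in X) && (x \in Y).
Proof.
move=> ne; apply/imsetP/idP=> [[[u v]]|].
  rewrite inE /= => /and3P[uX vY uv] e.
  have : u \in [set x; y] by rewrite e set21.
  have : v \in [set x; y] by rewrite e set22.
  rewrite !inE => /orP[] /eqP ev /orP[] /eqP eu; subst u v; rewrite ?eqxx // in uv *.
  - by rewrite uX vY orbT.
  - by rewrite uX vY.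
case/orP=> /andP[h1 h2]; first by exists (x, y); rewrite // inE /= h1 h2.
by exists (y, x); rewrite ?inE /= ?h1 ?h2 1?eq_sym // setUC.
Qed.

(** Once [y] and [z] share a part, every later step treats the pairs [xy] and [xz] alike. *)
Lemma unresolved_path (s : mw_state G) l x y z : path (@mw_step G) s l ->
  x != y -> x != z -> same_parts s y z ->
  ([set x; y] \in mw_E s) = ([set x; z] \in mw_E s) ->
  ([set x; y] \in mw_N s) = ([set x; z] \in mw_N s) ->
  ([set x; y] \in mw_E (last s l)) = ([set x; z] \in mw_E (last s l)).
Proof.
move=> + xy xz; elim: l s => //= t l IH s /andP[st pl] sp eE eN.
apply: IH => //.
- case/or3P: st => [/and3P[/existsP[X /andP[XP /existsP[Y /and3P[YP ne /eqP e]]]] _ _]||].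
  + by move=> Z; rewrite e !inE => /orP[/eqP ->|/and3P[_ _ /sp//]]; rewrite !inE !sp.
  + by case/existsP=> X /andP[_ /existsP[Y /andP[_ /and3P[/eqP e _ _]]]] Z; rewrite e; apply: sp.
  + by case/existsP=> X /andP[_ /existsP[Y /andP[_ /and3P[/eqP e _ _]]]] Z; rewrite e; apply: sp.
- case/or3P: st => [/and3P[_ /eqP -> _]//||].
    case/existsP=> X /andP[XP /existsP[Y /andP[YP /and3P[_ /eqP -> _]]]].
    by rewrite !inE !mem_pairs_between // eE eN !(sp _ XP) !(sp _ YP).
  by case/existsP=> X /andP[XP /existsP[Y /andP[YP /and3P[_ /eqP -> _]]]].
- case/or3P: st => [/and3P[_ _ /eqP ->]//||].
    by case/existsP=> X /andP[XP /existsP[Y /andP[YP /and3P[_ _ /eqP ->]]]].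
  case/existsP=> X /andP[XP /existsP[Y /andP[YP /and3P[_ _ /eqP ->]]]].
  by rewrite !inE !mem_pairs_between // eE eN !(sp _ XP) !(sp _ YP).
Qed.

Theorem mw_flip k : mw 2 G <= k -> d <= (2 * (k * k.+1)).+1.
Proof.
rewrite /mw; case: ex_minnP => w /boolp.asboolP[l /andP[pl fin] wl] _ wk.
have fin' := fin; case/and3P: fin' => /eqP fP _ /eqP fE.
have [] := @first_true _ _ (fun s => collision (mw_part s)) _ _ pl.
- exact: collision_singletons.
- by rewrite fP collision_one_block.
move=> s1 [t [s2 [es nc ct]]].
move: pl fE; rewrite es cat_path last_cat /= => /and3P[p1 st p2] fE.
(* A resolution keeps the partition and cannot create the first collision. *)
have st' : merge_step (mw_part (last (mw_init G) s1)) (mw_part t).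
  case/or3P: st => [/and3P[]//||] /existsP[X /andP[_ /existsP[Y /andP[_ /and3P[/eqP e _ _]]]]];
  by rewrite e (negbTE nc) in ct.
have hP : partition (mw_part (last (mw_init G) s1)) setT.
  have -> : mw_part (last (mw_init G) s1) = last (mw_part (mw_init G)) (map (@mw_part G) s1).
    by rewrite last_map.
  apply: path_partition (partition_singletons G).
  have := @path_map _ _ (@mw_part G) (fun P Q => merge_step P Q || (P == Q)) (mw_init G) s1.
  rewrite /= => ->.
  apply: sub_path p1 => X Y /or3P[/and3P[h _ _]||]; first by rewrite /= h.
    by case/existsP=> ? /andP[_ /existsP[? /andP[_ /and3P[/eqP e _ _]]]]; rewrite /= e eqxx orbT.
  by case/existsP=> ? /andP[_ /existsP[? /andP[_ /and3P[/eqP e _ _]]]]; rewrite /= e eqxx orbT.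
have pQ := merge_step_partition hP st'.
have [X [b [b' [[XQ ne] bX b'X o1 o2]]]] := first_collision nc st' ct.
apply: (mw_at_collision pQ XQ ne bX b'X o1 o2 erefl).
  move=> v; apply: leq_trans wk; rewrite -wl /construction_width.
  rewrite es big_cons big_cat big_cons /= !leq_max; apply/or4P; apply: Or43.
  exact: (bigmax_sup v).
move=> x y z exy nxy nxz; rewrite !inE !negb_or => /andP[ey ny] /andP[ez nz].
rewrite -!mem_edges -fE; apply: unresolved_path p2 _ _ _ _ _ => //.
- move=> Z ZP; case/and3P: pQ => /eqP cov tr _.
  have h u : (u \in Z) = (pblock (mw_part t) u == Z).
    by apply/idP/eqP => [uZ|<-]; [apply: def_pblock|rewrite mem_pblock cov inE].
  by rewrite !h exy.
- by rewrite (negbTE ey) (negbTE ez).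
- by rewrite (negbTE ny) (negbTE nz).
Qed.

End LowerBounds.

From mathcomp Require Import all_fingroup.

(** * Regular bipartite graphs of large girth *)

Section Cayley.
Variable n : nat.

Definition reduced (w : seq 'I_n) : bool := sorted (fun i j => i != j) w.

(** The ball of radius [n] in the [n]-regular tree, that is, in the Cayley graph of the free product
    of [n] groups of order two. *)
Definition word := {w : n.-bseq 'I_n | reduced w}.

(** Multiplication by an involutive generator, truncated to the identity where it would leave the
    ball. It remains an involution, so it is a permutation of the words. *)
Definition push (i : 'I_n) (w : seq 'I_n) : seq 'I_n :=
  if ohead w == Some i then behead w else if size w < n then i :: w else w.

Lemma size_push i w : size w <= n -> size (push i w) <= n.
Proof.
rewrite /push => h; case: ifP => _; last by case: ifP.
by apply: leq_trans h; rewrite size_behead leq_pred.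
Qed.

Lemma reduced_push i w : reduced w -> reduced (push i w).
Proof.
rewrite /push; case: w => [|j w] /=; first by case: ifP.
case: eqP => [_|/eqP ne] h; first exact: path_sorted h.
case: ifP => // _; rewrite /= h andbT.
by apply: contraNneq ne => ->.
Qed.

Lemma pushK i w : reduced w -> size w <= n -> push i (push i w) = w.
Proof.
rewrite {2}/push; case: w => [|j w] /=.
  by move=> _ _; case: ifP => h; rewrite /push /= ?eqxx // h.
case: eqP => [[ej] pw sw|/eqP ne pw sw].
  rewrite ej in pw *; rewrite /push sw; case: w pw {sw} => [|k w] //= /andP[ik _].
  by case: eqP => // -[] e; rewrite e eqxx in ik.
case: ifP => h; first by rewrite /push /= eqxx.
by rewrite /push /= (negbTE ne) h.
Qed.

Definition pushw (i : 'I_n) (w : word) : word :=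
  exist _ (Bseq (size_push i (size_bseq (sval w)))) (reduced_push i (svalP w)).

Lemma pushwK i : involutive (pushw i).
Proof.
by move=> w; do 2!apply: val_inj => /=; rewrite pushK ?(svalP w) ?size_bseq.
Qed.

Definition gen i : {perm word} := perm (can_inj (pushwK i)).

Lemma genK i : (gen i * gen i = 1)%g.
Proof. by apply/permP=> w; rewrite permM perm1 !permE pushwK. Qed.

Lemma genKg i (s : {perm word}) : (gen i * (gen i * s) = s)%g.
Proof. by rewrite mulgA genK mul1g. Qed.

Definition empty_word : word := exist (fun w : n.-bseq 'I_n => reduced w) [bseq] isT.

Definition spell (c : seq 'I_n) : word := foldr (fun i w => gen i w) empty_word c.

Lemma spellE c : reduced c -> size c <= n -> sval (spell c) = c :> seq 'I_n.
Proof.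
elim: c => //= i c IH hc sc; have e := IH (path_sorted hc) (ltnW sc).
rewrite permE /= e /push sc; case: c hc {IH sc e} => [|j c] //= /andP[ij _].
by case: eqP => // -[] e; rewrite e eqxx in ij.
Qed.

(** All permutations of the words are used, whose number is easy to bound, in two copies that form
    the sides of the bipartition. The edge [(s, i)] joins [s] in one copy to [gen i * s] in the
    other. *)
Definition bvert := (bool * {perm word})%type.
Definition avert := ({perm word} * 'I_n)%type.

Definition endpoint (t : bool) (a : avert) : {perm word} :=
  if t then (gen a.2 * a.1)%g else a.1.

Definition incident (b : bvert) (a : avert) : bool := b.2 == endpoint b.1 a.

Definition girth_graph : sgraph := flip_graph incident.

Definition inc_rel (x y : bvert + avert) : bool :=
  match x, y with
  | inl b, inr a | inr a, inl b => incident b a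
  | _, _ => false
  end.

Lemma endpointN t a : endpoint (~~ t) a = (gen a.2 * endpoint t a)%g.
Proof. by case: t => //=; rewrite genKg. Qed.

Lemma endpoint_inj t a a' : endpoint t a = endpoint t a' -> a.2 = a'.2 -> a = a'.
Proof.
by case: a a' => [s i] [s' i'] + /= e; rewrite -e; case: t => /=; [move/mulgI ->|move->].
Qed.

(** Each pair of steps crosses one edge and multiplies by its generator. Two consecutive edges with
    the same generator would be the same edge, so the word spelled is reduced. *)
Lemma walk_word t s w b' : walk inc_rel (inl (t, s) :: w) -> last (inl (t, s)) w = inl b' ->
  exists c, [/\ reduced c, size w = (size c).*2,
    b'.2 = foldl (fun u i => gen i * u)%g s c &
    if w is inr a :: _ then ohead c = Some a.2 else c = [::]].
Proof.
have [m] := ubnP (size w); elim: m t s w => // m IH t s w; rewrite ltnS => sw.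
case: w sw => [|[//|a] [|[b|a'] w]] sw; first by move=> _ [<-]; exists [::].
- by [].
2: by rewrite !walk_cons => /and3P[_ _ /andP[]].
rewrite !walk_cons => /and3P[i1 ne /and3P[i2 hw wk]] hl.
have e1 : s = endpoint t a by apply/eqP.
have [et es] : b.1 = ~~ t /\ b.2 = (gen a.2 * s)%g.
  have et : b.1 = ~~ t.
    apply/eqP; apply: contraNT ne => h; have bt : b.1 = t by move: h; case: (b.1); case: (t).
    by rewrite (surjective_pairing b) bt (eqP i2) bt -e1.
  by split=> //; rewrite (eqP i2) et endpointN -e1.
have wk' := wk; have hl' := hl; rewrite (surjective_pairing b) in wk' hl'.
have [|c [rc sc ec hc]] := IH _ _ _ _ wk' hl'; first by apply: leq_trans sw; rewrite /= ltnW.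
exists (a.2 :: c); split=> //.
- rewrite /reduced /=; case: c rc hc {sc ec} => [|j c] rc hc //=.
  rewrite /reduced /= in rc; rewrite rc andbT.
  case: w hc hw wk {sw hl wk' hl'} => [|[//|a'] w] // [ej] nea; rewrite {}ej.
  case: w => [|y w]; rewrite walk_cons => /and3P[i3 _ _]; apply: contraNneq nea => e;
  by apply/eqP; congr inr; apply: (@endpoint_inj b.1) => //; rewrite -(eqP i2) -(eqP i3).
- by rewrite /= sc doubleS.
- by rewrite /= ec es.
Qed.

Lemma foldl_gen (s : {perm word}) c x :
  foldl (fun u i => gen i * u)%g s c x = s (foldr (fun i w => gen i w) x c).
Proof. by elim: c s => //= i c IH s; rewrite IH permM. Qed.

(** A closed walk makes a product of generators the identity, yet applied to the empty word it
    yields the spelled word itself, which is non-empty and short enough to stay in the ball. *)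
Lemma no_closed_walk_b b w : walk inc_rel (inl b :: w) -> 0 < size w <= n ->
  last (inl b) w != inl b.
Proof.
case: b => t s hw /andP[w0 wn]; apply/eqP=> hl.
have [c [rc sc ec _]] := walk_word hw hl.
have cn : size c <= n by apply: leq_trans wn; rewrite sc -addnn leq_addr.
have : spell c = empty_word.
  by apply: (@perm_inj _ s); rewrite -foldl_gen -ec.
move/(congr1 (fun w : word => sval w : seq 'I_n)); rewrite spellE // => c0.
by rewrite sc c0 in w0.
Qed.

(** A closed walk from an edge [a] is either rotated to start at its last vertex [b'], or, if [b']
    equals the first vertex [b], it contains a shorter closed walk at [b]. *)
Lemma no_closed_walk x w : walk inc_rel (x :: w) -> 0 < size w <= n -> last x w != x.
Proof.
case: x => [b|a]; first exact: no_closed_walk_b.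
case: w => [//|[b|a'] w]; last by case: w.
case/lastP: w => [//|w y] hw; rewrite /= size_rcons last_rcons => wn.
apply/eqP=> ey; subst y.
have hw' : walk inc_rel [:: inr a, inl b & w] by apply: (@walk_belast _ _ _ (inr a)).
have wb : walk inc_rel (inl b :: w) by move: hw'; rewrite walk_cons => /and3P[].
have lastinc : inc_rel (last (inl b) w) (inr a).
  have : walk inc_rel (rcons (inl b :: w) (inr a)).
    by move: hw; rewrite rcons_cons walk_cons => /and3P[].
  elim: (w) (inl b : bvert + avert) => [|z v IH] x; first by rewrite /= andbT.
  by rewrite !rcons_cons walk_cons => /and3P[_ _ /IH].
case el: (last (inl b) w) lastinc => [b'|//] ib'.
case: (eqVneq b' b) => [eb|nb].
  have w0 : 0 < size w.
    by case: w hw {hw' wb el wn} => //; rewrite /= eqxx /= andbF.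
  have wn' : 0 < size w <= n by rewrite w0 (ltnW (ltnW wn)).
  by have := no_closed_walk_b wb wn'; rewrite el eb eqxx.
have : walk inc_rel [:: inl b', inr a, inl b & w].
  by rewrite walk_cons hw' andbT /=; apply/andP; split.
by move/no_closed_walk_b; rewrite /= el eqxx => /(_ wn).
Qed.

Lemma incident_le2 a : #|[set b | incident b a]| <= 2.
Proof.
have : [set b | incident b a] \subset [set (t, endpoint t a) | t : bool].
  apply/subsetP=> -[t s]; rewrite inE => /eqP /= ->; exact: imset_f.
by move/subset_leq_card/leq_trans; apply; apply: leq_trans (leq_imset_card _ _) _; rewrite card_bool.
Qed.

Lemma incident_side b b' a : incident b a -> incident b' a -> b.1 = b'.1 -> b = b'.
Proof. by case: b b' => [t s] [t' s'] /eqP /= -> /eqP /= -> ->. Qed.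

Lemma incident_degree b : n <= #|[set a | incident b a]|.
Proof.
case: b => t s; pose f i : avert := (if t then gen i * s else s, i)%g.
have fi : injective f by move=> i j [_ ->].
rewrite -[n in n <= _]card_ord -(card_imset _ fi); apply: subset_leq_card.
by apply/subsetP=> _ /imsetP[i _ ->]; rewrite inE /incident /f /endpoint; case: t {f fi}; rewrite /= ?genKg.
Qed.

Definition other_end (b : bvert) (a : avert) : bvert := (~~ b.1, endpoint (~~ b.1) a).

Lemma other_endP b a : incident b a -> other_end b a != b /\ incident (other_end b a) a.
Proof.
move=> _; split; last exact: eqxx.
by apply/eqP=> /(congr1 fst) /=; case: (b.1).
Qed.

(** There are no parallel edges: the two ends determine the generator, and different generators move
    the empty word differently. *)
Lemma incident_linear b b' a a' : b != b' ->
  incident b a -> incident b' a -> incident b a' -> incident b' a' -> a = a'.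
Proof.
move=> ne i1 i2 i3 i4.
have et : b'.1 = ~~ b.1.
  case: (eqVneq b'.1 b.1) => [e|]; last by case: (b'.1); case: (b.1).
  by rewrite (incident_side i1 i2) ?eqxx in ne.
have e2 : a.2 = a'.2.
  have : gen a.2 = gen a'.2.
    apply: (mulIg b.2); rewrite {1}(eqP i1) (eqP i3) -!endpointN -et.
    by rewrite -(eqP i2) -(eqP i4).
  move/permP/(_ empty_word)/(congr1 (fun w : word => sval w : seq 'I_n)).
  rewrite !permE /= /push /= (leq_ltn_trans _ (ltn_ord a.2)) //.
  by case.
by apply: (@endpoint_inj b.1) => //; rewrite -(eqP i1) -(eqP i3).
Qed.

Lemma card_girth_graph : #|girth_graph| <= n.+2 * (n.+1 ^ n.+1) ^ (n.+1 ^ n.+1).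
Proof.
set W := n.+1 ^ n.+1.
have cw : #|{: word}| <= W.
  apply: leq_trans (leq_card val val_inj) _; rewrite card_bseq card_ord.
  apply: leq_trans (_ : \sum_(i < n.+1) n.+1 ^ n <= _); last first.
    by rewrite sum_nat_const card_ord /W expnS.
  apply: leq_sum => i _; apply: leq_trans (_ : n.+1 ^ i <= _).
    by case: (val i) => // j; rewrite leq_exp2r.
  by rewrite leq_pexp2l // -ltnS.
have cp : #|{: {perm word}}| <= W ^ W.
  apply: leq_trans (leq_card val val_inj) _; rewrite card_ffun.
  have W0 : 0 < W by rewrite expn_gt0.
  apply: leq_trans (_ : W ^ #|{: word}| <= _); last by rewrite leq_pexp2l.
  by case: (#|{: word}|) cw => // m h; rewrite leq_exp2r.
rewrite card_sum !card_prod card_bool card_ord mulnC -mulnDr mulnC.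
by rewrite leq_mul // addnC.
Qed.

End Cayley.

(** * The class and its model checker *)

Lemma card_imset_factor (T U W : finType) (f : T -> U) (g : T -> W) (D : {set T}) :
  (forall x y, x \in D -> y \in D -> g x = g y -> f x = f y) -> #|f @: D| <= #|g @: D|.
Proof.
move=> h; case: (set_0Vmem D) => [->|[x0 x0D]]; first by rewrite !imset0 cards0.
pose k y := f (odflt x0 [pick x in D | g x == y]).
suff -> : f @: D = k @: (g @: D) by apply: leq_imset_card.
have kg x : x \in D -> k (g x) = f x.
  move=> xD; rewrite /k; case: pickP => [y /andP[yD /eqP e]|/(_ x)]; first exact: h.
  by rewrite xD eqxx.
apply/setP=> y; apply/imsetP/imsetP=> [[x xD ->]|[z /imsetP[x xD ->] ->]].
  by exists (g x); rewrite ?imset_f ?kg.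
by exists x; rewrite ?kg.
Qed.

Lemma sum_ord_card n (P : pred 'I_n) : \sum_(i < n) P i = #|[set i | P i]|.
Proof. by rewrite -sum1dep_card [RHS]big_mkcond; apply: eq_bigr => i _; case: (P i). Qed.

Lemma qrank_le k (phi : fo k) : qrank phi <= size (encode_fo phi).
Proof.
elim: k / phi => //= [k psi IH|k psi IH1 chi IH2]; first exact: leqW.
by rewrite size_cat geq_max; lia.
Qed.

Section Checking.
Variables (N n : nat) (adjN : rel 'I_N).
Hypotheses (adjN_sym : symmetric adjN) (adjN_irr : irreflexive adjN).
Let G : sgraph := SGraph adjN_sym adjN_irr.
Variable h : 'I_N -> girth_graph n.
Hypothesis h_inj : injective h.
Hypothesis h_adj : forall i j, adj (h i) (h j) = adjN i j.

Definition adj_nat (u v : nat) : bool :=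
  if insub u is Some i then if insub v is Some j then adjN i j else false else false.

Let A := adj_nat.

Lemma adj_natE (i j : 'I_N) : A i j = adjN i j.
Proof. by rewrite /A /adj_nat !valK. Qed.

Let isB i := if h i is inl _ then true else false.
Let Bset := [set i | isB i].

Lemma nnbE (i : 'I_N) : nnb N A i = #|[set x | (i != x) && ~~ adjN i x]|.
Proof.
by rewrite /nnb -sum_ord_card; apply: eq_bigr => x _; rewrite adj_natE.
Qed.

Lemma nnb_A i : ~~ isB i -> nnb N A i <= 2.
Proof.
rewrite nnbE /isB; case e: (h i) => [b|a] // _.
apply: leq_trans (incident_le2 a).
have {1}<- := card_imset (mem [set x | (i != x) && ~~ adjN i x]) h_inj.
rewrite -(card_imset (mem [set b | incident b a]) (@inl_inj _ (avert n))).
apply: subset_leq_card; apply/subsetP=> y /imsetP[x]; rewrite inE => /andP[ix nx] ->.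
move: nx; rewrite -h_adj e; case ex: (h x) => [b|a'] /=.
  by rewrite negbK => ib; apply: imset_f; rewrite inE.
by rewrite negbK => /eqP ea; case/eqP: ix; apply: h_inj; rewrite e ex ea.
Qed.

Lemma nnb_B i : isB i -> #|Bset| <= (nnb N A i).+1.
Proof.
move=> Bi; rewrite nnbE (cardsD1 i) inE Bi add1n ltnS; apply: subset_leq_card.
apply/subsetP=> x; rewrite !inE => /andP[xi Bx]; rewrite eq_sym xi /= -h_adj.
by move: Bi Bx; rewrite /isB; case: (h i) => // b _; case: (h x).
Qed.

Lemma modeE : mode N A = (3 < #|Bset|).
Proof.
have cnt : \sum_(x < N) (2 < nnb N A x) = #|[set x : 'I_N | 2 < nnb N A x]| by rewrite sum_ord_card.
rewrite /mode cnt; apply/idP/idP=> [h3|h3].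
  apply: leq_trans h3 _; apply: subset_leq_card; apply/subsetP=> x; rewrite !inE.
  by apply: contraTT => /nnb_A; rewrite -leqNgt.
apply: leq_trans (h3) _; apply: subset_leq_card; apply/subsetP=> x; rewrite !inE => Bx.
by rewrite -ltnS; apply: leq_trans h3 (nnb_B Bx).
Qed.

Lemma labn_mode (i : 'I_N) : mode N A -> labn N A i = ~~ isB i.
Proof.
move=> hm; rewrite /labn hm; congr nat_of_bool.
case: (boolP (isB i)) => Bi /=; last by rewrite ltnS nnb_A.
by apply/negbTE; rewrite -leqNgt -ltnS; apply: leq_trans (nnb_B Bi); rewrite -modeE.
Qed.

Let S (i j : 'I_N) := Sn N A i j.

Lemma S_mode i j : mode N A -> S i j = inc_rel (h i) (h j).
Proof.
move=> hm; rewrite /S /Sn hm !labn_mode // adj_natE -h_adj /isB /=.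
by case: (h i) => [b|a]; case: (h j) => [b'|a'] //=; rewrite negbK.
Qed.

Lemma S_nomode i j : ~~ mode N A -> S i j = false.
Proof. by rewrite /S /Sn => /negbTE ->. Qed.

Lemma S_symm : symmetric S.
Proof.
move=> i j; rewrite /S /Sn eq_sym; congr [&& _, _ & ~~ _].
by rewrite !adj_natE adjN_sym.
Qed.

Lemma S_no_cycle x s : walk S (x :: s) -> 0 < size s <= n -> last x s != x.
Proof.
case: (boolP (mode N A)) => hm; last first.
  by case: s => // y s; rewrite walk_cons S_nomode.
have hw t : walk S t -> walk (@inc_rel n) (map h t).
  elim: t => // y [|z t] IH //; rewrite !map_cons !walk_cons S_mode //.
  case/and3P=> -> hz /IH ->; rewrite andbT /=.
  by case: t hz {IH} => //= t0 t; rewrite (inj_eq h_inj).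
move=> /hw /no_closed_walk; rewrite size_map last_map => hh /hh.
by rewrite (inj_eq h_inj).
Qed.

Lemma twinbP (u v : 'I_N) : reflect (forall x, x != u -> x != v -> adjN u x = adjN v x)
  (twinb N A u v).
Proof.
rewrite /twinb sum_nat_eq0; apply: (iffP forallP) => [hh x xu xv|hh x].
  have := hh x; rewrite nat_of_bool_eq0 /= -!val_eqE in xu xv *.
  by rewrite xu xv /= negbK !adj_natE => /eqP.
rewrite nat_of_bool_eq0 /= !val_eqE; case: (boolP (x == u)) => //= xu.
by case: (boolP (x == v)) => //= xv; rewrite !adj_natE hh ?eqxx.
Qed.

(** Twins agree only on third vertices, so the exchange passes through [u'v] and the case where [v]
    equals [u'] needs its own route. *)
Lemma twin_adj (u v u' v' : 'I_N) : u != v -> u' != v' ->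
  twinb N A u u' -> twinb N A v v' -> adjN u v = adjN u' v'.
Proof.
move=> uv uv' /twinbP tu /twinbP tv.
case: (eqVneq v u') => [e|nv].
  move: tv uv; rewrite {}e => tv uv.
  case: (eqVneq u v') => [<-|nu]; first exact: adjN_sym.
  rewrite (adjN_sym u u') (tv u uv nu) (adjN_sym v' u) (tu v') //; by rewrite eq_sym.
have vu : v != u by rewrite eq_sym.
have u'v : u' != v by rewrite eq_sym.
by rewrite (tu v vu nv) (adjN_sym u' v) (tv u' u'v uv') (adjN_sym v' u').
Qed.

Lemma twin_rel (x y z : 'I_N) : twinb N A x y -> twinb N A z y = twinb N A z x.
Proof.
have sym (a b : 'I_N) : twinb N A a b -> twinb N A b a.
  by move/twinbP=> t; apply/twinbP=> c ca cb; rewrite t.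
have trans (a b c : 'I_N) : twinb N A a b -> twinb N A b c -> twinb N A a c.
  move=> tab tbc; apply/twinbP=> d da dc.
  case: (eqVneq d b) => [e|db]; last by rewrite (twinbP _ _ tab) // (twinbP _ _ tbc).
  move: da dc; rewrite {}e => ba bc.
  case: (eqVneq a c) => [->//|ac].
  have ab : a != b by rewrite eq_sym.
  have ca : c != a by rewrite eq_sym.
  have cb : c != b by rewrite eq_sym.
  rewrite (adjN_sym a b) (twinbP _ _ tbc a ab ac) (adjN_sym c a).
  by rewrite (twinbP _ _ tab c ca cb) (adjN_sym b c).
by move=> txy; apply/idP/idP=> t; [apply: trans t (sym _ _ txy)|apply: trans t txy].
Qed.

Lemma labn_twin (u v : 'I_N) : ~~ mode N A -> (labn N A u == labn N A v) = twinb N A u v.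
Proof.
move=> /negbTE hm; rewrite /labn hm.
apply: (least_rel (r := twinb N A)) => // [x xN|x y z xN yN zN].
  by apply/(twinbP (Ordinal xN) (Ordinal xN)).
exact: (@twin_rel (Ordinal xN) (Ordinal yN) (Ordinal zN)).
Qed.

Let labs := undup [seq labn N A i | i : 'I_N].

(** In [mode] there are two labels. Otherwise at most three vertices come from [B], and a vertex
    from [A] is determined up to twins by its non-neighbours among these, which gives [3 + 8]
    labels. *)
Lemma size_labs : size labs <= 16.
Proof.
have hN (i : 'I_N) : labn N A i < N.+2.
  rewrite /labn; case: mode; first by case: (_ < 3).
  rewrite leastE ltnS; apply: leqW.
  by have := find_size (twinb N A ^~ i) (iota 0 N); rewrite size_iota.
pose f i : 'I_N.+2 := Ordinal (hN i).
have -> : size labs = #|f @: setT|.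
  rewrite cardE -(size_map val); apply/perm_size/uniq_perm.
  - exact: undup_uniq.
  - by rewrite map_inj_uniq ?enum_uniq //; exact: val_inj.
  move=> y; rewrite mem_undup; apply/mapP/mapP=> [[i _ ->]|[z]].
    by exists (f i); rewrite // mem_enum imset_f.
  by rewrite mem_enum => /imsetP[i _ ->] ->; exists i; rewrite ?mem_enum.
have fE i j : (f i == f j) = (labn N A i == labn N A j) by [].
case: (boolP (mode N A)) => hm.
  apply: leq_trans (_ : #|isB @: setT| <= _).
    by apply: card_imset_factor => i j _ _ e; apply/eqP; rewrite fE !labn_mode // e.
  by apply: leq_trans (max_card _) _; rewrite card_bool.
have B3 : #|Bset| <= 3 by rewrite modeE -leqNgt in hm.
rewrite (_ : setT = Bset :|: ~: Bset); last by rewrite setUCr.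
rewrite imsetU; apply: leq_trans (leq_card_setU _ _) _.
apply: (@leq_trans (3 + 8)) => //; apply: leq_add; first exact: leq_trans (leq_imset_card _ _) B3.
pose g i := [set x in Bset | ~~ adjN i x].
apply: leq_trans (_ : #|g @: ~: Bset| <= _).
  apply: card_imset_factor => i j; rewrite !inE => Bi Bj e; apply/eqP.
  rewrite fE labn_twin //; apply/twinbP=> x xi xj.
  case: (boolP (isB x)) => Bx.
    have /setP/(_ x) := e; rewrite !inE Bx /= => /(congr1 negb).
    by rewrite !negbK.
  move: Bi Bj Bx; rewrite -!h_adj /isB.
  case ei: (h i) => [|a] //; case ej: (h j) => [|a'] //; case ex: (h x) => [|a''] // _ _ _ /=.
  have ne k a0 : h k = inr a0 -> x != k -> a0 != a''.
    by move=> ek xk; apply: contra xk => /eqP ea; apply/eqP; apply: h_inj; rewrite ex ek ea.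
  by rewrite (ne i) // (ne j).
apply: leq_trans (_ : #|powerset Bset| <= _).
  by apply: subset_leq_card; apply/subsetP=> _ /imsetP[i _ ->]; rewrite inE; apply/subsetP=> x; rewrite inE => /andP[].
by rewrite card_powerset (leq_pexp2l (m := 2) _ B3).
Qed.

(** Renumbering puts the labels into a type that is independent of the graph, so that the number of
    colours is too. *)
Let lab (i : 'I_N) : 'I_16 := inord (index (labn N A i) labs).

Lemma labE i j : (lab i == lab j) = (labn N A i == labn N A j).
Proof.
have mem (k : 'I_N) : labn N A k \in labs.
  by rewrite mem_undup; apply/mapP; exists k; rewrite // mem_enum.
apply/eqP/eqP=> [/(congr1 (@nat_of_ord _))|e]; last by rewrite /lab e.
have lt (k : 'I_N) : index (labn N A k) labs < 16 by apply: leq_trans size_labs; rewrite index_mem.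
rewrite !inordK // => e.
by rewrite -(nth_index 0 (mem i)) e nth_index.
Qed.

Lemma lab_adj (u v u' v' : G) : u != v -> u' != v' ->
  lab u = lab u' -> lab v = lab v' -> S u v = S u' v' -> adj u v = adj u' v'.
Proof.
move=> uv uv' /eqP lu /eqP lv; rewrite !labE in lu lv.
case: (boolP (mode N A)) => hm; last first.
  by move=> _; apply: twin_adj => //; rewrite -labn_twin.
rewrite !S_mode //=; move: lu lv; rewrite !labn_mode // -!h_adj /isB.
have ne k l a a' : h k = inr a -> h l = inr a' -> k != l -> a != a'.
  by move=> ek el kl; apply: contra kl => /eqP ea; apply/eqP; apply: h_inj; rewrite ek el ea.
case eu: (h u) => [?|?]; case eu': (h u') => [?|?] // _;
case ev: (h v) => [?|?]; case ev': (h v') => [?|?] // _ /= e; rewrite ?e //.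
by rewrite (ne u v) // (ne u' v').
Qed.

Section Classes.
Variables (T k : nat) (ps : k.-tuple 'I_N).
Let pn : seq nat := map val ps.

Lemma same0E (u v : 'I_N) : same0 N A pn u v = (col S lab T ps 0 u == col S lab T ps 0 v).
Proof.
rewrite /same0 -labE /= xpair_eqE; congr (_ && _).
rewrite -val_eqE /= /pn all_map; apply/allP/eqP=> [hh|e p pp].
  by apply/eq_in_map => p pp; have := hh p pp; rewrite /= !val_eqE ![_ == p]eq_sym => /eqP.
have /eq_in_map := e => /(_ p pp); rewrite /= !val_eqE ![p == _]eq_sym => ->.
exact: eqxx.
Qed.

Lemma cl_lt l (u : 'I_N) : cl N T A pn l u < N.
Proof.
have lt (r : rel nat) : r u u -> least N (r^~ u) < N.
  move=> ru; have : has (r^~ u) (iota 0 N).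
    by apply/hasP; exists (val u); rewrite ?mem_iota ?ltn_ord.
  by rewrite has_find size_iota leastE.
case: l => [|l] /=; apply: lt; first by rewrite same0E.
by rewrite /sameS eqxx /=; apply/eqP/big1 => y _; rewrite eqxx.
Qed.

(** The program counts over names of classes, the theory over abstract colours. Names and colours of
    existing vertices correspond by hypothesis; the remaining names and colours have count 0 on both
    sides. *)
Lemma sameS_col l : (forall u v : 'I_N,
    (cl N T A pn l u == cl N T A pn l v) = (col S lab T ps l u == col S lab T ps l v)) ->
  forall a b : 'I_N, sameS N T A (cl N T A pn l) a b =
    (col S lab T ps l.+1 a == col S lab T ps l.+1 b).
Proof.
move=> IH a b.
pose cnt (a : 'I_N) c := #|[set x in [set x | S a x] | col S lab T ps l x == c]|.
have cntE (a0 x0 : 'I_N) :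
    count_col N A (cl N T A pn l) a0 (cl N T A pn l x0) = cnt a0 (col S lab T ps l x0).
  rewrite /count_col /cnt sum_ord_card; apply: eq_card => x.
  by rewrite !inE IH.
apply/andP/eqP=> [[e0 e1]|/colS[e0 e1]].
  apply/colS; split; first by apply/eqP; rewrite -IH.
  move=> c; case: (pickP (fun x => col S lab T ps l x == c)) => [x0 /eqP <-|no].
    rewrite -!/(cnt _ _) -!cntE; move: e1; rewrite sum_nat_eq0.
    by move=> /forallP/(_ (Ordinal (cl_lt l x0))); rewrite /= nat_of_bool_eq0 negbK => /eqP.
  have z a0 : [set x in [set x | S a0 x] | col S lab T ps l x == c] = set0.
    by apply/setP=> x; rewrite !inE no andbF.
  by rewrite !z.
split; first by rewrite IH e0.
rewrite sum_nat_eq0; apply/forallP=> y; rewrite nat_of_bool_eq0 negbK /=.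
case: (pickP (fun x : 'I_N => cl N T A pn l x == y)) => [x0 /eqP <-|no].
  by rewrite !cntE; apply/eqP; exact: e1.
by rewrite /count_col !big1 // => x _; rewrite no andbF.
Qed.

Lemma clE l (u v : 'I_N) :
  (cl N T A pn l u == cl N T A pn l v) = (col S lab T ps l u == col S lab T ps l v).
Proof.
elim: l u v => [|l IH] u v.
  rewrite -same0E; apply: (least_rel (r := same0 N A pn)) => // [x xN|x y z xN yN zN].
    by rewrite (@same0E (Ordinal xN) (Ordinal xN)).
  rewrite (@same0E (Ordinal xN) (Ordinal yN)) (@same0E (Ordinal zN) (Ordinal yN)).
  by rewrite (@same0E (Ordinal zN) (Ordinal xN)) => /eqP ->.
have key := sameS_col IH.
rewrite -key; apply: (least_rel (r := sameS N T A (cl N T A pn l))) => // [x xN|x y z xN yN zN].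
  by rewrite (key (Ordinal xN) (Ordinal xN)).
rewrite (key (Ordinal xN) (Ordinal yN)) (key (Ordinal zN) (Ordinal yN)).
by rewrite (key (Ordinal zN) (Ordinal xN)) => /eqP ->.
Qed.

Lemma cl_rep l (u : 'I_N) : let v := Ordinal (cl_lt l u) in
  cl N T A pn l v = v /\ col S lab T ps l v = col S lab T ps l u.
Proof.
have lt (r : rel nat) : r u u -> r (least N (r^~ u)) u.
  move=> ru; have hs : has (r^~ u) (iota 0 N).
    by apply/hasP; exists (val u); rewrite ?mem_iota ?ltn_ord.
  have := nth_find 0 hs; rewrite nth_iota ?add0n ?leastE //.
  by move: hs; rewrite has_find size_iota.
have e : cl N T A pn l (Ordinal (cl_lt l u)) = cl N T A pn l u.
  apply/eqP; case: l => [|l]; rewrite clE.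
    by rewrite -same0E /=; apply: lt; rewrite same0E.
  rewrite -(sameS_col (clE l)); apply: (lt (sameS N T A (cl N T A pn l))).
  by rewrite (sameS_col (clE l)).
split; first by rewrite e.
by apply/eqP; rewrite -clE e.
Qed.

End Classes.

Variable L : nat.
Let K := kparam L.
Let M := mparam L.

Lemma small_or_large : N <= M \/ K <= n.
Proof.
have le2 a b c d : a <= b -> c <= d -> 0 < b -> a ^ c <= b ^ d.
  move=> ab cd b0; apply: leq_trans (_ : b ^ c <= _); last by rewrite leq_pexp2l.
  by case: c {cd} => // c; rewrite leq_exp2r.
have K0 : 0 < K by rewrite expn_gt0.
have Q0 : 0 < qparam L by rewrite expn_gt0 K0.
case: (leqP K n) => [|nK]; [by right|left].
have : #|'I_N| <= #|girth_graph n| by apply: leq_card h_inj.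
rewrite card_ord => /leq_trans; apply; apply: leq_trans (card_girth_graph n) _.
have WQ : n.+1 ^ n.+1 <= qparam L by apply: (le2).
by apply: leq_mul => //; apply: (le2).
Qed.

Lemma radius_le i : i <= L -> 2 * radius L i <= K.
Proof.
move=> iL; rewrite /radius -expnS /K /kparam leq_pexp2l //.
by apply: leq_trans (_ : (L + 3) * L < _); rewrite ?ltnS ?leq_mul2l ?iL ?orbT // ltn_mul2l; lia.
Qed.

Lemma threshold_lt i : i <= L -> threshold L i < K.
Proof.
move=> iL; apply: leq_ltn_trans (_ : (L + 3) * (L + 3) < _); last exact: ltn_expl.
by rewrite /threshold; nia.
Qed.

(** A witness of a quantifier is itself a candidate if [N <= M]; otherwise the girth is at least [K]
    and the witness can be replaced by the representative of its colour. *)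
Lemma teval_sat k (phi : fo k) (ps : k.-tuple 'I_N) : k + size (encode_fo phi) <= L ->
  teval N A (cand N K M A) phi (map val ps) = sat (G := G) phi (tnth ps).
Proof.
have nthE k0 (qs : k0.-tuple 'I_N) (i : 'I_k0) : nth 0 (map val qs) i = val (tnth qs i).
  by rewrite (nth_map (tnth qs i)) ?size_tuple // -tnth_nth.
elim: k / phi ps => [k i j|k i j|k psi IH|k psi IH1 chi IH2|k psi IH] ps /= hL.
- by rewrite !nthE val_eqE.
- by rewrite !nthE adj_natE.
- by rewrite IH //; lia.
- by rewrite size_cat in hL; rewrite IH1 ?IH2 //; lia.
have hL' : k.+1 + size (encode_fo psi) <= L by lia.
have IH' (x : 'I_N) : teval N A (cand N K M A) psi (val x :: map val ps) =
    sat (G := G) psi (env_cons (x : G) (tnth ps)).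
  by rewrite (eq_sat _ (env_cons_tnth _ _)) -IH.
apply/hasP/existsP=> [[u]|[x hx]].
  rewrite mem_iota add0n => /andP[_ uN] /andP[_ tu]; exists (Ordinal uN).
  by rewrite -IH'.
case: small_or_large => [NM|Kn].
  exists (val x); first by rewrite mem_iota ltn_ord.
  by rewrite /cand (leq_trans (ltn_ord x) NM) IH'.
have [e1 e2] := cl_rep K ps K x; set v := Ordinal _ in e1 e2.
exists (val v); first by rewrite mem_iota ltn_ord.
rewrite /cand e1 eqxx orbT IH' /=.
have iL : qrank psi <= L by have := qrank_le psi; lia.
rewrite (@same_colour_sat G _ S lab n L S_symm S_no_cycle lab_adj (qrank psi) k psi ps v x K K) //.
- by have := qrank_le psi; lia.
- exact: radius_le.
- by apply: leq_trans (radius_le iL) Kn.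
- exact: threshold_lt.
Qed.

(** The cardinality of [ctype] for 16 labels, [L] parameters, cap [K] and [K] rounds. *)
Definition colour_bound := iter K (fun b => b * K.+1 ^ b) (16 * 2 ^ L).

Lemma card_ctype k T l :
  #|ctype 'I_16 k T l| = iter l (fun b => b * T.+1 ^ b) (16 * 2 ^ k).
Proof.
elim: l => [|l IH]; first by rewrite card_prod card_ord card_tuple card_bool.
by rewrite card_prod card_ffun card_ord IH.
Qed.

Lemma cand_bound ps : size ps < L -> all (fun u => u < N) ps ->
  \sum_(u < N) cand N K M A ps u <= M + colour_bound.
Proof.
move=> szL psN.
have [pt [ept]] : exists pt : (size ps).-tuple 'I_N, map val pt = ps.
  have e : map val (pmap insub ps : seq 'I_N) = ps.
    rewrite (pmap_filter (@insubK _ _ _)) (eq_filter (a2 := fun u => u < N)); last first.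
      by move=> u; rewrite isSome_insub.
    exact/all_filterP.
  have sz : size (pmap insub ps : seq 'I_N) == size ps by rewrite -{2}e size_map.
  by exists (Tuple sz).
apply: leq_trans (_ : \sum_(u < N) ((u < M) + (cl N K A ps K u == u)) <= _).
  by apply: leq_sum => u _; rewrite /cand; case: (u < M); case: (_ == _).
rewrite big_split /=; apply: leq_add.
  elim: (N) => [|m IH]; first by rewrite big_ord0.
  have H m' : \sum_(u < m') (u < M) = minn m' M.
    elim: m' => [|m' IH']; first by rewrite big_ord0 min0n.
    by rewrite big_ord_recr /= IH'; case: ltnP; lia.
  by rewrite H geq_minr.
rewrite sum_ord_card -ept; set D := [set _ | _].
have inj : {in D &, injective (col S lab K pt K)}.
  move=> u v; rewrite !inE => /eqP eu /eqP ev /eqP; rewrite -clE eu ev => /eqP.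
  exact: val_inj.
rewrite -(card_in_imset inj); apply: leq_trans (max_card _) _.
have {1}-> : #|ctype 'I_16 (size ps) K K| = iter K (fun b => b * K.+1 ^ b) (16 * 2 ^ size ps).
  exact: card_ctype.
rewrite /colour_bound; elim: (X in iter X) => [|l IH] /=; first by rewrite leq_mul2l leq_pexp2l // ltnW.
by apply: leq_mul => //; rewrite leq_pexp2l.
Qed.

End Checking.

Lemma sat_iso (G G' : sgraph) (f : G' -> G) : bijective f ->
  (forall x y, adj (f x) (f y) = adj x y) ->
  forall k (phi : fo k) rho, sat phi (f \o rho) = sat phi rho.
Proof.
move=> [g fg gf] fadj k phi; elim: k / phi => [k i j|k i j|k psi IH|k psi IH1 chi IH2|k psi IH] rho /=.
- by rewrite (can_eq fg).
- exact: fadj.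
- by rewrite IH.
- by rewrite IH1 IH2.
have E x : sat psi (env_cons (f x) (f \o rho)) = sat psi (env_cons x rho).
  rewrite -IH; apply: eq_sat => i; rewrite /env_cons /=; by case: unlift.
apply/existsP/existsP=> -[x hx]; last by exists (f x); rewrite E.
by exists (g x); rewrite -E gf.
Qed.

Lemma nth_allpairs (T1 T2 : Type) (R : Type) x1 x2 r0 (f : T1 -> T2 -> R) s1 s2 u v :
  u < size s1 -> v < size s2 ->
  nth r0 [seq f x y | x <- s1, y <- s2] (size s2 * u + v) = f (nth x1 s1 u) (nth x2 s2 v).
Proof.
elim: s1 u => // x s1 IH [|u] hu hv /=.
  by rewrite muln0 add0n nth_cat size_map hv (nth_map x2).
rewrite nth_cat size_map mulnS -addnA ltnNge leq_addr /= addKn; exact: IH.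
Qed.

Definition girth_class (G : sgraph) : Prop := exists n, induced_subgraph G (girth_graph n).

(** * The running time and the computability of its bound *)

(** The sum of all loop bounds depending on the sentence only; its last term bounds the number of
    tree nodes. *)
Definition size_bound L :=
  (L + 3) * (L + 3) + L + 2 + kparam L + qparam L + (mparam L + colour_bound L).+1 ^ L.

Definition time_bound L :=
  lenC model_checker * (4 * size_bound L) ^ depthC model_checker.

(** The parameter function of an FPT algorithm must itself be computable by a machine, so
    [time_bound] is programmed in the loop language as well. *)
Definition c_bound :=
  CSeq (CAssign 2 (EIn (EC 0)))
  (CSeq c_params
  (CSeq (CAssign 6 (EC 2))
  (CSeq (c_pow 2 6)
  (CSeq (CAssign 6 (EC 16))
  (CSeq (CAssign 25 (EMul 6 (EV 23)))
  (CSeq (CAssign 26 (EAdd (EC 1) (EV 3)))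
  (CSeq (CFor 27 3 (CSeq (c_pow 25 26) (CAssign 25 (EMul 25 (EV 23)))))
  (CSeq (CAssign 26 (EAdd (EC 1) (EAdd (EV 22) (EV 25))))
  (CSeq (c_pow 2 26)
  (CSeq (CAssign 28 (EV 23))
  (CSeq (c_pow 3 3)
  (CSeq (CAssign 6 (EAdd (EV 2) (EC 3)))
  (CSeq (CAssign 26 (EAdd (EAdd (EAdd (EAdd (EAdd (EMul 6 (EV 6)) (EV 2)) (EC 2)) (EV 3))
                                 (EV 23)) (EV 28)))
  (CSeq (CAssign 6 (EC 4))
  (CSeq (CAssign 25 (EMul 6 (EV 26)))
  (CSeq (CAssign 29 (EC (depthC model_checker)))
  (CSeq (c_pow 29 25)
  (CSeq (CAssign 6 (EC (lenC model_checker)))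
        (CAssign 0 (EMul 6 (EV 23))))))))))))))))))))).

Lemma eval_mulV w y x s : x != 12 -> eval w (EMul y (EV x)) s = vr s y * vr s x.
Proof.
by move=> x12; rewrite (@evalMul _ _ _ _ (vr s x)) // => i; rewrite evalE /= (negbTE x12).
Qed.

Lemma run_bound L : vr (run [:: L] c_bound store0) 0 = time_bound L.
Proof.
set w := [:: L]; set mc := model_checker.
pose D := depthC mc; pose C := lenC mc.
rewrite /c_bound -/mc -/D -/C run_seq run_assign !evalE.
set s1 := setv _ _ _; pose Z := (L + 3) * (L + 3) + L + 2 + kparam L + qparam L.
have m1 : small Z s1 by move=> x _ /=; case: eqP => // _; rewrite /Z; lia.
have [||||_ _ k2 M2 fr2] := @run_params w Z s1 L erefl m1; rewrite ?/Z; try lia.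
rewrite run_seq; set s2 := run w c_params s1 in k2 M2 fr2 *.
have L2 : vr s2 2 = L by rewrite fr2.
clearbody s2.
rewrite run_seq run_assign evalE run_seq; set s3 := run w (c_pow 2 6) _.
have p3 : vr s3 23 = 2 ^ L by rewrite run_pow //= L2.
have f3 x : x \notin [:: 6; 18; 23] -> vr s3 x = vr s2 x.
  by rewrite !inE !negb_or => /and3P[a b c]; rewrite run_modv ?inE ?negb_or ?b ?c //= (negbTE a).
clearbody s3.
rewrite run_seq run_assign evalE run_seq run_assign eval_mulV // run_seq run_assign !evalE.
set s4 := setv _ 26 _; rewrite run_seq.
have k4 : vr s4 3 = kparam L by rewrite /= f3.
have b4 : vr s4 25 = 16 * 2 ^ L by rewrite /= p3.
have c4 : vr s4 26 = (kparam L).+1 by rewrite /= f3 // k2.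
have [L4 M4] : vr s4 2 = L /\ vr s4 22 = mparam L by rewrite /= !f3.
clearbody s4.
pose I i s' := [/\ vr s' 25 = iter i (fun b => b * (kparam L).+1 ^ b) (16 * 2 ^ L),
  vr s' 26 = (kparam L).+1, vr s' 2 = L, vr s' 3 = kparam L & vr s' 22 = mparam L].
set body := CSeq (c_pow 25 26) _.
have : I (vr s4 3) (run w (CFor 27 3 body) s4).
  apply: for_ind => [|i s' _ [h1 h2 h3 h4 h5]]; first by split.
  rewrite /body run_seq run_assign eval_mulV //; set t := run w _ _.
  have e23 : vr t 23 = (kparam L).+1 ^ vr s' 25 by rewrite /t run_pow //= h2.
  by split; rewrite /= ?e23 /t ?run_modv //= h1.
rewrite k4; set s5 := run w _ s4 => -[b5 _ L5 k5 M5]; clearbody s5.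
rewrite run_seq run_assign !evalE run_seq; set s6 := run w (c_pow 2 26) _.
have p6 : vr s6 23 = (mparam L + colour_bound L).+1 ^ L.
  by rewrite /s6 run_pow //= L5 M5 b5.
have [L6 k6] : vr s6 2 = L /\ vr s6 3 = kparam L by rewrite /s6 !run_modv //= L5 k5.
clearbody s6.
rewrite run_seq run_assign evalE run_seq; set s7 := run w (c_pow 3 3) _.
have p7 : vr s7 23 = qparam L by rewrite /s7 run_pow //= k6.
have [L7 k7] : vr s7 2 = L /\ vr s7 3 = kparam L by rewrite /s7 !run_modv //= L6 k6.
have d7 : vr s7 28 = (mparam L + colour_bound L).+1 ^ L by rewrite /s7 run_modv //= p6.
clearbody s7.
rewrite run_seq run_assign !evalE run_seq run_assign !evalAdd eval_mulV // !evalE.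
rewrite run_seq run_assign evalE run_seq run_assign eval_mulV // run_seq run_assign evalE.
set s8 := setv _ 29 _.
have b8 : vr s8 25 = 4 * size_bound L by rewrite /= L7 k7 p7 d7.
have d8 : vr s8 29 = D by [].
clearbody s8; rewrite run_seq; set s9 := run w _ s8.
have p9 : vr s9 23 = (4 * size_bound L) ^ D by rewrite /s9 run_pow // b8 d8.
clearbody s9; rewrite run_seq !run_assign evalE eval_mulV //= p9.
by [].
Qed.

Lemma halts_within_le p w T T' y : T <= T' -> halts_within p w T y -> halts_within p w T' y.
Proof. by move=> le [t ht h]; exists t => //; apply: leq_trans le. Qed.

Theorem girth_class_fpt : fpt_model_checking girth_class.
Proof.
exists (compile model_checker), time_bound, (depthC model_checker); split.
  by apply: (@run_computable c_bound) => // L; apply: run_bound.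
move=> G s phi [n [h [h_inj h_adj]]] ps.
set N := size s; pose f (i : 'I_N) : G := tnth (in_tuple s) i.
have us : uniq s by rewrite (perm_uniq ps) enum_uniq.
have f_inj : injective f by apply/injectiveP; rewrite /injectiveb /dinjectiveb map_tnth_enum.
have f_bij : bijective f.
  apply: inj_card_bij => //; rewrite card_ord /N (perm_size ps) -cardE; exact: leqnn.
pose adjN (i j : 'I_N) := adj (f i) (f j).
have a_sym : symmetric adjN by move=> i j; apply: adj_sym.
have a_irr : irreflexive adjN by move=> i; apply: adj_irr.
have hf_inj : injective (h \o f) by apply: inj_comp.
have hf_adj i j : adj ((h \o f) i) ((h \o f) j) = adjN i j by apply: h_adj.
set w := _ ++ _; set L := size (encode_fo phi).
have sw : size (encode_graph s) = (N * N).+1 by rewrite /= size_allpairs.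
pose A := adj_nat adjN; pose C := mparam L + colour_bound L.
pose Z := size_bound L * N.+1.
have Fle x : x <= size_bound L -> x <= Z by move=> hx; apply: leq_trans hx _; apply: leq_pmulr.
have F1 : 0 < size_bound L by rewrite /size_bound; lia.
have [] := @model_checker_correct w N L A phi C Z.
- by [].
- by rewrite size_cat sw add1n.
- by [].
- move=> u v uN vN; rewrite /w /= nth_cat size_allpairs.
  have x0 : G := f (Ordinal uN).
  have -> : N * u + v < size s * size s.
    apply: leq_trans (_ : N * u.+1 <= _); last by rewrite leq_mul2l uN orbT.
    by rewrite mulnS addnC ltn_add2r.
  rewrite (nth_allpairs x0 x0) // /A -[u in RHS](erefl : val (Ordinal uN) = u).
  rewrite -[v in RHS](erefl : val (Ordinal vN) = v) adj_natE /adjN /f.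
  by rewrite !(tnth_nth x0).
- by move=> p hp; rewrite /w nth_cat sw add1n ltnS ltnNge leq_addr /= subSS addKn.
- move=> q h1 h2; exact: (@cand_bound N n adjN a_sym (h \o f) hf_inj hf_adj L).
- by apply: leq_trans (leqnSn _) _; apply: leq_pmull.
- by apply: Fle; rewrite /size_bound; lia.
- by apply: Fle; rewrite /size_bound; lia.
- by apply: Fle; rewrite /size_bound; lia.
- by apply: Fle; rewrite /size_bound; lia.
- by apply: Fle; rewrite /size_bound; lia.
- by apply: Fle; apply: leq_addl.
move=> sf res.
have -> : nat_of_bool (models G phi) = vr (run w model_checker store0) 0.
  rewrite res; congr nat_of_bool.
  have := @teval_sat N n adjN a_sym a_irr (h \o f) hf_inj hf_adj L 0 phi [tuple].
  rewrite add0n leqnn /= => -> //.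
  rewrite -(@sat_iso G (SGraph a_sym a_irr) f f_bij) //.
  by rewrite /models; apply: eq_sat => -[].
apply: halts_within_le (compile_correct _ sf) => //.
(* The constant 4 absorbs the passage from [(size_bound L * N.+1).+1] to [size_bound L] times the
   length [(N * N).+1] of the encoded graph. *)
apply: leq_trans (timeC_le _ _) _; rewrite /time_bound -mulnA leq_mul2l -expnMn sw.
apply/orP; right; have d0 : 0 < depthC model_checker by [].
rewrite leq_exp2r // /Z; nia.
Qed.

(** * Two edges whose removal keeps the graph connected *)

Section RemoveEdge.
Variables (T : finType) (r : rel T).
Hypothesis r_sym : symmetric r.

Definition remove_edge (E : {set T}) : rel T := fun a b => r a b && ([set a; b] != E).

Lemma remove_edge_sym E : symmetric (remove_edge E).
Proof. by move=> a b; rewrite /remove_edge r_sym setUC. Qed.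

Lemma cycle_detour c x : uniq c -> path.cycle r c -> 2 < size c -> x \in c ->
  connect (remove_edge [set x; next c x]) (next c x) x.
Proof.
move=> uc cc sc xc; have [i c' e] := rot_to xc.
have uc' : uniq (x :: c') by rewrite -e rot_uniq.
have cc' : path.cycle r (x :: c') by rewrite -e rot_cycle.
have sc' : 2 < size (x :: c') by rewrite -e size_rot.
have -> : next c x = next (x :: c') x by rewrite -e next_rot.
case: c' {e} uc' cc' sc' => [|y [|z c']] //= /and3P[xny ync uzc] /and3P[rxy ryz pz] _.
rewrite eqxx; set E := [set x; y].
have nE a b : a != x -> a != y -> r a b -> remove_edge E a b.
  move=> ax ay rab; rewrite /remove_edge rab; apply: contraNneq ay => eE.
  by have : a \in E by [rewrite -eE set21]; rewrite !inE (negbTE ax).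
have pE : forall s a, x \notin a :: s -> y \notin a :: s -> path r a (rcons s x) ->
    path (remove_edge E) a (rcons s x).
  elim=> [|b s IH] a; rewrite !inE ?negb_or.
    by move=> xa ya /= /andP[rax _]; rewrite nE // eq_sym.
  move=> /andP[xa xs] /andP[ya ys] /= /andP[rab pb].
  have rE : remove_edge E a b by apply: nE; rewrite // eq_sym.
  by rewrite rE; apply: IH => //; rewrite inE negb_or.
apply/connectP; exists (rcons (z :: c') x); last by rewrite last_rcons.
rewrite /= {1}/remove_edge ryz /= pE //; last first.
- by move: xny; rewrite !inE !negb_or => /and3P[_ -> ->].
rewrite andbT; apply: contraNneq ync => eE.
have : z \in E by rewrite -eE set22.
rewrite !inE => /orP[/eqP ez|/eqP ->]; last by rewrite eqxx.
by move: xny; rewrite !inE ez eqxx /= orbT.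
Qed.

Lemma connect_remove c x : uniq c -> path.cycle r c -> 2 < size c -> x \in c ->
  (forall a b, connect r a b) ->
  forall a b, connect (remove_edge [set x; next c x]) a b.
Proof.
move=> uc cc sc xc conn a b; have d := cycle_detour uc cc sc xc.
apply: (connect_sub _ (conn a b)) => {a b} a b rab.
case: (eqVneq [set a; b] [set x; next c x]) => [eE|ne]; last first.
  by apply: connect1; rewrite /remove_edge rab.
have sym := sym_connect_sym (remove_edge_sym [set x; next c x]).
have : a \in [set x; next c x] by rewrite -eE set21.
have : b \in [set x; next c x] by rewrite -eE set22.
rewrite !inE => /orP[] /eqP -> /orP[] /eqP ->; rewrite ?connect0 //.
by rewrite sym.
Qed.

End RemoveEdge.

(** One of the cycles has an edge outside the other. Its removal keeps the graph connected and the
    other cycle intact, so any edge of the latter can be removed next. *)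
Lemma two_removable_edges (H : sgraph) : connected_graph H -> at_least_two_cycles H ->
  exists u1 v1 u2 v2 : H, [/\ adj u1 v1, adj u2 v2, [set u1; v1] != [set u2; v2] &
    forall a b, connect (fun x y => [&& adj x y, [set x; y] != [set u1; v1]
      & [set x; y] != [set u2; v2]]) a b].
Proof.
move=> [_ conn] [c1 [c2 [cy1 cy2]]].
wlog [E E1 E2] : c1 c2 cy1 cy2 / exists2 E, E \in cycle_edges c1 & E \notin cycle_edges c2.
  move=> W ne; case: (boolP (cycle_edges c1 \subset cycle_edges c2)) => [s12|/subsetPn h].
    case: (boolP (cycle_edges c2 \subset cycle_edges c1)) => [s21|/subsetPn h].
      by rewrite eqEsubset s12 s21 in ne.
    by apply: (W c2 c1) => //; rewrite eq_sym.
  exact: (W c1 c2).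
move=> _; case: cy1 => sz1 /andP[cc1 uc1]; case: cy2 => sz2 /andP[cc2 uc2].
case/imsetP: E1 => x xc1 eE.
have conn1 := connect_remove (@adj_sym H) uc1 cc1 sz1 xc1 conn; rewrite -eE in conn1.
have cc2' : path.cycle (remove_edge (@adj H) E) c2.
  apply: cycle_from_next => // y yc; rewrite /remove_edge (next_cycle cc2) //.
  by apply: contraNneq E2 => <-; apply: imset_f.
have [y yc] : exists y, y \in c2 by case: (c2) sz2 => // y s _; exists y; rewrite mem_head.
have conn2 := connect_remove (remove_edge_sym (@adj_sym H) E) uc2 cc2' sz2 yc conn1.
exists x, (next c1 x), y, (next c2 y); split.
- exact: next_cycle cc1 xc1.
- exact: next_cycle cc2 yc.
- by rewrite -eE; apply: contraNneq E2 => ->; apply: imset_f.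
move=> a b; rewrite -eE; apply: etrans (conn2 a b); apply: eq_connect => p q.
by rewrite /remove_edge andbA.
Qed.

From mathcomp Require Import all_order all_algebra.
From mathcomp Require Import all_classical all_reals all_analysis.
Import Order.TTheory GRing.Theory Num.Theory.
Import numFieldNormedType.Exports.

(** * Representing the flipped graphs on [H] *)

Section Realisation.
Local Open Scope ring_scope.
Local Open Scope classical_set_scope.
Variables (R : realType) (H : sgraph).
Local Notation vp := (@vertex_point R H).
Local Notation pt := ('rV[R]_#|H|).

Definition seg (u v : H) (t : R) : pt := (1 - t) *: vp u + t *: vp v.

Lemma segE u v t w : seg u v t 0 (enum_rank w) = (1 - t) * (w == u)%:R + t * (w == v)%:R.
Proof.
by rewrite /seg /vertex_point !mxE !eqxx /= !(inj_eq enum_rank_inj).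
Qed.

Lemma seg0 u v : seg u v 0 = vp u.
Proof. by rewrite /seg subr0 scale1r scale0r addr0. Qed.

Lemma seg1 u v : seg u v 1 = vp v.
Proof. by rewrite /seg subrr scale0r scale1r add0r. Qed.

Lemma seg_sym u v t : seg v u t = seg u v (1 - t).
Proof. by rewrite /seg subKr addrC. Qed.

Lemma seg_inj u v t t' : u != v -> seg u v t = seg u v t' -> t = t'.
Proof.
move=> uv /(congr1 (fun x : pt => x 0 (enum_rank v))); rewrite !segE eqxx.
by rewrite eq_sym (negbTE uv) !mulr0 !add0r !mulr1.
Qed.

(** The non-zero coordinates of an interior point are exactly those of the two ends of its edge. *)
Lemma seg_edge u v u' v' t t' : u != v -> u' != v' -> 0 < t < 1 ->
  seg u v t = seg u' v' t' -> [set u; v]%SET = [set u'; v']%SET.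
Proof.
move=> uv uv' /andP[t0 t1] e.
have supp w : (w == u) || (w == v) -> (w == u') || (w == v').
  move=> hw; have := congr1 (fun x : pt => x 0 (enum_rank w)) e; rewrite !segE.
  case: (w == u') => //; case: (w == v') => //; rewrite !mulr0 addr0.
  have n1 : 1 - t != 0 by rewrite subr_eq0 gt_eqF.
  case/orP: hw => /eqP ->; rewrite eqxx ?(negbTE uv) ?[v == u]eq_sym ?(negbTE uv) mulr1 mulr0 ?addr0 ?add0r => /eqP.
    by rewrite (negbTE n1).
  by rewrite gt_eqF.
apply/eqP; rewrite finset.eqEcard !cards2 uv uv' leqnn andbT; apply/fintype.subsetP => w.
by rewrite !finset.inE; apply: supp.
Qed.

Lemma seg_continuous u v : continuous (seg u v).
Proof.
move=> t; apply: cvgD; apply: cvgZr_tmp; last exact: cvg_id.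
by apply: cvgB; [apply: cvg_cst|apply: cvg_id].
Qed.

Lemma seg_connected u v a b : connected (seg u v @` `[a, b]).
Proof.
apply: connected_continuous_connected; first exact: segment_connected.
by apply: continuous_subspaceT => t; apply: seg_continuous.
Qed.

Lemma seg_realisation u v t : adj u v -> 0 <= t <= 1 -> @realisation R H (seg u v t).
Proof. by move=> uv ht; right; exists u, v, t. Qed.

Variables (u1 v1 u2 v2 : H).
Hypotheses (a1 : adj u1 v1) (a2 : adj u2 v2).
Hypothesis ne12 : ([set u1; v1] != [set u2; v2])%SET.
Let keep (x y : H) := [&& adj x y, [set x; y]%SET != [set u1; v1]%SET
  & [set x; y]%SET != [set u2; v2]%SET].
Hypothesis keep_conn : forall a b, connect keep a b.

Lemma adj_neq (x y : H) : adj x y -> x != y.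
Proof. by apply: contraTneq => ->; rewrite adj_irr. Qed.

Section Punctured.
Variables (t1 t2 : R).
Hypotheses (ht1 : 0 < t1 < 1) (ht2 : 0 < t2 < 1).

Definition punctured : set pt :=
  [set x | [/\ @realisation R H x, x <> seg u1 v1 t1 & x <> seg u2 v2 t2]].

(** Joining by connected subsets makes transitivity a union of two sets with a common point. *)
Definition linked (x y : pt) :=
  exists C : set pt, [/\ connected C, C `<=` punctured, C x & C y].

Lemma linked_trans y x z : linked x y -> linked y z -> linked x z.
Proof.
move=> [C [cC sC Cx Cy]] [D [cD sD Dy Dz]]; exists (C `|` D); split.
- by apply: connectedU => //; exists y.
- by move=> p [/sC|/sD].
- by left.
- by right.
Qed.

Lemma linked_seg u v a b t t' : adj u v -> 0 <= a -> b <= 1 ->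
  (forall s, a <= s <= b -> seg u v s <> seg u1 v1 t1 /\ seg u v s <> seg u2 v2 t2) ->
  a <= t <= b -> a <= t' <= b -> linked (seg u v t) (seg u v t').
Proof.
move=> uv a0 b1 avoid ht ht'; exists (seg u v @` `[a, b]); split.
- exact: seg_connected.
- move=> _ [s /= + <-]; rewrite in_itv /= => hs; have [n1 n2] := avoid s hs.
  split=> //; apply: seg_realisation => //; case/andP: hs => h1 h2.
  by rewrite (le_trans a0 h1) (le_trans h2 b1).
- by exists t => //=; rewrite in_itv.
- by exists t' => //=; rewrite in_itv.
Qed.

Lemma seg_avoid u v u' v' s t : adj u v -> adj u' v' -> 0 < t < 1 ->
  [set u; v]%SET != [set u'; v']%SET -> seg u v s <> seg u' v' t.
Proof.
move=> uv uv' ht ne e; move/eqP: ne; apply; apply/esym.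
by apply: (seg_edge _ _ ht (esym e)); apply: adj_neq.
Qed.

Lemma linked_keep u v : keep u v -> linked (vp u) (vp v).
Proof.
case/and3P=> uv n1 n2; rewrite -(seg0 u v) -(seg1 u v).
apply: (linked_seg (a := 0) (b := 1)) => //; rewrite ?lexx ?ler01 //.
by move=> s _; split; apply: seg_avoid.
Qed.

Lemma linked_vertices u v : linked (vp u) (vp v).
Proof.
have /connectP[p + ->] := keep_conn u v.
elim: p u => [|w p IH] u /=.
  move=> _; exists [set vp u]; split=> //; first exact: connected1.
  (* The trivial path gives a single point, which has to lie in the punctured space: a vertex is
     never interior to an edge. *)
  move=> _ ->; have vne x y t : adj x y -> 0 < t < 1 -> vp u <> seg x y t.
    move=> xy /andP[t0 t1'] e.
    have hz z : (z == u)%:R = (1 - t) * (z == x)%:R + t * (z == y)%:R :> R.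
      by rewrite -segE -e /vertex_point mxE eqxx /= (inj_eq enum_rank_inj).
    have hx : x = u.
      apply/eqP/negPn/negP=> nx; have /eqP := hz x.
      by rewrite (negbTE nx) eqxx (negbTE (adj_neq xy)) mulr1 mulr0 addr0 eq_sym subr_eq0 gt_eqF.
    have hy : y = u.
      apply/eqP/negPn/negP=> ny; have /eqP := hz y.
      by rewrite (negbTE ny) eqxx eq_sym [y == x]eq_sym (negbTE (adj_neq xy)) mulr1 mulr0 add0r gt_eqF.
    by move: xy; rewrite hx hy adj_irr.
  by split; [left; exists u|apply: vne|apply: vne].
by case/andP=> /linked_keep uw /IH; apply: linked_trans.
Qed.

(** On a punctured edge one moves away from the puncture to the end on the same side. The hypothesis
    on [punctured] hides the order of the two edges, so that the lemma serves both. *)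
Lemma linked_edge u v t t0 u' v' tt : adj u v -> adj u' v' -> 0 < t0 < 1 -> 0 < tt < 1 ->
  [set u; v]%SET != [set u'; v']%SET ->
  (forall x, x <> seg u v t0 -> x <> seg u' v' tt -> @realisation R H x -> punctured x) ->
  0 <= t <= 1 -> t != t0 -> exists w, linked (seg u v t) (vp w).
Proof.
move=> uv uv' ht0 htt ne into /andP[t0' t1'] tne.
have avoid' s : seg u v s <> seg u' v' tt by apply: seg_avoid.
have sub a b : 0 <= a -> b <= 1 -> (forall s, a <= s <= b -> s != t0) ->
    seg u v @` `[a, b] `<=` punctured.
  move=> a0 b1 hs _ [s /= + <-]; rewrite in_itv /= => sab; apply: into => //.
    by move/(seg_inj (adj_neq uv)) => e; have := hs s sab; rewrite e eqxx.
  apply: seg_realisation => //; case/andP: sab => h1 h2.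
  by rewrite (le_trans a0 h1) (le_trans h2 b1).
case: (ltP t t0) => tt0.
  exists u, (seg u v @` `[0, t]); split.
  - exact: seg_connected.
  - by apply: sub => // s /andP[_ st]; rewrite lt_eqF // (le_lt_trans st).
  - by exists t => //=; rewrite in_itv /= t0' lexx.
  - by exists 0; rewrite ?seg0 //= in_itv /= lexx.
exists v, (seg u v @` `[t, 1]); split.
- exact: seg_connected.
- apply: sub => // s /andP[ts _]; rewrite gt_eqF //.
  by apply: lt_le_trans ts; rewrite lt_neqAle eq_sym tne.
- by exists t => //=; rewrite in_itv /= lexx.
- by exists 1; rewrite ?seg1 //= in_itv /= t1' lexx.
Qed.

Lemma punctured_linked x w : punctured x -> linked x (vp w).
Proof.
move=> px; suff [w' h] : exists w', linked x (vp w').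
  exact: linked_trans h (linked_vertices w' w).
case: (px) => -[[v ->]|[u [v [t [uv ht ex]]]]] n1 n2; first by exists v; apply: linked_vertices.
rewrite -/(seg u v t) in ex; subst x.
have on1 s : 0 <= s <= 1 -> s != t1 -> exists w', linked (seg u1 v1 s) (vp w').
  move=> hs sne; by apply: (linked_edge a1 a2 ht1 ht2).
have on2 s : 0 <= s <= 1 -> s != t2 -> exists w', linked (seg u2 v2 s) (vp w').
  move=> hs sne; by apply: (linked_edge a2 a1 ht2 ht1) => //; rewrite eq_sym.
have flip (s : R) : 0 <= s <= 1 -> 0 <= 1 - s <= 1.
  by move=> /andP[h1 h2]; rewrite subr_ge0 h2 lerBlDr lerDl.
have orient (x y z w' : H) : [set x; y]%SET = [set z; w']%SET -> adj x y -> (x = z /\ y = w') \/ (x = w' /\ y = z).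
  move=> e xy; have := adj_neq xy.
  have : x \in [set z; w']%SET by rewrite -e set21.
  have : y \in [set z; w']%SET by rewrite -e set22.
  rewrite !finset.inE => /orP[] /eqP -> /orP[] /eqP ->; rewrite ?eqxx //; [by right|by left].
case: (eqVneq [set u; v]%SET [set u1; v1]%SET) => [e1|ne1].
  case: (orient _ _ _ _ e1 uv) => -[eu ev]; subst u v.
    by apply: on1 => //; apply: contra_notN n1 => /eqP ->.
  rewrite seg_sym in n1 *; apply: on1; first exact: flip.
  by apply: contra_notN n1 => /eqP ->.
case: (eqVneq [set u; v]%SET [set u2; v2]%SET) => [e2|ne2].
  case: (orient _ _ _ _ e2 uv) => -[eu ev]; subst u v.
    by apply: on2 => //; apply: contra_notN n2 => /eqP ->.
  rewrite seg_sym in n2 *; apply: on2; first exact: flip.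
  by apply: contra_notN n2 => /eqP ->.
exists u; rewrite -(seg0 u v); apply: (linked_seg (a := 0) (b := 1)); rewrite ?lexx ?ler01 //.
by move=> s _; split; apply: seg_avoid.
Qed.

Lemma punctured_connected (w : H) : connected punctured.
Proof.
have -> : punctured = \bigcup_(C in [set C | [/\ connected C, C `<=` punctured & C (vp w)]]) C.
  apply/seteqP; split=> [x /(punctured_linked w)[C [cC sC Cx Cw]]|x [C [_ sC _] Cx]].
    by exists C.
  exact: sC.
apply: bigcup_connected; last by move=> C [].
by exists (vp w) => C [].
Qed.

End Punctured.

(** * The sets representing the flipped graph *)

Section Model.
Variable n : nat.

(** Reciprocals of integers from 2 on: distinct and strictly between 0 and 1. *)
Definition param (s : {perm word n}) : R := (enum_rank s).+2%:R^-1.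

Lemma param_itv s : 0 < param s < 1.
Proof. by rewrite invr_gt0 ltr0n /= invf_lt1 ?ltr0n // ltr1n. Qed.

Lemma param_inj : injective param.
Proof.
move=> s s' /invr_inj/eqP; rewrite eqr_nat !eqSS => /eqP/ord_inj; exact: enum_rank_inj.
Qed.

Definition bpoint (b : bvert n) : pt :=
  if b.1 then seg u2 v2 (param b.2) else seg u1 v1 (param b.2).

Lemma bpoint_inj : injective bpoint.
Proof.
have ne t t' : seg u1 v1 (param t) <> seg u2 v2 (param t').
  by apply: seg_avoid => //; apply: param_itv.
move=> [[] s] [[] s']; rewrite /bpoint /=.
- by move/(seg_inj (adj_neq a2))/param_inj ->.
- by move/esym/ne.
- by move/ne.
- by move/(seg_inj (adj_neq a1))/param_inj ->.
Qed.

Definition model (x : girth_graph n) : set pt :=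
  match x with
  | inl b => [set bpoint b]
  | inr a => punctured (param (endpoint false a)) (param (endpoint true a))
  end.

Lemma bpoint_realisation b : @realisation R H (bpoint b).
Proof.
have /andP[h0 h1] := param_itv b.2; rewrite /bpoint.
by case: (b.1); apply: seg_realisation; rewrite ?(ltW h0) ?(ltW h1).
Qed.

Lemma bpoint_punctured b a : model (inr a) (bpoint b) <-> ~~ incident b a.
Proof.
have e t : bpoint (t, endpoint t a) = if t then seg u2 v2 (param (endpoint true a))
    else seg u1 v1 (param (endpoint false a)) by case: t.
split=> [[_ n1 n2]|ni].
  apply/negP=> /eqP hb; case: b hb n1 n2 => [[] s] /= ->; rewrite -?(e true) -?(e false) => n1 n2; [exact: n2|exact: n1].
split; first exact: bpoint_realisation.
  by rewrite -(e false) => /bpoint_inj eb; rewrite eb /incident /= eqxx in ni.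
by rewrite -(e true) => /bpoint_inj eb; rewrite eb /incident /= eqxx in ni.
Qed.

Lemma vertex_model w a : model (inr a) (vp w).
Proof.
have [C [_ sC Cw _]] := linked_vertices (param_itv (endpoint false a)) (param_itv (endpoint true a)) w w.
exact: sC.
Qed.

Lemma Hgraph_girth (w : H) : Hgraph R H (girth_graph n).
Proof.
exists model; split.
  case=> [b|a] /=.
    split; [by move=> _ ->; apply: bpoint_realisation|by exists (bpoint b)|exact: connected1].
  split; first by move=> x [].
    by exists (vp w); apply: (vertex_model w a).
  by apply: punctured_connected => //; apply: param_itv.
case=> [b|a] [b'|a'] ne /=.
- split=> // -[x [/= -> /bpoint_inj eb]]; by rewrite eb eqxx in ne.
- split=> [/bpoint_punctured hb|[x [/= -> hb]]]; first by exists (bpoint b).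
  exact/bpoint_punctured.
- split=> [/bpoint_punctured hb|[x [/= hb xb]]]; first by exists (bpoint b').
  by apply/bpoint_punctured; rewrite -xb.
(* All punctures are interior to edges, so any vertex of [H] lies in every set of [A]. *)
- split=> // _; exists (vp w); split; [exact: (vertex_model w a)|exact: (vertex_model w a')].
Qed.

End Model.
End Realisation.

Lemma Hgraph_hereditary (R : realType) (H G G' : sgraph) :
  Hgraph R H G' -> induced_subgraph G G' -> Hgraph R H G.
Proof.
move=> [S [h1 h2]] [h [hi ha]]; exists (S \o h); split=> [x|x y ne]; first exact: h1.
by rewrite -ha; apply: h2; rewrite (inj_eq hi).
Qed.

Theorem theorem4 (R : realType) :
  exists C : sgraph -> Prop,
    [/\ hereditary C,
        fpt_model_checking C,
        ~ bounded_twin_width C,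
        ~ bounded_merge_width C
      & forall H : sgraph, connected_graph H -> at_least_two_cycles H ->
          forall G : sgraph, C G -> Hgraph R H G].
Proof.
have self n : girth_class (girth_graph n).
  by exists n, id; split.
have Bgt1 n : 1 < #|{: bvert n}|.
  by apply/card_gt1P; exists (false, 1%g), (true, 1%g).
exists girth_class; split.
- move=> G G' [n [h [hi ha]]] [g [gi ga]]; exists n, (h \o g).
  by split=> [|x y]; [apply: inj_comp|rewrite ha].
- exact: girth_class_fpt.
(* One more than the degree that twin-width at most [k] permits. *)
- move=> [k hk]; set n := (k.+2 * k.+2).+2.
  have := tww_flip (Bgt1 n) (@incident_degree n) (@other_endP n) (@incident_linear n) (hk _ (self n)).
  by rewrite ltnn.
- move=> [f hf]; set n := (2 * (f 2 * (f 2).+1)).+2.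
  have := mw_flip (Bgt1 n) (@incident_degree n) (@other_endP n) (@incident_linear n) (hf 2 _ (self n)).
  by rewrite ltnn.
move=> H cH cyc G [n GG]; have [u1 [v1 [u2 [v2 [a1 a2 ne conn]]]]] := two_removable_edges cH cyc.
exact: Hgraph_hereditary (Hgraph_girth R a1 a2 ne conn n u1) GG.
Qed.
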